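(* Let $\rho$ be a function norm over a finite measure space $(\Omega,\Sigma,\mu)$. Suppose that $L_2(\mu)\subseteq L_\rho$ and that $L_\rho$ has Rademacher cotype $2$. Let $\Psi=(\psi_n)_{n=1}^\infty$ be a semi-normalized complemented unconditional basic sequence in $L_\rho$ with projecting functionals $\Psi^*=(\psi_n^* )_{n=1}^\infty$, regarded as functions in $L_{\rho^*}$. (i) If $\inf_n\|\psi_n^*\|_2>0$, then $\Psi$ is equivalent to the unit vector system of $\ell_2$. (ii) If $\inf_n\|\psi_n^*\|_2=0$, then $\Psi$ has a subsequence equivalent to a well-complemented basic sequence $\Phi=(\phi_n)_{n=1}^\infty$ in $L_\rho$ escaping to infinity; moreover, both $\Phi$ and a sequence $\Phi^*$ of good projecting functionals for $\Phi$ consist of simple functions. If, in addition, $\rho^*$ is absolutely continuous, then $\Phi$ can be chosen congruent to a subsequence of $\Psi$ and $\Phi^*$ can be chosen escaping to infinity.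
   Context: Let $(\Omega,\Sigma,\mu)$ be a $\sigma$-finite measure space, $\mathbb F$ the real or complex field, $L_0(\mu)$ the space of $\mathbb F$-valued measurable functions and $L_0^+(\mu)$ the cone of measurable functions with values in $[0,\infty]$ (functions equal a.e. are identified). A function norm over $(\Omega,\Sigma,\mu)$ is a map $\rho\colon L_0^+(\mu)\to[0,\infty]$ such that: (a) $\rho(f)=0$ iff $f=0$ a.e.; (b) $\rho(f+g)\le\rho(f)+\rho(g)$; (c) $\rho(tf)=t\rho(f)$ for $t\ge 0$; (d) $\rho(f)\le\rho(g)$ if $f\le g$ a.e.; (e) $\rho(\chi_E)<\infty$ if $\mu(E)<\infty$; (f) $\rho(\lim_n f_n)=\lim_n\rho(f_n)$ for every non-decreasing sequence $(f_n)$ in $L_0^+(\mu)$; (g) for every $E$ with $\mu(E)<\infty$ there is a constant $C_E$ with $\int_E f\,d\mu\le C_E\rho(f)$ for all $f\in L_0^+(\mu)$. Put $L_\rho=\{f\in L_0(\mu):\rho(|f|)<\infty\}$, a Banach lattice with norm $\|f\|_\rho=\rho(|f|)$. The function norm $\rho^*$ is $\rho^*(f)=\sup\{\int_\Omega fg\,d\mu: g\in L_0^+(\mu),\ \rho(g)\le 1\}$. On a finite measure space, $\rho$ is absolutely continuous if $\lim_n\rho(f\chi_{A_n})=0$ whenever $\rho(f)<\infty$ and $(A_n)$ is a non-increasing sequence in $\Sigma$ with $\mu(A_n)\to 0$. If $\rho$ is absolutely continuous (which is automatic when $L_\rho$ has finite cotype), the pairing $\langle g,f\rangle=\int_\Omega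 gf\,d\mu$ identifies $(L_\rho)^*$ isometrically with $L_{\rho^*}$. A basic sequence is a sequence that is a Schauder basis of its closed linear span; it is unconditional if every rearrangement is a basic sequence; semi-normalized if its norms are bounded above and away from $0$; complemented if its closed linear span is the range of a bounded projection. If $(x_n)$ is a complemented unconditional basic sequence in $U$, a sequence of projecting functionals for it is $(z_n^*\circ P)_n$, where $P$ is a bounded projection of $U$ onto the closed span $X$ of $(x_n)$ and $(z_n^* )$ in $X^*$ are the coordinate functionals of $(x_n)$. Two sequences are equivalent if there is an isomorphism between their closed linear spans mapping one to the other termwise; two sequences in $U$ are congruent if an automorphism of $U$ maps one to the other termwise. For absolutely continuous $\rho$, a sequence $\Phi$ of nonzero functions in $L_\rho$ is a well-complemented basic sequence if it is pairwise disjointly supported, complemented, and has a sequence $\Phi^*$ of projecting functionals which, as functions in $L_{\rho^*}$, are pairwise disjointly supported; such a $\Phi^*$ is called a sequence of good projecting functionals for $\Phi$. With $\operatorname{supp}(f)=\Omega\setminus f^{-1}(0)$, a sequence $(f_n)$ in $L_0(\mu)$ escapes to infinity if $\lim_n\operatorname{ess\,inf}\{|f_n(\omega)|:\omega\in\operatorname{supp}(f_n)\}=\infty$. *)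

(* Defs.v *)
From HB Require Import structures.
From mathcomp Require Import all_boot all_order all_algebra.
From mathcomp Require Import generic_quotient ring_quotient.
From mathcomp Require Import all_classical all_reals all_analysis.
From mathcomp Require Import measurable_realfun ess_sup_inf.
From mathcomp Require Import complex.

Set Implicit Arguments.
Unset Strict Implicit.
Unset Printing Implicit Defensive.

Import Order.TTheory GRing.Theory Num.Theory.
Import numFieldNormedType.Exports.

Local Open Scope classical_set_scope.
Local Open Scope ring_scope.

Inductive scalar_kind := RealScalars | ComplexScalars.

Definition scalar_field (R : realType) (k : scalar_kind) : numFieldType :=
  match k with
  | RealScalars => R
  | ComplexScalars => R[i]
  end.

Section scalars.
Context {R : realType} {k : scalar_kind}.
Local Notation K := (scalar_field R k).

Definition sc_re : K -> R :=
  match k return scalar_field R k -> R with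
  | RealScalars => fun x => x
  | ComplexScalars => fun z => complex.Re z
  end.

Definition sc_im : K -> R :=
  match k return scalar_field R k -> R with
  | RealScalars => fun=> 0
  | ComplexScalars => fun z => complex.Im z
  end.

Definition sc_mk (a b : R) : K :=
  match k return scalar_field R k with
  | RealScalars => a
  | ComplexScalars => (a +i* b)%C
  end.

(* The norm [`|z|] of a numFieldType is a (real) element of the field itself;
   [modulus z] is that number as an element of [R]. *)
Definition modulus (z : K) : R := sc_re `|z|.

End scalars.
Arguments sc_mk {R} k a b.

Section scalar_lemmas.
Context (R : realType) (k : scalar_kind).
Local Notation K := (scalar_field R k).

Lemma sc_re0 : sc_re (0 : K) = 0. Proof. by case: k. Qed.
Lemma sc_im0 : sc_im (0 : K) = 0. Proof. by case: k. Qed.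

Lemma sc_reD (x y : K) : sc_re (x + y) = sc_re x + sc_re y.
Proof. by move: x y; case: k => //= -[a b] [c e]. Qed.

Lemma sc_imD (x y : K) : sc_im (x + y) = sc_im x + sc_im y.
Proof. by move: x y; case: k => /= [x y|[a b] [c e]] //; rewrite addr0. Qed.

Lemma sc_reM (x y : K) :
  sc_re (x * y) = sc_re x * sc_re y - sc_im x * sc_im y.
Proof.
by move: x y; case: k => /= [x y|[a b] [c e]] //; rewrite mulr0 subr0.
Qed.

Lemma sc_imM (x y : K) :
  sc_im (x * y) = sc_re x * sc_im y + sc_im x * sc_re y.
Proof.
by move: x y; case: k => /= [x y|[a b] [c e]] //; rewrite mulr0 mul0r addr0.
Qed.

Lemma modulusE (x : K) : modulus x = Num.sqrt (sc_re x ^+ 2 + sc_im x ^+ 2).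
Proof.
move: x; rewrite /modulus; case: k => /= [x|[a b]] //.
by rewrite expr0n /= addr0 sqrtr_sqr.
Qed.

Lemma modulus_ge0 (x : K) : 0 <= modulus x.
Proof. by rewrite modulusE sqrtr_ge0. Qed.

Lemma mk_modulus (x : K) : sc_mk k (modulus x) 0 = `|x|.
Proof. by move: x; rewrite /modulus; case: k => /= [x|[a b]]. Qed.

Lemma sc_mkD (a b : R) : sc_mk k (a + b) 0 = sc_mk k a 0 + sc_mk k b 0.
Proof.
by case: k => //=; apply/eqP; rewrite eq_complex /= addr0 !eqxx.
Qed.

Lemma sc_mkM (a b : R) : sc_mk k (a * b) 0 = sc_mk k a 0 * sc_mk k b 0.
Proof.
case: k => //=; apply/eqP; rewrite eq_complex /=.
by rewrite !mulr0 !mul0r subr0 addr0 !eqxx.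
Qed.

Lemma sc_mk_le (a b : R) : (sc_mk k a 0 <= sc_mk k b 0) = (a <= b).
Proof. by case: k => //=; rewrite lecE /= eqxx. Qed.

Lemma sc_mk0 : sc_mk k (0 : R) 0 = 0. Proof. by case: k. Qed.

Lemma sc_mk_inj (a b : R) : sc_mk k a 0 = sc_mk k b 0 -> a = b.
Proof. by move/eqP; rewrite eq_le !sc_mk_le -eq_le => /eqP. Qed.

Lemma modulusD (x y : K) : modulus (x + y) <= modulus x + modulus y.
Proof. by rewrite -sc_mk_le sc_mkD !mk_modulus ler_normD. Qed.

Lemma modulusM (x y : K) : modulus (x * y) = modulus x * modulus y.
Proof. by apply: sc_mk_inj; rewrite sc_mkM !mk_modulus normrM. Qed.

Lemma modulus0 : modulus (0 : K) = 0.
Proof. by apply: sc_mk_inj; rewrite mk_modulus normr0 sc_mk0. Qed.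

Lemma modulus_eq0 (x : K) : modulus x = 0 -> x = 0.
Proof. by move=> h; apply/eqP; rewrite -normr_eq0 -mk_modulus h sc_mk0. Qed.

End scalar_lemmas.

Section measurable_functions.
Context {d : measure_display} {T : measurableType d} {R : realType}.
Context {k : scalar_kind}.
Local Notation K := (scalar_field R k).

Definition sc_measurable (f : T -> K) : Prop :=
  measurable_fun [set: T] (sc_re \o f) /\
  measurable_fun [set: T] (sc_im \o f).

Definition eabs (f : T -> K) : T -> \bar R := fun x => (modulus (f x))%:E.

Definition sc_integral (mu : {measure set T -> \bar R}) (f : T -> K) : K :=
  sc_mk k (\int[mu]_x sc_re (f x)) (\int[mu]_x sc_im (f x)).

Definition pairing (mu : {measure set T -> \bar R}) (g f : T -> K) : K :=
  sc_integral mu (fun x => g x * f x).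

Definition nneg_measurable (f : T -> \bar R) : Prop :=
  measurable_fun [set: T] f /\ (forall x, (0 <= f x)%E).

Lemma sc_measurable0 : sc_measurable (fun=> 0).
Proof.
split; [rewrite (_ : _ \o _ = cst 0)//|rewrite (_ : _ \o _ = cst 0)//];
  by apply/funext => x /=; rewrite ?sc_re0 ?sc_im0.
Qed.

Lemma sc_measurableD (f g : T -> K) :
  sc_measurable f -> sc_measurable g -> sc_measurable (fun x => f x + g x).
Proof.
move=> [fr fi] [gr gi]; split.
- rewrite (_ : _ \o _ = (sc_re \o f) \+ (sc_re \o g)); last first.
    by apply/funext => x /=; rewrite sc_reD.
  exact: measurable_funD.
- rewrite (_ : _ \o _ = (sc_im \o f) \+ (sc_im \o g)); last first.
    by apply/funext => x /=; rewrite sc_imD.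
  exact: measurable_funD.
Qed.

Lemma sc_measurableZ (a : K) (f : T -> K) :
  sc_measurable f -> sc_measurable (fun x => a * f x).
Proof.
move=> [fr fi]; split.
- rewrite (_ : _ \o _ = (fun x => sc_re a * (sc_re \o f) x)
                     \- (fun x => sc_im a * (sc_im \o f) x)); last first.
    by apply/funext => x /=; rewrite sc_reM.
  by apply: measurable_funB; apply: measurable_funM.
- rewrite (_ : _ \o _ = (fun x => sc_re a * (sc_im \o f) x)
                     \+ (fun x => sc_im a * (sc_re \o f) x)); last first.
    by apply/funext => x /=; rewrite sc_imM.
  by apply: measurable_funD; apply: measurable_funM.
Qed.

Lemma nneg_measurable_eabs (f : T -> K) :
  sc_measurable f -> nneg_measurable (eabs f).
Proof.
move=> [fr fi]; split; last by move=> x; rewrite lee_fin modulus_ge0.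
apply/measurable_EFinP; rewrite (_ : (fun _ => _) =
  Num.sqrt \o (fun x => (sc_re \o f) x ^+ 2 + (sc_im \o f) x ^+ 2)); last first.
  by apply/funext => x /=; rewrite modulusE.
apply: measurableT_comp.
  by apply: continuous_measurable_fun; exact: sqrt_continuous.
by apply: measurable_funD; apply: measurable_funX.
Qed.

End measurable_functions.

Section function_norms.
Context {d : measure_display} {T : measurableType d} {R : realType}.
Variable mu : {measure set T -> \bar R}.
Local Open Scope ereal_scope.

(* A function norm is only constrained on [nneg_measurable] functions.  By
   monotonicity it is compatible with a.e. equality there, which is why a
   pointwise non-decreasing sequence can be used in [fnorm_lim]. *)
Record function_norm := FunctionNorm {
  fnorm :> (T -> \bar R) -> \bar R;
  fnorm_ge0 : forall f, nneg_measurable f -> 0 <= fnorm f;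
  fnorm_eq0 : forall f, nneg_measurable f ->
    (fnorm f = 0 <-> {ae mu, forall x, f x = 0});
  fnormD : forall f g, nneg_measurable f -> nneg_measurable g ->
    fnorm (fun x => f x + g x) <= fnorm f + fnorm g;
  fnormZ : forall (t : R) f, (0 <= t)%R -> nneg_measurable f ->
    fnorm (fun x => t%:E * f x) = t%:E * fnorm f;
  le_fnorm : forall f g, nneg_measurable f -> nneg_measurable g ->
    {ae mu, forall x, f x <= g x} -> fnorm f <= fnorm g;
  fnorm_indic : forall E, measurable E -> mu E < +oo ->
    fnorm (EFin \o \1_E) < +oo;
  fnorm_lim : forall f : nat -> T -> \bar R,
    (forall n, nneg_measurable (f n)) ->
    (forall x, nondecreasing_seq (f ^~ x)) ->
    fnorm (fun x => limn (f ^~ x)) = limn (fun n => fnorm (f n));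
  fnorm_integral : forall E, measurable E -> mu E < +oo ->
    exists C : R, forall f, nneg_measurable f ->
      \int[mu]_(x in E) f x <= C%:E * fnorm f
}.

Definition assoc_fnorm (rho : (T -> \bar R) -> \bar R) : (T -> \bar R) -> \bar R :=
  fun f => ereal_sup [set \int[mu]_x (f x * g x) |
                       g in [set g | nneg_measurable g /\ rho g <= 1]].

(* Only meaningful as a definition when [mu] is finite. *)
Definition absolutely_continuous_fnorm (rho : (T -> \bar R) -> \bar R) : Prop :=
  forall (f : T -> \bar R) (A : nat -> set T),
    nneg_measurable f -> rho f < +oo ->
    (forall n, measurable (A n)) -> nonincreasing_seq A ->
    mu (A n) @[n --> \oo] --> 0 ->
    rho (fun x => f x * (\1_(A n) x)%:E) @[n --> \oo] --> 0.

Definition norm2 : (T -> \bar R) -> \bar R := Lnorm mu 2%:E.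

Definition in_L (k : scalar_kind) (rho : (T -> \bar R) -> \bar R)
    (f : T -> scalar_field R k) : Prop :=
  sc_measurable f /\ rho (eabs f) < +oo.

End function_norms.

Section Lrho.
Context {d : measure_display} {T : measurableType d} {R : realType}.
Variables (k : scalar_kind) (mu : {measure set T -> \bar R}).
Variable rho : function_norm mu.
Local Notation K := (scalar_field R k).

Definition rfun_pred : {pred T -> K^o} := fun f => `[< in_L rho f >].

Lemma eabs_nneg (f : T -> K) : in_L rho f -> nneg_measurable (eabs f).
Proof. by case=> mf _; exact: nneg_measurable_eabs. Qed.

Lemma fnorm_eabsD (f g : T -> K) : in_L rho f -> in_L rho g ->
  (rho (eabs (fun x => f x + g x)%R) <= rho (eabs f) + rho (eabs g))%E.
Proof.
move=> Lf Lg; have [nf ng] := (eabs_nneg Lf, eabs_nneg Lg).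
apply: le_trans (fnormD rho nf ng); apply: le_fnorm.
- by apply: nneg_measurable_eabs; apply: sc_measurableD; [case: Lf|case: Lg].
- split; first by apply: emeasurable_funD; [case: nf|case: ng].
  by move=> x; rewrite adde_ge0//; [case: nf|case: ng].
- by apply/nearW => x; rewrite /eabs -EFinD lee_fin modulusD.
Qed.

Lemma fnorm_eabsZ (a : K) (f : T -> K) : in_L rho f ->
  rho (eabs (fun x => a * f x)) = ((modulus a)%:E * rho (eabs f))%E.
Proof.
move=> Lf; rewrite -fnormZ ?modulus_ge0//; last exact: eabs_nneg.
by congr (rho _); apply/funext => x; rewrite /eabs modulusM EFinM.
Qed.

Lemma rfun_submod_closed : submod_closed rfun_pred.
Proof.
split=> [|a f g].
  apply/asboolP; split; first exact: sc_measurable0.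
  have -> : eabs (0 : T -> K^o) = (fun x => 0%:E * cst 0%E x)%E.
    by apply/funext => x; rewrite /eabs mul0e /=; congr EFin; exact: modulus0.
  by rewrite fnormZ// mul0e.
move=> /asboolP Lf /asboolP Lg.
have maf : sc_measurable (fun x => a * f x) by apply: sc_measurableZ; case: Lf.
have Laf : in_L rho (fun x => a * f x).
  split=> //; rewrite fnorm_eabsZ//.
  by apply: lte_mul_pinfty; rewrite ?lee_fin ?modulus_ge0//; case: Lf.
apply/asboolP; split; first by apply: sc_measurableD => //; case: Lg.
apply: le_lt_trans (fnorm_eabsD Laf Lg) _.
by rewrite lte_add_pinfty//; [case: Laf|case: Lg].
Qed.

HB.instance Definition _ :=
  GRing.isSubmodClosed.Build K (T -> K^o) rfun_pred rfun_submod_closed.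

Record rfun := MkRfun { rfun_val :> T -> K^o; _ : rfun_val \in rfun_pred }.

HB.instance Definition _ := [isSub for rfun_val].
HB.instance Definition _ := [Choice of rfun by <:].
HB.instance Definition _ := [SubChoice_isSubLmodule of rfun by <:].

Lemma rfunP (f : rfun) : in_L rho f.
Proof. by case: f => f /= /asboolP. Qed.

Definition rfun_norm (f : rfun) : R := fine (rho (eabs f)).

Lemma rfun_normE (f : rfun) : (rfun_norm f)%:E = rho (eabs f).
Proof.
rewrite /rfun_norm fineK// ge0_fin_numE; first by case: (rfunP f).
by apply: fnorm_ge0; apply: eabs_nneg; exact: rfunP.
Qed.

Lemma rfun_norm_ge0 f : 0 <= rfun_norm f.
Proof.
rewrite -lee_fin rfun_normE; apply: fnorm_ge0.
by apply: eabs_nneg; exact: rfunP.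
Qed.

Lemma rfun_normD f g : rfun_norm (f + g) <= rfun_norm f + rfun_norm g.
Proof.
by rewrite -lee_fin EFinD !rfun_normE; apply: fnorm_eabsD; exact: rfunP.
Qed.

Lemma rfun_normZ a f : rfun_norm (a *: f) = modulus a * rfun_norm f.
Proof.
by apply: EFin_inj; rewrite EFinM !rfun_normE; apply: fnorm_eabsZ; exact: rfunP.
Qed.

Definition null_pred : {pred rfun} :=
  fun f => `[< {ae mu, forall x, f x = 0} >].

Lemma null_predP f : reflect (rfun_norm f = 0) (f \in null_pred).
Proof.
have nf : nneg_measurable (eabs f) by apply: eabs_nneg; exact: rfunP.
apply: (iffP (asboolP _)).
  move=> f0; apply: EFin_inj; rewrite rfun_normE; apply/(fnorm_eq0 rho nf).
  by apply: filterS f0 => x fx; rewrite /eabs fx modulus0.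
move=> f0; have := rfun_normE f; rewrite f0 => /esym/(fnorm_eq0 rho nf).
by apply: filterS => x [] /modulus_eq0.
Qed.

Lemma rfun_normN f : rfun_norm (- f) = rfun_norm f.
Proof.
rewrite -scaleN1r rfun_normZ (_ : modulus _ = 1) ?mul1r//.
by apply: (@sc_mk_inj _ k); rewrite mk_modulus normrN1; case: (k).
Qed.

Lemma null_zmod_closed : zmod_closed null_pred.
Proof.
split=> [|f g /null_predP f0 /null_predP g0]; apply/null_predP.
  by rewrite -(scale0r 0) rfun_normZ modulus0 mul0r.
apply/eqP; rewrite eq_le rfun_norm_ge0 andbT.
by apply: le_trans (rfun_normD _ _) _; rewrite rfun_normN f0 g0 addr0.
Qed.

HB.instance Definition _ :=
  GRing.isZmodClosed.Build rfun null_pred null_zmod_closed.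

Local Open Scope quotient_scope.

Definition Lrho : Type := @Quotient.quot rfun null_pred.

HB.instance Definition _ := GRing.Zmodule.on Lrho.
HB.instance Definition _ := EqQuotient.on Lrho.

Definition Lclass (f : rfun) : Lrho := \pi_Lrho f.

(* A representative of the class; only its a.e. properties are meaningful. *)
Definition Lrepr (u : Lrho) : rfun := repr u.
Definition Lrho_fun (u : Lrho) : T -> K := Lrepr u.
Coercion Lrho_fun : Lrho >-> Funclass.

Lemma LreprK u : Lclass (Lrepr u) = u.
Proof. exact: reprK. Qed.

Lemma Lclass_eq f g : Lclass f = Lclass g <-> rfun_norm (f - g) = 0.
Proof.
split=> [/eqP|fg].
  by rewrite /Lclass -Quotient.idealrBE => /null_predP.
by apply/eqP; rewrite /Lclass -Quotient.idealrBE; apply/null_predP.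
Qed.

Lemma LclassD f g : Lclass (f + g) = Lclass f + Lclass g.
Proof. exact: (@Quotient.pi_add _ null_pred). Qed.

Definition Lscale (a : K) (u : Lrho) : Lrho := Lclass (a *: Lrepr u).

Lemma LclassZ a f : Lscale a (Lclass f) = Lclass (a *: f).
Proof.
apply/Lclass_eq; rewrite -scalerBr rfun_normZ.
by have /Lclass_eq -> := LreprK (Lclass f); rewrite mulr0.
Qed.

Lemma LscaleA a b u : Lscale a (Lscale b u) = Lscale (a * b) u.
Proof. by rewrite -(LreprK u) !LclassZ scalerA. Qed.

Lemma Lscale1 : left_id 1 Lscale.
Proof. by move=> u; rewrite -(LreprK u) !LclassZ scale1r. Qed.

Lemma LscaleDr : right_distributive Lscale +%R.
Proof.
move=> a u v; rewrite -(LreprK u) -(LreprK v) -LclassD !LclassZ.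
by rewrite scalerDr LclassD.
Qed.

Lemma LscaleDl u : {morph Lscale^~ u : a b / a + b}.
Proof. by move=> a b; rewrite -(LreprK u) !LclassZ scalerDl LclassD. Qed.

HB.instance Definition _ :=
  GRing.Zmodule_isLmodule.Build K Lrho LscaleA Lscale1 LscaleDr LscaleDl.

Definition Lrho_norm (u : Lrho) : K := sc_mk k (rfun_norm (Lrepr u)) 0.

Lemma Lrho_norm_class f : Lrho_norm (Lclass f) = sc_mk k (rfun_norm f) 0.
Proof.
congr sc_mk; have /Lclass_eq e1 := LreprK (Lclass f).
have e2 : rfun_norm (f - Lrepr (Lclass f)) = 0 by rewrite -rfun_normN opprB.
apply/eqP; rewrite eq_le; apply/andP; split.
  rewrite -{1}(subrK f (Lrepr _)); apply: le_trans (rfun_normD _ _) _.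
  by rewrite e1 add0r.
rewrite -{1}(subrK (Lrepr (Lclass f)) f); apply: le_trans (rfun_normD _ _) _.
by rewrite e2 add0r.
Qed.

Lemma Lrho_normD u v : Lrho_norm (u + v) <= Lrho_norm u + Lrho_norm v.
Proof.
rewrite -(LreprK u) -(LreprK v) -LclassD !Lrho_norm_class -sc_mkD sc_mk_le.
exact: rfun_normD.
Qed.

Lemma Lrho_normZ a u : Lrho_norm (a *: u) = `|a| * Lrho_norm u.
Proof.
rewrite -(LreprK u) (_ : a *: _ = Lclass (a *: Lrepr u)); last exact: LclassZ.
by rewrite !Lrho_norm_class rfun_normZ sc_mkM mk_modulus.
Qed.

Lemma Lrho_norm_eq0 u : Lrho_norm u = 0 -> u = 0.
Proof.
rewrite -sc_mk0 => /sc_mk_inj u0; rewrite -(LreprK u).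
have -> : 0 = Lclass 0 :> Lrho.
  by rewrite -(addr0 (Lclass 0)) -{2}(subrr (Lclass 0)) addrA -LclassD addr0 subrr.
by apply/Lclass_eq; rewrite subr0.
Qed.

HB.instance Definition _ := Lmodule_isNormed.Build K Lrho
  Lrho_normD Lrho_normZ Lrho_norm_eq0.

End Lrho.
Arguments Lrho {d T R} k {mu} rho.

Section norm2.
Context {d : measure_display} {T : measurableType d} {R : realType}.
Variable mu : {measure set T -> \bar R}.
Local Open Scope ereal_scope.
Implicit Types f g : T -> \bar R.

Let sq f := fun x => `|f x| `^ 2.

Let norm2E f : norm2 mu f = (\int[mu]_x sq f x) `^ 2^-1.
Proof. by rewrite /norm2 unlock. Qed.

Let sq_int f : norm2 mu f `^ 2 = \int[mu]_x sq f x.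
Proof. by rewrite /norm2 poweR_Lnorm. Qed.

Let norm2_ge0 f : 0 <= norm2 mu f. Proof. exact: Lnorm_ge0. Qed.

Let nneg_sq f : nneg_measurable f -> nneg_measurable (sq f).
Proof.
move=> [mf f0]; split; last by move=> x; exact: poweR_ge0.
apply: (@measurableT_comp _ _ _ _ _ _ (poweR^~ 2%R) _ (abse \o f)).
  exact: measurable_poweR.
exact: measurableT_comp.
Qed.

Let poweR_le (r : R) (x y : \bar R) : (0 <= r)%R -> 0 <= x -> x <= y ->
  x `^ r <= y `^ r.
Proof.
move=> r0 x0 xy; apply: gt0_ler_poweR => //; rewrite in_itv /= leey andbT//.
exact: le_trans xy.
Qed.

Let poweR_limn (r : R) (u : (\bar R)^nat) : (0 < r)%R ->
  (forall n, 0 <= u n) -> nondecreasing_seq u ->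
  limn (fun n => u n `^ r) = (limn u) `^ r.
Proof.
move=> r0 u0 nu.
have nur : nondecreasing_seq (fun n => u n `^ r).
  by move=> m n mn; apply: poweR_le => //; [exact: ltW|exact: nu].
have ul n : u n <= limn u.
  by rewrite (cvg_lim _ (ereal_nondecreasing_cvgn nu))//; apply: ereal_sup_ubound; exists n.
have url n : u n `^ r <= limn (fun n => u n `^ r).
  by rewrite (cvg_lim _ (ereal_nondecreasing_cvgn nur))//; apply: ereal_sup_ubound; exists n.
have limu0 : 0 <= limn u by apply: le_trans (ul 0%N).
have limur0 : 0 <= limn (fun n => u n `^ r).
  by apply: le_trans (url 0%N); exact: poweR_ge0.
apply/eqP; rewrite eq_le; apply/andP; split.
  apply: lime_le; first exact: ereal_nondecreasing_is_cvgn.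
  by apply: nearW => n; apply: poweR_le => //; exact: ltW.
have -> : limn (fun n => u n `^ r) = (limn (fun n => u n `^ r) `^ r^-1) `^ r.
  by rewrite -poweRrM mulVf ?poweRe1// gt_eqF.
apply: poweR_le => //; first exact: ltW.
apply: lime_le; first exact: ereal_nondecreasing_is_cvgn.
apply: nearW => n; have -> : u n = (u n `^ r) `^ r^-1.
  by rewrite -poweRrM mulfV ?poweRe1// gt_eqF.
by apply: poweR_le => //; [rewrite invr_ge0 ltW|exact: poweR_ge0].
Qed.

Let le_norm2 f g : nneg_measurable f -> nneg_measurable g ->
  {ae mu, forall x, f x <= g x} -> norm2 mu f <= norm2 mu g.
Proof.
move=> nf ng fg; rewrite !norm2E; apply: poweR_le => //.
  by apply: integral_ge0 => x _; exact: poweR_ge0.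
have [msf sf0] := nneg_sq nf; have [msg sg0] := nneg_sq ng.
have mM : measurable_fun setT (fun x => maxe (sq f x) (sq g x)).
  exact: measurable_maxe.
apply: (@le_trans _ _ (\int[mu]_x (maxe (sq f x) (sq g x)))).
  apply: ge0_le_integral => //.
  by move=> x _; rewrite le_max lexx.
rewrite le_eqVlt; apply/orP; left; apply/eqP.
apply: ae_eq_integral => //; apply: filterS fg => x fgx _.
apply/max_idPr; apply: poweR_le => //.
by rewrite !gee0_abs//; [case: ng|case: nf].
Qed.

Let norm2_eq0 f : nneg_measurable f ->
  (norm2 mu f = 0 <-> {ae mu, forall x, f x = 0}).
Proof.
move=> nf; split=> [f0|f0].
  have [mf _] := nf.
  have f0' := @Lnorm_eq0_eq0 _ _ _ _ f 2%:E mf _ f0.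
  have {f0'} : f = \0 %[ae mu] by apply: f0'; rewrite lte_fin.
  by apply: filterS => x /(_ I).
have n0 : nneg_measurable (cst 0 : T -> \bar R) by split.
have -> : 0 = norm2 mu (cst 0) by rewrite /norm2 Lnorm0// eqe.
apply/eqP; rewrite eq_le !le_norm2//; apply: filterS f0 => x /= ->//.
Qed.

Let ae_norm2 f g : nneg_measurable f -> nneg_measurable g ->
  {ae mu, forall x, f x = g x} -> norm2 mu f = norm2 mu g.
Proof.
move=> nf ng fg; apply/eqP; rewrite eq_le !le_norm2//;
  by apply: filterS fg => x ->.
Qed.

Let nneg_fine f : nneg_measurable f ->
  nneg_measurable (fun x => (fine (f x))%:E).
Proof.
move=> [mf f0]; split; last by move=> x; rewrite lee_fin fine_ge0.
by apply/measurable_EFinP; exact: measurableT_comp.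
Qed.

Let norm2_fin_ae f : nneg_measurable f -> norm2 mu f < +oo ->
  {ae mu, forall x, f x = (fine (f x))%:E}.
Proof.
move=> nf foo; have [msf sf0] := nneg_sq nf.
have isf : mu.-integrable setT (sq f).
  apply/integrableP; split=> //.
  under eq_integral do rewrite gee0_abs//.
  by rewrite -sq_int; exact: poweR_lty.
have := integrable_ae measurableT isf; apply: filterS => x /(_ I).
rewrite ge0_fin_numE// => /lty_poweRy sfx.
by rewrite fineK// -abse_fin_num ge0_fin_numE ?abse_ge0// sfx// gt_eqF.
Qed.

Let norm2D f g : nneg_measurable f -> nneg_measurable g ->
  norm2 mu (fun x => f x + g x) <= norm2 mu f + norm2 mu g.
Proof.
move=> nf ng; have [mf f0] := nf; have [mg g0] := ng.
have nfg : nneg_measurable (fun x => f x + g x).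
  by split=> [|x]; [exact: emeasurable_funD|exact: adde_ge0].
have [->|foo] := eqVneq (norm2 mu f) +oo.
  by rewrite addye ?leey// gt_eqF// (lt_le_trans _ (norm2_ge0 _)).
have [->|goo] := eqVneq (norm2 mu g) +oo.
  by rewrite addey ?leey// gt_eqF// (lt_le_trans _ (norm2_ge0 _)).
rewrite -ltey in foo; rewrite -ltey in goo.
have [aef aeg] := (norm2_fin_ae nf foo, norm2_fin_ae ng goo).
have [nf' ng'] := (nneg_fine nf, nneg_fine ng).
rewrite (ae_norm2 nf nf')// (ae_norm2 ng ng')//.
rewrite (@ae_norm2 _ (EFin \o ((fine \o f) \+ (fine \o g))%R))//.
- apply: minkowski_EFin; [exact: measurableT_comp|exact: measurableT_comp|].
  by rewrite ler1n.
- split; last by move=> x; rewrite lee_fin addr_ge0// fine_ge0.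
  by apply/measurable_EFinP; apply: measurable_funD; exact: measurableT_comp.
- by apply: filterS2 aef aeg => x fx gx; rewrite /= EFinD -fx -gx.
Qed.

Let norm2Z (t : R) f : (0 <= t)%R -> nneg_measurable f ->
  norm2 mu (fun x => t%:E * f x) = t%:E * norm2 mu f.
Proof.
move=> t0 nf; have [msf sf0] := nneg_sq nf; rewrite !norm2E.
transitivity ((\int[mu]_x ((t `^ 2)%:E * sq f x)) `^ 2^-1).
  congr (_ `^ _); apply: eq_integral => x _.
  rewrite /sq abseM poweRM ?abse_ge0// -poweR_EFin; congr (_ `^ _ * _).
  by rewrite gee0_abs.
rewrite ge0_integralZl// ?lee_fin ?powR_ge0// poweRM ?lee_fin ?powR_ge0//.
  by rewrite -poweR_EFin -poweRrM mulfV// poweRe1.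
exact: integral_ge0.
Qed.

Let norm2_indic E : measurable E -> mu E < +oo ->
  norm2 mu (EFin \o \1_E) < +oo.
Proof.
move=> mE Eoo; rewrite norm2E; apply: poweR_lty.
rewrite (_ : \int[mu]_x _ = mu E)//.
rewrite -[in RHS](setIT E) -integral_indic//; apply: eq_integral => x _.
rewrite /sq /= indicE; case: (x \in E) => /=; rewrite ?normr1 ?normr0.
  by rewrite powR1.
by rewrite powR0.
Qed.

Let norm2_lim (f : nat -> T -> \bar R) :
  (forall n, nneg_measurable (f n)) ->
  (forall x, nondecreasing_seq (f ^~ x)) ->
  norm2 mu (fun x => limn (f ^~ x)) = limn (fun n => norm2 mu (f n)).
Proof.
move=> nf ndf; rewrite norm2E.
have f0 n x : 0 <= f n x by case: (nf n).
have l0 x : 0 <= limn (f ^~ x).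
  apply: lime_ge; first exact: ereal_nondecreasing_is_cvgn.
  by apply: nearW => n; exact: f0.
have -> : sq (fun x => limn (f ^~ x)) = fun x => limn (fun n => sq (f n) x).
  apply/funext => x; rewrite /sq gee0_abs// -poweR_limn//.
  by apply: congr_lim; apply/funext => n; rewrite gee0_abs.
rewrite monotone_convergence//; last first.
- move=> x _ m n mn; rewrite /sq !gee0_abs//; apply: poweR_le => //.
  exact: ndf.
- by move=> n x _; exact: poweR_ge0.
- by move=> n; case: (nneg_sq (nf n)).
rewrite -poweR_limn ?invr_gt0//.
- by apply: congr_lim; apply/funext => n; rewrite norm2E.
- by move=> n; apply: integral_ge0 => x _; exact: poweR_ge0.
- move=> m n mn; apply: ge0_le_integral => //.
  + by move=> x _; exact: poweR_ge0.
  + by case: (nneg_sq (nf m)).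
  + by case: (nneg_sq (nf n)).
  + move=> x _; rewrite /sq !gee0_abs//; apply: poweR_le => //.
    exact: ndf.
Qed.

Let norm2_integral E : measurable E -> mu E < +oo ->
  exists C : R, forall f, nneg_measurable f ->
    \int[mu]_(x in E) f x <= C%:E * norm2 mu f.
Proof.
move=> mE Eoo; exists (fine (norm2 mu (EFin \o \1_E)) + 1)%R => f nf.
have [mf f0] := nf.
have [foo|foo] := eqVneq (norm2 mu f) +oo.
  rewrite foo gt0_muley ?leey// lte_fin ltr_wpDl//.
  by apply: fine_ge0; exact: norm2_ge0.
rewrite -ltey in foo.
have aef := norm2_fin_ae nf foo; have nf' := nneg_fine nf; have [mf' f'0] := nf'.
have -> : \int[mu]_(x in E) f x = 'N[mu]_1[EFin \o ((fine \o f) \* \1_E)%R].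
  rewrite Lnorm1 integral_mkcond; apply: ae_eq_integral => //.
  - by apply/(measurable_restrictT _ mE).1; exact: measurable_funTS.
  - apply: (measurableT_comp _ (g := EFin \o _)) => //; apply/measurable_EFinP.
    by apply: measurable_funM; [exact: measurableT_comp|exact: measurable_indic].
  - apply: filterS aef => x fx _ /=; rewrite patchE indicE.
    case: (x \in E) => /=; rewrite ?mulr1 ?mulr0 ?normr0//.
    by rewrite ger0_norm -?fx// fine_ge0.
apply: le_trans (@hoelder _ _ _ mu (fine \o f) (\1_E) 2 2 _ _ _ _ _) _ => //.
- exact: measurableT_comp.
- by rewrite [RHS]splitr !div1r.
rewrite (ae_norm2 nf nf')// muleC; apply: lee_wpmul2r; first exact: Lnorm_ge0.
rewrite -/(norm2 mu (EFin \o \1_E)) -[leLHS]fineK ?lee_fin ?lerDl//.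
by rewrite ge0_fin_numE// norm2_indic.
Qed.

Definition L2_fnorm : function_norm mu := FunctionNorm
  (fun f _ => norm2_ge0 f) norm2_eq0 norm2D norm2Z le_norm2 norm2_indic
  norm2_lim norm2_integral.

End norm2.

Section ell2.
Context (R : realType) (k : scalar_kind).
Local Notation K := (scalar_field R k).

(* l_2 is the L_2-space of the counting measure on [nat]. *)
Definition ell2 : Type := Lrho k (L2_fnorm (@counting nat R)).

HB.instance Definition _ := NormedModule.on ell2.

Definition unit_seq (n : nat) : nat -> K^o := fun m => (m == n)%:R.

Lemma unit_seq_in_L n :
  unit_seq n \in @rfun_pred _ _ _ k _ (L2_fnorm (@counting nat R)).
Proof.
apply/asboolP; split; first by split; move=> _ Y mY.
have -> : @eabs _ _ _ k (unit_seq n) = EFin \o \1_[set n].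
  apply/funext => m; rewrite /eabs /unit_seq /= indicE; congr EFin.
  have -> : (m \in [set n]) = (m == n).
    by apply/idP/eqP => [/set_mem//|->]; rewrite inE.
  case: (m == n); rewrite ?modulus0//=.
  by apply: (@sc_mk_inj _ k); rewrite mk_modulus normr1; case: (k).
apply: fnorm_indic => //.
have fn : `[< finite_set [set n] >] by apply/asboolP; exact: finite_set1.
change (@counting nat R [set n] < +oo)%E.
by rewrite /counting fn ltry.
Qed.

Definition ell2_unit (n : nat) : ell2 := Lclass (MkRfun (unit_seq_in_L n)).

End ell2.

Section normed_spaces.
Context {K : numFieldType}.

Section one_space.
Context {U : normedModType K}.
Implicit Types (x y : nat -> U) (X : set U).

Definition closed_span x : set U :=
  closure [set u | exists (n : nat) (a : nat -> K), u = \sum_(i < n) a i *: x i].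

Definition schauder_basis x X : Prop :=
  (forall n, X (x n)) /\
  forall u, X u -> exists! a : nat -> K, series (fun n => a n *: x n) @ \oo --> u.

Definition basic_sequence x : Prop := schauder_basis x (closed_span x).

Definition unconditional_basic x : Prop :=
  forall s : nat -> nat, bijective s -> basic_sequence (x \o s).

Definition seminormalized x : Prop :=
  exists a b : K, 0 < a /\ forall n, a <= `|x n| <= b.

Definition bounded_projection (P : {linear U -> U}) X : Prop :=
  [/\ continuous P, forall u, P (P u) = P u & range P = X].

Definition complemented x : Prop :=
  exists P : {linear U -> U}, bounded_projection P (closed_span x).

(* The functionals live on [closed_span x]; their values elsewhere are
   irrelevant. *)
Definition coordinate_functionals x (z : nat -> U -> K) : Prop :=
  forall u, closed_span x u -> series (fun n => z n u *: x n) @ \oo --> u.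

Definition projecting_functionals x (f : nat -> U -> K) : Prop :=
  exists (P : {linear U -> U}) (z : nat -> U -> K),
    [/\ bounded_projection P (closed_span x), coordinate_functionals x z &
        forall n u, f n u = z n (P u)].

Definition congruent x y : Prop :=
  exists (A : {linear U -> U}) (B : U -> U),
    [/\ continuous A, continuous B, cancel A B, cancel B A &
        forall n, A (x n) = y n].

End one_space.

(* [A] and [B] are mutually inverse bounded linear maps between the subspaces
   [X] and [Y]; their values outside these subspaces are irrelevant. *)
Definition subspace_isomorphism (U V : normedModType K) (X : set U) (Y : set V)
    (A : U -> V) (B : V -> U) : Prop :=
  [/\ forall u, X u -> Y (A u) /\ B (A u) = u,
      forall v, Y v -> X (B v) /\ A (B v) = v,
      forall (c : K) (u1 u2 : U), X u1 -> X u2 ->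
        A (c *: u1 + u2) = c *: A u1 + A u2,
      {within X, continuous A} & {within Y, continuous B}].

Definition equivalent_seq (U V : normedModType K) (x : nat -> U) (y : nat -> V) :
    Prop :=
  exists (A : U -> V) (B : V -> U),
    subspace_isomorphism (closed_span x) (closed_span y) A B /\
    forall n, A (x n) = y n.

(* Both sides of the cotype inequality are squared, the norm being [K]-valued. *)
Definition rademacher_cotype2 (U : normedModType K) : Prop :=
  exists2 C : K, 0 <= C &
    forall (n : nat) (x : 'I_n -> U),
      \sum_(i < n) `|x i| ^+ 2 <=
      C ^+ 2 * ((2 ^+ n)^-1 *
        \sum_(e : {ffun 'I_n -> bool}) `|\sum_(i < n) (-1) ^+ e i *: x i| ^+ 2).

End normed_spaces.

Section function_sequences.
Context {d : measure_display} {T : measurableType d} {R : realType}.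
Context {k : scalar_kind}.
Variable mu : {measure set T -> \bar R}.
Local Notation K := (scalar_field R k).

Definition disjointly_supported (f : nat -> T -> K) : Prop :=
  forall n m, n <> m -> {ae mu, forall x, f n x = 0 \/ f m x = 0}.

(* A property of the class of [f] modulo a.e. equality. *)
Definition simple_function (f : T -> K) : Prop :=
  exists h : T -> K,
    [/\ sc_measurable h, finite_set (range h) & {ae mu, forall x, f x = h x}].

(* The value [+oo] off the support turns the essential infimum over the whole
   space into the one over the support. *)
Definition ess_inf_supp (f : T -> K) : \bar R :=
  ess_inf mu (fun x => if f x == 0 then +oo%E else (modulus (f x))%:E).

Definition escapes_to_infinity (f : nat -> T -> K) : Prop :=
  ess_inf_supp (f n) @[n --> \oo] --> +oo%E.

End function_sequences.

Section well_complemented.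
Context {d : measure_display} {T : measurableType d} {R : realType}.
Context {k : scalar_kind} {mu : {measure set T -> \bar R}}.
Variable rho : function_norm mu.
Local Notation K := (scalar_field R k).

Definition function_functionals (g : nat -> T -> K) : nat -> Lrho k rho -> K :=
  fun n u => pairing mu (g n) u.

(* The dual of [Lrho k rho] is identified with the functions of finite associate
   norm through the bilinear (conjugation-free) pairing. *)
Definition projecting_functions (x : nat -> Lrho k rho) (g : nat -> T -> K) :
    Prop :=
  (forall n, in_L (assoc_fnorm mu rho) (g n)) /\
  projecting_functionals x (function_functionals g).

Definition good_projecting_functions (x : nat -> Lrho k rho)
    (g : nat -> T -> K) : Prop :=
  projecting_functions x g /\ disjointly_supported mu g.

(* That [x] is an unconditional basic sequence is implicit in speaking of
   projecting functionals for it. *)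
Definition well_complemented (x : nat -> Lrho k rho) : Prop :=
  [/\ forall n, x n != 0, disjointly_supported mu (fun n => x n : T -> K),
      unconditional_basic x, complemented x &
      exists g, good_projecting_functions x g].

End well_complemented.

(* Main.v *)
From HB Require Import structures.
Require Import Defs.
From mathcomp Require Import all_boot all_order all_algebra.
From mathcomp Require Import all_classical all_reals all_analysis.
From mathcomp Require Import measurable_realfun ess_sup_inf complex ring lra.

Set Implicit Arguments.
Unset Strict Implicit.
Unset Printing Implicit Defensive.

Import Order.TTheory GRing.Theory Num.Theory.
Import numFieldNormedType.Exports.
Local Open Scope classical_set_scope.
Local Open Scope ring_scope.

(** The norm of [Lrho k rho] is used only through two facts: the space is complete
    ([Lrho_banach], a Riesz-Fischer theorem that rests on the Fatou property) and it
    has cotype 2. By uniform boundedness, an unconditional basic sequence with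
    projecting functionals is a biorthogonal system [x_n], [y_n] whose signed partial
    expansions [sum e_n y_n(u) x_n] are uniformly bounded
    ([unconditional_sign_bounded]). Conversely, in a space of cotype 2 such a bound
    makes all these series converge, so it produces the projection, the unconditional
    basis property and the operators [sum f_n(.) x_n] between two sequences
    ([cotype2_series_cvg], [represents_exists], [sign_bounded_projection]). Equivalence
    of two sequences reduces to comparing norms of finite combinations with equal
    coefficients ([equivalent_seq_of_dominated]).

    The link with functions is [dual_bound]. Let [b_n] be the values at the [x_n] of a
    norming functional of some combination of the [x_n] ([norming_coefs]). For all signs
    the function [sum e_n b_n y_n] has associate norm at most a constant [C]: its modulus
    integrated against [v] is its pairing with a function of the same modulus as [v], which
    is the norming functional at a signed expansion.

    (i) The inclusion of [L_2] in [Lrho] is bounded ([L2_embedding]), so the functions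
    [sum e_n b_n y_n] are also bounded in [L_2]. Averaging over the signs gives
    [sum |b_n|^2 ||y_n||_2^2 <= const]. When the [||y_n||_2] are bounded below, the
    coefficients [b_n] are square summable, which is the upper [l_2] estimate for [x_n];
    cotype 2 and unconditionality give the lower one ([equivalent_ell2]).

    (ii) Let [B_n] be disjoint sets and let [phi_n], [psi_n] be supported in [B_n], with
    [|phi_n| <= 2 |x_n|], [|psi_n| <= |y_n|] and [<psi_n, phi_n> = 1]. A sum of disjoint
    functions is pointwise at most the average of the signed sums of any dominating
    sequence. Hence the [phi_n] are dominated by the [x_n], by unconditionality; and the
    [psi_n] inherit [dual_bound], so that the [x_n] are dominated by the [phi_n] and the
    system is sign-bounded in its turn ([block_dominated], [block_dominates],
    [block_sign_bounded]). Such blocks therefore form a well-complemented basic sequence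
    equivalent to [x_n], for any sets that still carry the pairing.

    It remains to find the sets. As [||y_n||_2] is small infinitely often, while
    [<y_n, x_n> = 1], the pairing is concentrated where [|x_n|] is large; these sets have small
    measure, and a diagonal choice with removal of the later sets makes them disjoint
    ([selection], [select_blocks]). Rounding makes the functions simple, and their
    values on the supports grow ([simple_block_exists]).

    If the associate norm is absolutely continuous, the sets where [|y_n|] is large are
    taken instead. Then [y_n] itself is small outside these sets in the associate norm, so
    [psi_n] is summably close to [y_n] ([select_close_blocks]), and congruence
    follows from a perturbation argument: if [sum (y_n - psi_n)(.) phi_n] has norm at most
    [1/2], an automorphism maps [x_n] to [phi_n] ([congruent_of_close]). *)

(** * Scalars and real-valued norms *)

Section scalar_facts.
Context {R : realType} {k : scalar_kind}.
Local Notation K := (scalar_field R k).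
Implicit Types (z w : K) (r : R).

Lemma sc_eqP z w : sc_re z = sc_re w -> sc_im z = sc_im w -> z = w.
Proof. by move: z w; case: k => [z w //|[a b] [c e]] /= -> ->. Qed.

Lemma sc_re_mk r : sc_re (sc_mk k r 0) = r.
Proof. by case: k. Qed.

Lemma sc_im_mk r : sc_im (sc_mk k r 0) = 0.
Proof. by case: k. Qed.

Lemma sc_reN z : sc_re (- z) = - sc_re z.
Proof. by move: z; case: k => [//|[a b]]. Qed.

Lemma sc_imN z : sc_im (- z) = - sc_im z.
Proof. by move: z; case: k => [z|[a b]] //=; rewrite oppr0. Qed.

Lemma sc_reB z w : sc_re (z - w) = sc_re z - sc_re w.
Proof. by rewrite sc_reD sc_reN. Qed.

Lemma sc_imB z w : sc_im (z - w) = sc_im z - sc_im w.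
Proof. by rewrite sc_imD sc_imN. Qed.

Lemma sc_re1 : sc_re (1 : K) = 1. Proof. by case: k. Qed.
Lemma sc_im1 : sc_im (1 : K) = 0. Proof. by case: k. Qed.
Lemma sc_mk1 : sc_mk k (1 : R) 0 = 1. Proof. by case: k. Qed.

Lemma sc_mkN r : sc_mk k (- r) 0 = - sc_mk k r 0.
Proof. by apply: sc_eqP; rewrite ?sc_reN ?sc_imN ?sc_re_mk ?sc_im_mk ?oppr0. Qed.

Lemma sc_mk_pos (e : R) : 0 < e -> 0 < sc_mk k e 0.
Proof.
move=> e0; rewrite -(sc_mk0 R k) lt_neqAle sc_mk_le ltW// andbT.
by apply/eqP => /sc_mk_inj /eqP; rewrite lt_eqF.
Qed.

Lemma modulus1 : modulus (1 : K) = 1.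
Proof. by apply: (@sc_mk_inj _ k); rewrite mk_modulus normr1 sc_mk1. Qed.

Lemma modulusN z : modulus (- z) = modulus z.
Proof. by apply: (@sc_mk_inj _ k); rewrite !mk_modulus normrN. Qed.

Lemma modulus_mk r : modulus (sc_mk k r 0) = `|r|.
Proof. by rewrite modulusE sc_re_mk sc_im_mk expr0n /= addr0 sqrtr_sqr. Qed.

Lemma modulus_sign (e : bool) : modulus ((-1) ^+ e : K) = 1.
Proof. by case: e; rewrite ?expr1 ?expr0 ?modulusN modulus1. Qed.

Lemma modulus_sqr z : modulus z ^+ 2 = sc_re z ^+ 2 + sc_im z ^+ 2.
Proof. by rewrite modulusE sqr_sqrtr // addr_ge0 // sqr_ge0. Qed.

Lemma abs_re_le z : `|sc_re z| <= modulus z.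
Proof. by rewrite modulusE -sqrtr_sqr ler_wsqrtr // lerDl sqr_ge0. Qed.

Lemma abs_im_le z : `|sc_im z| <= modulus z.
Proof. by rewrite modulusE -sqrtr_sqr ler_wsqrtr // lerDr sqr_ge0. Qed.

Lemma re_le_modulus z : sc_re z <= modulus z.
Proof. exact: le_trans (ler_norm _) (abs_re_le z). Qed.

Lemma modulus_le z : modulus z <= `|sc_re z| + `|sc_im z|.
Proof.
rewrite -(@ler_pXn2r _ 2) ?nnegrE ?modulus_ge0 ?addr_ge0 //.
rewrite modulus_sqr sqrrD !real_normK ?num_real //.
have : 0 <= `|sc_re z| * `|sc_im z| by rewrite mulr_ge0.
lra.
Qed.

Lemma modulusV z : modulus z^-1 = (modulus z)^-1.
Proof.
have [->|z0] := eqVneq z 0; first by rewrite invr0 modulus0 invr0.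
have m0 : modulus z != 0 by apply/eqP => /modulus_eq0 /eqP; apply/negP.
by apply: (mulfI m0); rewrite -modulusM !mulfV // modulus1.
Qed.

Lemma modulus_gt0 z : (0 < modulus z) = (z != 0).
Proof.
rewrite lt_neqAle modulus_ge0 andbT eq_sym; congr negb.
by apply/eqP/eqP => [/modulus_eq0 //|->]; rewrite modulus0.
Qed.

Lemma sc_re_sum (I : Type) (s : seq I) (F : I -> K) :
  sc_re (\sum_(i <- s) F i) = \sum_(i <- s) sc_re (F i).
Proof. by apply: (big_morph sc_re); [exact: sc_reD|exact: sc_re0]. Qed.

Lemma sc_im_sum (I : Type) (s : seq I) (F : I -> K) :
  sc_im (\sum_(i <- s) F i) = \sum_(i <- s) sc_im (F i).
Proof. by apply: (big_morph sc_im); [exact: sc_imD|exact: sc_im0]. Qed.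

Lemma sc_re_sign (e : bool) z : sc_re ((-1) ^+ e * z) = (-1) ^+ e * sc_re z.
Proof. by case: e; rewrite ?expr1 ?expr0 ?mul1r // !mulN1r sc_reN. Qed.

Lemma sc_im_sign (e : bool) z : sc_im ((-1) ^+ e * z) = (-1) ^+ e * sc_im z.
Proof. by case: e; rewrite ?expr1 ?expr0 ?mul1r // !mulN1r sc_imN. Qed.

Lemma ler_modulus_sum (I : Type) (s : seq I) (F : I -> K) :
  modulus (\sum_(i <- s) F i) <= \sum_(i <- s) modulus (F i).
Proof.
elim/big_rec2: _ => [|i a z _ h]; first by rewrite modulus0.
by apply: le_trans (modulusD _ _) _; rewrite lerD2l.
Qed.

End scalar_facts.

Section real_norm.
Context {R : realType} {k : scalar_kind}.
Local Notation K := (scalar_field R k).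
Context {V : normedModType K}.
Implicit Types (u v w : V) (x : nat -> V).

(** The norm of a module over [K] has its values in [K] itself; all estimates are
    made with its real part, which [rnE] shows to carry the same information. *)
Definition rn v : R := sc_re `|v|.

Lemma rnE v : `|v| = sc_mk k (rn v) 0.
Proof.
have : 0 <= `|v| by [].
rewrite /rn; move: `|v|; case: k => //= -[a b].
by rewrite lecE /= => /andP[/eqP -> _].
Qed.

Lemma rn_ge0 v : 0 <= rn v.
Proof. by rewrite -(sc_mk_le k) sc_mk0 -rnE. Qed.

Lemma rnD u v : rn (u + v) <= rn u + rn v.
Proof. by rewrite -(sc_mk_le k) sc_mkD -!rnE ler_normD. Qed.

Lemma rnZ (a : K) v : rn (a *: v) = modulus a * rn v.
Proof. by apply: (@sc_mk_inj _ k); rewrite sc_mkM -!rnE mk_modulus normrZ. Qed.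

Lemma rn0 : rn (0 : V) = 0.
Proof. by rewrite /rn normr0 sc_re0. Qed.

Lemma rn_eq0 v : rn v = 0 -> v = 0.
Proof. by move=> h; apply/eqP; rewrite -normr_eq0 rnE h sc_mk0. Qed.

Lemma rnN v : rn (- v) = rn v.
Proof. by rewrite /rn normrN. Qed.

Lemma rn_distC u v : rn (u - v) = rn (v - u).
Proof. by rewrite /rn distrC. Qed.

Lemma rn_dist w u v : rn (u - v) <= rn (u - w) + rn (w - v).
Proof. by rewrite -[u - v](subrKA w) rnD. Qed.

Lemma rnB u v : rn (u - v) <= rn u + rn v.
Proof. by rewrite -[rn v]rnN rnD. Qed.

Lemma rn_sub u v : rn u - rn v <= rn (u - v).
Proof. by rewrite lerBlDr; apply: le_trans (rnD _ _); rewrite subrK. Qed.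

Lemma rn_sum (I : Type) (s : seq I) (F : I -> V) :
  rn (\sum_(i <- s) F i) <= \sum_(i <- s) rn (F i).
Proof.
elim/big_rec2: _ => [|i a z _ h]; first by rewrite rn0.
by apply: le_trans (rnD _ _) _; rewrite lerD2l.
Qed.

Lemma rn_lt v (e : R) : (rn v < e) = (`|v| < sc_mk k e 0).
Proof.
by rewrite rnE; case: (k) => //=; rewrite ltcE /= eqxx.
Qed.

Lemma sc_mk_gt0 (e : K) : 0 < e -> 0 < sc_re e /\ e = sc_mk k (sc_re e) 0.
Proof.
by move: e; case: (k) => //= -[a b]; rewrite ltcE /= => /andP[/eqP -> ->].
Qed.

(** Convergence with real radii, so that estimates on [rn] apply directly. *)
Definition tends (u : nat -> V) (l : V) : Prop :=
  forall e : R, 0 < e -> exists N, forall n, (N <= n)%N -> rn (u n - l) < e.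

Lemma tendsP (u : nat -> V) (l : V) : u @ \oo --> l <-> tends u l.
Proof.
split=> [/cvgrPdist_lt h e e0|h].
  have [N _ hN] := h _ (sc_mk_pos e0); exists N => n Nn.
  by rewrite rn_distC rn_lt; apply: hN.
apply/cvgrPdist_lt => e /sc_mk_gt0[e0 ee].
have [N hN] := h _ e0; exists N => // n /= Nn.
by rewrite ee -rn_lt rn_distC; apply: hN.
Qed.

Lemma closure_rnP (A : set V) (u : V) :
  closure A u <-> forall e : R, 0 < e -> exists2 a, A a & rn (u - a) < e.
Proof.
split=> [h e e0|h].
  have [|a [Aa /=]] := h (ball u (sc_mk k e 0)).
    exact/nbhsx_ballx/sc_mk_pos.
  by rewrite -ball_normE /= => ua; exists a => //; rewrite rn_lt.
move=> B /nbhs_ballP[e /= /sc_mk_gt0[e0 ee] eB].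
have [a Aa ua] := h _ e0; exists a; split=> //; apply: eB.
by rewrite -ball_normE /= ee -rn_lt.
Qed.

End real_norm.

(** * Convergence and completeness *)

Section convergence.
Context {R : realType} {k : scalar_kind}.
Local Notation K := (scalar_field R k).
Context {V W : normedModType K}.
Implicit Types (u v : nat -> V) (l m : V).

Lemma eps_le0 (a : R) : (forall e, 0 < e -> a < e) -> a <= 0.
Proof. by move=> h; rewrite leNgt; apply/negP => a0; have := h _ a0; rewrite ltxx. Qed.

Lemma tends_unique u l m : tends u l -> tends u m -> l = m.
Proof.
move=> ul um; apply/subr0_eq/rn_eq0/eqP; rewrite eq_le rn_ge0 andbT.
apply: eps_le0 => e e0; have e2 : 0 < e / 2 by lra.
have [N hN] := ul _ e2; have [M hM] := um _ e2.
have := hN (maxn N M) (leq_maxl _ _); have := hM (maxn N M) (leq_maxr _ _).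
have := rn_dist (u (maxn N M)) l m; rewrite (rn_distC l (u _)).
lra.
Qed.

Lemma tends_cst l : tends (fun=> l) l.
Proof. by move=> e e0; exists 0%N => n _; rewrite subrr rn0. Qed.

Lemma tends_eventually u l N : (forall n, (N <= n)%N -> u n = l) -> tends u l.
Proof. by move=> h e e0; exists N => n Nn; rewrite h // subrr rn0. Qed.

Lemma tendsD u v l m : tends u l -> tends v m ->
  tends (fun n => u n + v n) (l + m).
Proof.
move=> ul vm e e0; have e2 : 0 < e / 2 by lra.
have [N hN] := ul _ e2; have [M hM] := vm _ e2.
exists (maxn N M) => n; rewrite geq_max => /andP[/hN h1 /hM h2].
rewrite opprD addrACA; have := rnD (u n - l) (v n - m); lra.
Qed.

Lemma tends_map (f : V -> W) (C : R) u l :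
  (forall n, rn (f (u n) - f l) <= C * rn (u n - l)) ->
  tends u l -> tends (f \o u) (f l).
Proof.
move=> fC ul e e0.
have C0 : 0 < `|C| + 1 by have := normr_ge0 C; lra.
have [N hN] := ul _ (divr_gt0 e0 C0); exists N => n /hN.
rewrite ltr_pdivlMr // => h; apply: le_lt_trans (fC n) _; apply: le_lt_trans h.
rewrite mulrC ler_wpM2l ?rn_ge0 //; have := ler_norm C; lra.
Qed.

Lemma tendsZ (a : K) u l : tends u l -> tends (fun n => a *: u n) (a *: l).
Proof.
move=> ul e e0.
have C0 : 0 < modulus a + 1 by have := modulus_ge0 a; lra.
have [N hN] := ul _ (divr_gt0 e0 C0); exists N => n /hN.
rewrite ltr_pdivlMr // => h; apply: le_lt_trans h.
rewrite -scalerBr rnZ mulrC ler_wpM2l ?rn_ge0 //; lra.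
Qed.

Lemma tends_rn_le u l (C : R) N :
  (forall n, (N <= n)%N -> rn (u n) <= C) -> tends u l -> rn l <= C.
Proof.
move=> uC ul; rewrite -subr_le0; apply: eps_le0 => e e0.
have [M hM] := ul _ e0.
have := hM _ (leq_maxr N M); have := uC _ (leq_maxl N M).
rewrite rn_distC; have := rn_sub l (u (maxn N M)); lra.
Qed.

Lemma tends_comp (s : nat -> nat) u l :
  {homo s : m n / (m < n)%N} -> tends u l -> tends (u \o s) l.
Proof.
move=> hs ul e /ul[N hN]; exists N => n Nn; apply: hN.
apply: leq_trans Nn _; elim: n => [//|n ih].
exact: leq_ltn_trans ih (hs _ _ (ltnSn n)).
Qed.

Lemma lip_continuous (f : V -> W) (C : R) :
  (forall a b, rn (f a - f b) <= C * rn (a - b)) -> continuous f.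
Proof.
move=> fC a; apply/cvgrPdist_lt => e /sc_mk_gt0[e0 ee].
have C0 : 0 < `|C| + 1 by have := normr_ge0 C; lra.
have d0 := sc_mk_pos (k := k) (divr_gt0 e0 C0).
apply/nbhs_normP; exists (sc_mk k (sc_re e / (`|C| + 1)) 0) => //= b.
rewrite /ball_ /= -rn_lt ltr_pdivlMr // => h.
rewrite ee -rn_lt; apply: le_lt_trans (fC _ _) _; apply: le_lt_trans h.
rewrite mulrC ler_wpM2l ?rn_ge0 //; have := ler_norm C; lra.
Qed.

Lemma lip_within (X : set V) (f : V -> W) (C : R) :
  (forall a b, X a -> X b -> rn (f a - f b) <= C * rn (a - b)) ->
  {within X, continuous f}.
Proof.
move=> fC; apply/subspace_continuousP => a Xa.
apply/cvgrPdist_lt => e /sc_mk_gt0[e0 ee].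
have C0 : 0 < `|C| + 1 by have := normr_ge0 C; lra.
have d0 := sc_mk_pos (k := k) (divr_gt0 e0 C0).
rewrite near_withinE.
apply/nbhs_normP; exists (sc_mk k (sc_re e / (`|C| + 1)) 0) => //= b.
rewrite /ball_ /= -rn_lt ltr_pdivlMr // => h Xb.
rewrite ee -rn_lt; apply: le_lt_trans (fC _ _ Xa Xb) _; apply: le_lt_trans h.
rewrite mulrC ler_wpM2l ?rn_ge0 //; have := ler_norm C; lra.
Qed.

End convergence.

Section completeness.
Context {R : realType} {k : scalar_kind}.
Local Notation K := (scalar_field R k).
Context {V : normedModType K}.
Implicit Types (u : nat -> V).

Definition cauchy_rn u : Prop :=
  forall e : R, 0 < e -> exists N, forall n, (N <= n)%N -> rn (u n - u N) < e.

Lemma tends_cauchy u (l : V) : tends u l -> cauchy_rn u.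
Proof.
move=> ul e e0; have e2 : 0 < e / 2 by lra.
have [N hN] := ul _ e2; exists N => n /hN h1; have h2 := hN _ (leqnn N).
have := rn_dist l (u n) (u N); rewrite (rn_distC l (u N)); lra.
Qed.

(** Increments bounded by a geometric sequence leave a tail bounded by its remainder. *)
Lemma geo_dist u (c : R) N : 0 <= c ->
  (forall m, (N <= m)%N -> rn (u m.+1 - u m) <= c * 2^-1 ^+ m) ->
  forall m, (N <= m)%N -> rn (u m - u N) <= 2 * c * 2^-1 ^+ N.
Proof.
move=> c0 h m Nm.
suff : rn (u m - u N) <= 2 * c * (2^-1 ^+ N - 2^-1 ^+ m).
  move=> hh; apply: le_trans hh _; rewrite ler_wpM2l //; first lra.
  by rewrite gerBl exprn_ge0.
elim: m Nm => [|m ih].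
  by rewrite leqn0 => /eqP ->; rewrite !subrr rn0 mulr0.
rewrite leq_eqVlt => /predU1P[->|]; first by rewrite !subrr rn0 mulr0.
rewrite ltnS => Nm; apply: le_trans (rn_dist (u m) _ _) _.
have := ih Nm; have := h _ Nm; rewrite exprS; lra.
Qed.

Lemma half_pow_small (c e : R) : 0 < e -> exists N, c * 2^-1 ^+ N < e.
Proof.
move=> e0; have [N hN] : exists N : nat, c / e < N%:R.
  by exists (Num.truncn (c / e)).+1; rewrite truncnS_gt.
exists N; rewrite exprVn -[_ / _]/(c * (2 ^+ N)^-1) ltr_pdivrMr ?exprn_gt0 //.
rewrite mulrC -ltr_pdivrMr //; apply: lt_le_trans hN _.
by rewrite -natrX ler_nat ltnW // ltn_expl.
Qed.

Lemma geo_cauchy u (c : R) N : 0 <= c ->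
  (forall m, (N <= m)%N -> rn (u m.+1 - u m) <= c * 2^-1 ^+ m) -> cauchy_rn u.
Proof.
move=> c0 h e e0; have [M hM] := half_pow_small (2 * c) e0.
exists (N + M)%N => n Mn; apply: le_lt_trans hM.
have h' m : (N + M <= m)%N -> rn (u m.+1 - u m) <= c * 2^-1 ^+ m.
  by move=> Mm; apply: h; rewrite (leq_trans _ Mm) ?leq_addr.
apply: le_trans (geo_dist c0 h' Mn) _.
rewrite ler_wpM2l //; first lra.
by apply: ler_wiXn2l; rewrite ?leq_addl //; lra.
Qed.

Definition banach : Prop := forall u, cauchy_rn u -> exists l, tends u l.

Hypothesis complete :
  forall u, (forall n, rn (u n.+1 - u n) <= 2^-1 ^+ n) -> exists l, tends u l.

(** It is enough to find limits of rapidly Cauchy sequences, as a Cauchy sequence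
    with a convergent subsequence converges. *)
Lemma banach_of_rapid : banach.
Proof.
move=> u cu.
have /choice[N hN] : forall n, exists N, forall m, (N <= m)%N ->
    rn (u m - u N) < 2^-1 ^+ n.+2.
  by move=> n; apply: cu; rewrite exprn_gt0 // invr_gt0.
pose M n := \max_(i < n.+1) N i.
have MN n : (N n <= M n)%N by exact: (leq_bigmax (Ordinal (ltnSn n))).
have Mmono n : (M n <= M n.+1)%N by rewrite /M [leqRHS]big_ord_recr leq_maxl.
have hM n m : (M n <= m)%N -> rn (u m - u (M n)) <= 2^-1 ^+ n.+1.
  move=> Mm; apply: le_trans (rn_dist (u (N n)) _ _) _.
  have := hN n _ (leq_trans (MN n) Mm); have := hN n _ (MN n).
  rewrite (rn_distC (u (N n))) [2^-1 ^+ n.+2]exprS; lra.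
have [l hl] : exists l, tends (u \o M) l.
  apply: complete => n /=; apply: le_trans (hM n _ (Mmono n)) _.
  by rewrite exprS ler_piMl ?exprn_ge0 //; lra.
exists l => e e0; have e2 : 0 < e / 2 by lra.
have [n1 h1] := hl _ e2; have [n2 h2] := half_pow_small 1 e2.
exists (M (n1 + n2)%N) => m Mm.
apply: le_lt_trans (rn_dist (u (M (n1 + n2)%N)) _ _) _.
have := h1 _ (leq_addr n2 n1); have := hM _ _ Mm.
have : (2^-1 ^+ (n1 + n2).+1 : R) <= 2^-1 ^+ n2.
  by apply: ler_wiXn2l; [lra|lra|rewrite leqW // leq_addl].
rewrite /=; lra.
Qed.

End completeness.

Arguments banach {R k} V.

(** * Operators and equivalence of sequences *)

Section uniform_boundedness.
Context {R : realType} {k : scalar_kind}.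
Local Notation K := (scalar_field R k).
Context {V W : normedModType K}.

(** Gliding hump: if the family were not uniformly bounded, one could choose
    successive corrections so small that they do not disturb the operators
    treated before, but large enough for the next operator to exceed [n]; the sum
    of the corrections would contradict pointwise boundedness. *)
Lemma uniform_boundedness (I : Type) (T : I -> V -> W) :
  banach V ->
  (forall i u v, T i (u + v) = T i u + T i v) ->
  (forall i a u, T i (a *: u) = a *: T i u) ->
  (forall i, exists C : R, forall u, rn (T i u) <= C * rn u) ->
  (forall u, exists C : R, forall i, rn (T i u) <= C) ->
  exists2 C : R, 0 <= C & forall i u, rn (T i u) <= C * rn u.
Proof.
move=> bV TD TZ Tbd Tpt.
have TN i u : T i (- u) = - T i u by rewrite -scaleN1r TZ scaleN1r.
have [[C hC]|noC] := pselect (exists C : R, forall i u, rn (T i u) <= C * rn u).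
  exists `|C| => // i u; apply: le_trans (hC i u) _.
  by rewrite ler_wpM2r ?rn_ge0 // ler_norm.
exfalso.
have /choice[M hM] : forall i, exists C : R, 0 <= C /\ forall u, rn (T i u) <= C * rn u.
  move=> i; have [C hC] := Tbd i; exists `|C|; split=> // u.
  by apply: le_trans (hC u) _; rewrite ler_wpM2r ?rn_ge0 // ler_norm.
have /choice[g hg] : forall C : R, exists p : I * V, rn p.2 = 1 /\ C < rn (T p.1 p.2).
  move=> C; apply: contrapT => no; apply: noC; exists C => i u.
  have [->|u0] := eqVneq u 0.
    by have := (hM i).2 0; rewrite rn0 !mulr0.
  have ru : 0 < rn u.
    by rewrite lt_neqAle rn_ge0 andbT eq_sym; apply: contra_neq u0 => /rn_eq0.
  rewrite leNgt; apply/negP => h; apply: no.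
  exists (i, sc_mk k (rn u)^-1 0 *: u) => /=.
  rewrite TZ !rnZ modulus_mk gtr0_norm ?invr_gt0 // mulVf ?gt_eqF //; split=> //.
  by rewrite mulrC ltr_pdivlMr.
(* [S] is the sum of the operator bounds used before step [n]; a correction of norm
   [2^-n / (1 + S)] is small for all of these operators at once. *)
pose r n (S : R) : R := 2^-1 ^+ n / (1 + S).
pose q n (S : R) := g (n.+2%:R / r n S).
pose stp n (s : V * R) : V * R :=
  let h := sc_mk k (r n s.2) 0 *: (q n s.2).2 in
  (if n.+2%:R <= rn (T (q n s.2).1 (s.1 + h)) then s.1 + h else s.1 - h,
   s.2 + M (q n s.2).1).
pose st := fix st n := if n is m.+1 then stp m (st m) else (0, 0).
pose x n := (st n).1; pose S n := (st n).2; pose i n := (q n (S n)).1.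
have SS n : S n.+1 = S n + M (i n) by [].
have S0 n : 0 <= S n by elim: n => // n ih; rewrite SS addr_ge0 //; case: (hM (i n)).
have Smono m n : (m <= n)%N -> S m <= S n.
  elim: n => [|n ih]; first by rewrite leqn0 => /eqP ->.
  rewrite leq_eqVlt ltnS => /predU1P[-> //|/ih h]; apply: le_trans h _.
  by rewrite SS lerDl; case: (hM (i n)).
have r0 n : 0 < r n (S n).
  rewrite divr_gt0 ?exprn_gt0 ?invr_gt0 //; have := S0 n; lra.
have xS n : rn (x n.+1 - x n) = r n (S n).
  have rw : rn (sc_mk k (r n (S n)) 0 *: (q n (S n)).2) = r n (S n).
    by rewrite rnZ modulus_mk (gtr0_norm (r0 n)) (hg _).1 mulr1.
  rewrite /x /= -/(x n) -/(S n); case: ifP => _.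
    by rewrite addrC addKr.
  by rewrite addrC addKr rnN.
(* One of the two corrections [h] and [- h] is large, as the difference of the two
   values is twice the value at [h]. *)
have big n : n.+2%:R <= rn (T (i n) (x n.+1)).
  rewrite /x /= -/(x n) -/(S n) -/(i n); case: ifP => // /negbT; rewrite -ltNge.
  set h := _ *: _ => lt1.
  have : n.+2%:R < rn (T (i n) h).
    rewrite /h TZ rnZ modulus_mk (gtr0_norm (r0 n)).
    have := (hg (n.+2%:R / r n (S n))).2; rewrite -/(q n (S n)) -/(i n).
    by rewrite ltr_pdivrMr // mulrC.
  have := rnB (T (i n) (x n + h)) (T (i n) (x n - h)).
  rewrite !TD TN opprD opprK addrACA subrr add0r -mulr2n -scaler_nat rnZ.
  have -> : (2%:R : K) = sc_mk k 2 0 by rewrite -[2]/(1 + 1) sc_mkD !sc_mk1.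
  rewrite modulus_mk ger0_norm // -TD; lra.
have xbd N m : (N <= m)%N -> rn (x m.+1 - x m) <= (1 + S N)^-1 * 2^-1 ^+ m.
  move=> Nm; rewrite xS /r mulrC ler_wpM2r ?exprn_ge0 //.
  have := S0 N; have := S0 m; have := Smono _ _ Nm => h1 h2 h3.
  by rewrite lef_pV2 ?posrE; lra.
have S1 N : 0 <= (1 + S N)^-1 by rewrite invr_ge0; have := S0 N; lra.
have [l hl] := bV _ (geo_cauchy (S1 0%N) (@xbd 0%N)).
have [C hC] := Tpt l.
have [n hn] : exists n : nat, C < n%:R by exists (Num.truncn C).+1; rewrite truncnS_gt.
have dl : rn (l - x n.+1) <= 2 * (1 + S n.+1)^-1 * 2^-1 ^+ n.+1.
  rewrite rn_distC -rn_distC; apply: (@tends_rn_le _ _ _ (fun m => x m - x n.+1) _ _ n.+1).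
    by move=> m; apply: geo_dist (S1 _) (@xbd _) _.
  apply: tendsD hl _; exact: tends_cst.
have := big n; have := hC (i n); have := (hM (i n)).2 (l - x n.+1).
have -> : T (i n) (l - x n.+1) = T (i n) l - T (i n) (x n.+1) by rewrite TD TN.
have := rn_sub (T (i n) (x n.+1)) (T (i n) l); rewrite rn_distC.
suff : M (i n) * rn (l - x n.+1) <= 1 by move: hn; rewrite -!natr1; lra.
have [Mi _] := hM (i n).
apply: le_trans (ler_wpM2l Mi dl) _.
rewrite exprS; set c := (1 + _)^-1; set p := _ ^+ n.
have -> : M (i n) * (2 * c * (2^-1 * p)) = M (i n) * c * p by field.
have c0 : 0 <= c by exact: S1.
apply: mulr_ile1; rewrite ?mulr_ge0 ?exprn_ge0 //; last by apply: exprn_ile1; lra.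
have := S0 n; have := SS n; have := S0 n.+1.
by rewrite /c => ? ? ?; rewrite ler_pdivrMr; lra.
Qed.

End uniform_boundedness.

Section neumann.
Context {R : realType} {k : scalar_kind}.
Local Notation K := (scalar_field R k).
Context {V : normedModType K}.

(** The iteration [u := v - E u] is a contraction, and [1 + E] is bounded below, which
    gives uniqueness, hence linearity, of the solution. *)
Lemma neumann (E : V -> V) : banach V ->
  (forall u v, E (u + v) = E u + E v) ->
  (forall a u, E (a *: u) = a *: E u) ->
  (forall u, rn (E u) <= 2^-1 * rn u) ->
  exists T : V -> V,
   [/\ forall v, T v + E (T v) = v, forall u, T (u + E u) = u,
       forall u v, T (u + v) = T u + T v,
       forall a u, T (a *: u) = a *: T u &
       forall u, rn (T u) <= 2 * rn u].
Proof.
move=> bV ED EZ Ebd.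
have EN u : E (- u) = - E u by rewrite -scaleN1r EZ scaleN1r.
have low u : rn u <= 2 * rn (u + E u).
  have := rn_sub u (- E u); rewrite opprK rnN; have := Ebd u; lra.
have inj u v : u + E u = v + E v -> u = v.
  move=> h; apply/subr0_eq/rn_eq0/eqP; rewrite eq_le rn_ge0 andbT.
  by have := low (u - v); rewrite ED EN addrACA h -opprD subrr rn0 mulr0.
have /choice[T hT] : forall v, exists u, u + E u = v.
  move=> v; pose u := fix u n := if n is m.+1 then v - E (u m) else 0.
  have us n : rn (u n.+1 - u n) <= rn v * 2^-1 ^+ n.
    elim: n => [|n ih]; first by rewrite /= -{1}(scale0r 0) EZ scale0r !subr0 mulr1.
    have -> : u n.+2 - u n.+1 = - E (u n.+1 - u n).
      rewrite ED EN -[u n.+2]/(v - E (u n.+1)) -{2}[u n.+1]/(v - E (u n)).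
      by rewrite opprD opprK addrACA subrr add0r opprB addrC.
    rewrite rnN exprS mulrCA; apply: le_trans (Ebd _) _; lra.
  have [l hl] := bV _ (@geo_cauchy _ _ _ u (rn v) 0%N (rn_ge0 v) (fun m _ => us m)).
  exists l.
  have h1 : tends (u \o S) (v - E l).
    apply: (@tendsD _ _ _ (fun=> v) (fun n => - E (u n)) v (- E l)); first exact: tends_cst.
    apply: (@tends_map _ _ _ _ (fun w => - E w) 2^-1 _ _ _ hl) => n.
    by rewrite -opprD rnN -EN -ED.
  have h2 : tends (u \o S) l by apply: tends_comp hl => m n.
  by rewrite {1}(tends_unique h2 h1) subrK.
exists T; split=> [//|u|u v|a u|u].
- by apply: inj; rewrite hT.
- by apply: inj; rewrite hT ED addrACA !hT.
- by apply: inj; rewrite hT EZ -scalerDr hT.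
- by rewrite -{2}(hT u).
Qed.

End neumann.

Section equivalence.
Context {R : realType} {k : scalar_kind}.
Local Notation K := (scalar_field R k).

(** The closure of the graph of the correspondence between finite combinations with
    equal coefficients: it is the graph of the isomorphism between closed spans. *)
Definition span_graph {V W : normedModType K} (x : nat -> V) (y : nat -> W)
    (u : V) (v : W) : Prop :=
  forall e : R, 0 < e -> exists N (a : nat -> K),
    rn (u - \sum_(i < N) a i *: x i) < e /\ rn (v - \sum_(i < N) a i *: y i) < e.

Definition finite_dominated {V W : normedModType K} (x : nat -> V) (y : nat -> W)
    (C : R) : Prop :=
  forall N (a : nat -> K),
    rn (\sum_(i < N) a i *: y i) <= C * rn (\sum_(i < N) a i *: x i).

Lemma sum_widen {V : normedModType K} (x : nat -> V) (a : nat -> K) N M :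
  (N <= M)%N ->
  \sum_(i < N) a i *: x i = \sum_(i < M) (if (i < N)%N then a i else 0) *: x i.
Proof.
move=> NM; rewrite (big_ord_widen M (fun i => a i *: x i) NM) big_mkcond /=.
by apply: eq_bigr => i _; case: ifP => //; rewrite scale0r.
Qed.

Lemma span_graph_comb {V W : normedModType K} (x : nat -> V) (y : nat -> W) c u v u' v' :
  span_graph x y u v -> span_graph x y u' v' ->
  span_graph x y (c *: u + u') (c *: v + v').
Proof.
move=> h h' e e0.
have m0 : 0 < 2 * (modulus c + 1) by have := modulus_ge0 c; lra.
have [N [a [h1 h2]]] := h _ (divr_gt0 e0 m0).
have e2 : 0 < e / 2 by lra.
have [M [b [h3 h4]]] := h' _ e2.
pose f i := (if (i < N)%N then a i else 0); pose g i := (if (i < M)%N then b i else 0).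
exists (maxn N M), (fun i => c * f i + g i).
have sumE (U : normedModType K) (z : nat -> U) :
    \sum_(i < maxn N M) (c * f i + g i) *: z i =
    c *: (\sum_(i < N) a i *: z i) + \sum_(i < M) b i *: z i.
  rewrite (sum_widen z a (leq_maxl N M)) (sum_widen z b (leq_maxr N M)).
  rewrite scaler_sumr -big_split /=; apply: eq_bigr => i _.
  by rewrite scalerDl scalerA.
have bd (U : normedModType K) (p p' q q' : U) :
    rn (p - q) < e / (2 * (modulus c + 1)) -> rn (p' - q') < e / 2 ->
    rn (c *: p + p' - (c *: q + q')) < e.
  rewrite opprD addrACA -scalerBr ltr_pdivlMr // => hp hq.
  have := rnD (c *: (p - q)) (p' - q'); rewrite rnZ.
  have := rn_ge0 (p - q); have := modulus_ge0 c; lra.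
by rewrite !sumE; split; apply: bd.
Qed.

Lemma span_graphC {V W : normedModType K} (x : nat -> V) (y : nat -> W) u v :
  span_graph x y u v -> span_graph y x v u.
Proof. by move=> h e /h[N [a [h1 h2]]]; exists N, a. Qed.

Lemma span_graph_closed {V W : normedModType K} (x : nat -> V) (y : nat -> W) u v :
  span_graph x y u v -> closed_span x u.
Proof.
move=> h; apply/closure_rnP => e /h[N [a [h1 h2]]].
by exists (\sum_(i < N) a i *: x i) => //; exists N, a.
Qed.

Lemma span_graph_bound {V W : normedModType K} (x : nat -> V) (y : nat -> W) C u v :
  finite_dominated x y C -> span_graph x y u v -> rn v <= `|C| * rn u.
Proof.
move=> hC h; rewrite -subr_le0; apply: eps_le0 => e e0.
have m0 : 0 < `|C| + 2 by have := normr_ge0 C; lra.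
have [N [a [h1 h2]]] := h _ (divr_gt0 e0 m0).
have := hC N a; move: h1 h2; rewrite !ltr_pdivlMr //.
set p := \sum_(i < N) _; set q := \sum_(i < N) _ => h1 h2 hpq.
have := rn_sub v q; have := rn_sub p u; rewrite (rn_distC p).
have := ler_wpM2r (rn_ge0 p) (ler_norm C).
have := normr_ge0 C; have := rn_ge0 (u - p); have := rn_ge0 (v - q).
nra.
Qed.

(** Combinations of the [x i] converging rapidly to [u] have images that form a Cauchy
    sequence, because the graph is dominated. *)
Lemma span_graph_total {V W : normedModType K} (x : nat -> V) (y : nat -> W) C u :
  banach W -> finite_dominated x y C -> closed_span x u ->
  exists v, span_graph x y u v.
Proof.
move=> bW hC /closure_rnP h.
have /choice[w hw] : forall n : nat, exists w : nat * (nat -> K),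
    rn (u - \sum_(i < w.1) w.2 i *: x i) < 2^-1 ^+ n.
  move=> n; have [|_ [N [a ->]] ha] := h (2^-1 ^+ n); first by rewrite exprn_gt0 // invr_gt0.
  by exists (N, a).
pose s n := \sum_(i < (w n).1) (w n).2 i *: x i.
pose t n := \sum_(i < (w n).1) (w n).2 i *: y i.
have dts m n : rn (t m - t n) <= `|C| * rn (s m - s n).
  apply: (@span_graph_bound _ _ x y C (s m - s n) (t m - t n)) => //.
  have hs j : span_graph x y (s j) (t j).
    by move=> e e0; exists (w j).1, (w j).2; rewrite !subrr !rn0.
  by rewrite [s m - _]addrC [t m - _]addrC -[- s n]scaleN1r -[- t n]scaleN1r; apply: span_graph_comb.
have [v hv] : exists v, tends t v.
  apply: bW; apply: (@geo_cauchy _ _ _ t (`|C| * 2) 0%N); first by rewrite mulr_ge0.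
  move=> m _; apply: le_trans (dts _ _) _; rewrite -mulrA ler_wpM2l //.
  apply: le_trans (rn_dist u _ _) _; rewrite (rn_distC _ u).
  have := hw m; have := hw m.+1; rewrite -/(s _) -/(s _) exprS.
  have : (0:R) <= 2^-1 ^+ m by rewrite exprn_ge0.
  lra.
exists v => e e0; have [N hN] := hv _ e0; have [M hM] := half_pow_small 1 e0.
exists (w (N + M)%N).1, (w (N + M)%N).2; split.
  apply: lt_trans (hw _) _; apply: le_lt_trans hM; rewrite mul1r.
  by apply: ler_wiXn2l; [lra|lra|rewrite leq_addl].
by rewrite rn_distC; apply: hN; rewrite leq_addr.
Qed.

(** The correspondence between finite combinations is bounded in both directions, so by
    completeness its closure is the graph of an isomorphism of the closed spans. *)
Lemma equivalent_seq_of_dominated {V W : normedModType K} (x : nat -> V) (y : nat -> W) C D :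
  banach V -> banach W -> finite_dominated x y C -> finite_dominated y x D ->
  equivalent_seq x y.
Proof.
move=> bV bW hC hD.
have uniqr u v v' : span_graph x y u v -> span_graph x y u v' -> v = v'.
  move=> h h'; apply/subr0_eq/rn_eq0/eqP; rewrite eq_le rn_ge0 andbT.
  have /(span_graph_bound hC) := span_graph_comb (-1) h' h.
  by rewrite !scaleN1r ![- _ + _]addrC subrr rn0 mulr0.
have uniql u u' v : span_graph x y u v -> span_graph x y u' v -> u = u'.
  move=> /span_graphC h /span_graphC h'; apply/subr0_eq/rn_eq0/eqP; rewrite eq_le rn_ge0 andbT.
  have /(span_graph_bound hD) := span_graph_comb (-1) h' h.
  by rewrite !scaleN1r ![- _ + _]addrC subrr rn0 mulr0.
have /choice[A hA] : forall u, exists v, closed_span x u -> span_graph x y u v.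
  move=> u; have [/(span_graph_total bW hC)[v hv]|nu] := pselect (closed_span x u).
    by exists v.
  by exists 0.
have /choice[B hB] : forall v, exists u, closed_span y v -> span_graph x y u v.
  move=> v; have [/(span_graph_total bV hD)[u hu]|nu] := pselect (closed_span y v).
    by exists u => _; apply: span_graphC.
  by exists 0.
exists A, B; split; first split.
- move=> u Xu; have h := hA _ Xu.
  have Yv := span_graph_closed (span_graphC h).
  by split=> //; apply: uniql (hB _ Yv) h.
- move=> v Yv; have h := hB _ Yv.
  have Xu := span_graph_closed h.
  by split=> //; apply: uniqr (hA _ Xu) h.
- move=> c u1 u2 /hA h1 /hA h2; have h := span_graph_comb c h1 h2.
  by apply: uniqr (hA _ (span_graph_closed h)) h.
- apply: (@lip_within _ _ _ _ _ _ `|C|) => a b /hA ha /hA hb.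
  have := span_graph_bound hC (span_graph_comb (-1) hb ha).
  by rewrite !scaleN1r ![- _ + _]addrC.
- apply: (@lip_within _ _ _ _ _ _ `|D|) => a b /hB /span_graphC ha /hB /span_graphC hb.
  have := span_graph_bound hD (span_graph_comb (-1) hb ha).
  by rewrite !scaleN1r ![- _ + _]addrC.
move=> n; have h : span_graph x y (x n) (y n).
  move=> e e0; exists n.+1, (fun i => (i == n)%:R).
  have sE (U : normedModType K) (z : nat -> U) :
      \sum_(i < n.+1) (nat_of_ord i == n)%:R *: z i = z n.
    rewrite big_ord_recr /= eqxx scale1r big1 ?add0r // => i _.
    by rewrite ltn_eqF // scale0r.
  by rewrite !sE !subrr !rn0.
exact: uniqr (hA _ (span_graph_closed h)) h.
Qed.

End equivalence.

(** * Rearrangements *)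

Section rearrangement.

(** A rearrangement is described by the finite stages of its construction: the lists
    form an increasing chain without duplicates, so their common limit is a bijection
    as soon as every number is reached. *)
Lemma chain_bijection (L : nat -> seq nat) (ext : nat -> seq nat) :
  (forall j, L j.+1 = L j ++ ext j) -> (forall j, uniq (L j)) ->
  (forall i j, (i < j)%N -> i \in L j) ->
  exists2 s : nat -> nat, bijective s &
    forall j m, (m <= size (L j))%N -> map s (iota 0 m) = take m (L j).
Proof.
move=> LS uL mL.
have sizeL j : (j <= size (L j))%N.
  rewrite -{1}(size_iota 0 j); apply: uniq_leq_size; first exact: iota_uniq.
  by move=> i; rewrite mem_iota add0n => /andP[_ /mL].
have pre j d : exists t, L (j + d)%N = L j ++ t.
  elim: d => [|d [t ht]]; first by exists [::]; rewrite addn0 cats0.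
  by exists (t ++ ext (j + d)%N); rewrite addnS LS ht catA.
have nthL j j' m : (j <= j')%N -> (m < size (L j))%N ->
    nth 0%N (L j') m = nth 0%N (L j) m.
  move=> jj' mj; have [t] := pre j (j' - j)%N; rewrite subnKC // => ->.
  by rewrite nth_cat mj.
pose s m := nth 0%N (L m.+1) m.
have sE j m : (m < size (L j))%N -> s m = nth 0%N (L j) m.
  move=> mj; have [jm|mj'] := leqP j m.+1; first exact: nthL.
  by rewrite /s (@nthL m.+1 j) // ltnW.
have sinj : injective s.
  move=> m m' /eqP; set j := (maxn m m').+1.
  have hm : (m < size (L j))%N by apply: leq_trans (sizeL j); rewrite ltnS leq_maxl.
  have hm' : (m' < size (L j))%N by apply: leq_trans (sizeL j); rewrite ltnS leq_maxr.
  by rewrite (sE j) // (sE j) // nth_uniq // => /eqP.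
have ssurj n : exists m, s m = n.
  have nL := mL n n.+1 (ltnSn n); exists (index n (L n.+1)).
  by rewrite (sE n.+1) ?index_mem // nth_index.
have [g hg] := choice ssurj.
exists s; first by exists g => // m; apply: sinj; rewrite hg.
move=> j m mj; apply: (@eq_from_nth _ 0%N) => [|i].
  by rewrite size_map size_iota size_takel.
rewrite size_map size_iota => im; have imj := leq_trans im mj.
by rewrite (nth_map 0%N) ?size_iota // nth_iota // nth_take // add0n (sE j).
Qed.

Context {R : realType} {k : scalar_kind}.
Local Notation K := (scalar_field R k).
Context {V : normedModType K}.

(** If arbitrary partial sums were unbounded, an enumeration that visits, one after
    the other, disjoint finite sets with sums of norm at least [1] would give a
    divergent rearrangement. *)
Lemma bounded_partial_sums (v : nat -> V) :
  (forall s : nat -> nat, bijective s ->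
     exists l, tends (series (v \o s)) l) ->
  exists C : R, forall L : seq nat, uniq L -> rn (\sum_(i <- L) v i) <= C.
Proof.
move=> conv; apply: contrapT => unb.
have /choice[g hg] : forall F : seq nat, exists A : seq nat,
    [/\ uniq A, forall i, i \in A -> i \notin F & 1 <= rn (\sum_(i <- A) v i)] \/ ~ uniq F.
  move=> F; have [uF|nF] := pselect (uniq F); last by exists [::]; right.
  have [[L [uL hL]]|no] := pselect (exists L, uniq L /\
      1 + \sum_(i <- F) rn (v i) < rn (\sum_(i <- L) v i)); last first.
    exfalso; apply: unb; exists (1 + \sum_(i <- F) rn (v i)) => L uL.
    by rewrite leNgt; apply/negP => h; apply: no; exists L.
  exists [seq i <- L | i \notin F]; left; split; first exact: filter_uniq.
    by move=> i; rewrite mem_filter => /andP[].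
  have e : \sum_(i <- L) v i = \sum_(i <- [seq i <- L | i \in F]) v i +
      \sum_(i <- [seq i <- L | i \notin F]) v i by rewrite !big_filter (bigID (mem F)).
  move: hL; rewrite e.
  have : rn (\sum_(i <- [seq i <- L | i \in F]) v i) <= \sum_(i <- F) rn (v i).
    apply: le_trans (rn_sum _ _) _.
    have p : perm_eq [seq i <- L | i \in F] [seq i <- F | i \in L].
      by apply: uniq_perm; rewrite ?filter_uniq // => i; rewrite !mem_filter andbC.
    rewrite (perm_big _ p) big_filter big_mkcond /=.
    by apply: ler_sum => i _; case: ifP => // _; exact: rn_ge0.
  set a := \sum_(i <- _) v i; set b := \sum_(i <- _) v i; have := rnD b a; lra.
(* Each stage appends a set with a large sum, then the numbers up to [j] not used so
   far, which makes the enumeration exhaustive. *)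
pose rest F j := [seq i <- iota 0 j.+1 | i \notin F ++ g F].
pose L := fix L j := if j is i.+1 then L i ++ (g (L i) ++ rest (L i) i) else [::].
have LS j : L j.+1 = L j ++ (g (L j) ++ rest (L j) j) by [].
have uL j : uniq (L j).
  elim: j => // j ih; case: (hg (L j)) => [[uA dA _]|//].
  rewrite LS catA cat_uniq filter_uniq ?iota_uniq // andbT.
  rewrite cat_uniq ih uA /= andbT; apply/andP; split.
    by apply/hasPn => i /dA.
  by apply/hasPn => i; rewrite mem_filter => /andP[].
have mL i j : (i < j)%N -> i \in L j.
  case: j => // j; rewrite ltnS => ij.
  rewrite LS catA mem_cat; case h: (i \in L j ++ g (L j)) => //; rewrite orFb.
  by rewrite mem_filter h mem_iota add0n ltnS ij.
have [s bs sL] := chain_bijection LS uL mL.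
have [l /tends_cauchy hl] := conv s bs.
have [N hN] := hl 2^-1 ltac:(lra).
have serE m : series (v \o s) m = \sum_(i <- map s (iota 0 m)) v i.
  by rewrite big_map /series /= /index_iota subn0.
case: (hg (L N)) => [[uA dA A1]|]; last by case.
have sizeL j : (j <= size (L j))%N.
  rewrite -{1}(size_iota 0 j); apply: uniq_leq_size; first exact: iota_uniq.
  by move=> i; rewrite mem_iota add0n => /andP[_ /mL].
have h1 := hN _ (sizeL N).
have h2 := hN (size (L N ++ g (L N))).
have {}h2 := h2 ltac:(by rewrite size_cat (leq_trans (sizeL N)) // leq_addr).
move: h1 h2; rewrite !serE (sL N (size (L N))) // take_size.
rewrite [in X in _ -> X -> _](sL N.+1); last by rewrite LS catA [leqRHS]size_cat leq_addr.
rewrite LS catA take_size_cat // big_cat /=.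
set a := \sum_(i <- L N) v i; set b := \sum_(i <- g _) v i; set c := \sum_(i <- _) v i.
move=> h1 h2; have := rn_dist c (a + b) a; rewrite (rn_distC c).
by rewrite [a + b]addrC addrK [b + a]addrC; move: A1; rewrite -/b; lra.
Qed.

End rearrangement.

(** * Sign-bounded systems *)

Section sign_bounds.
Context {R : realType} {k : scalar_kind}.
Local Notation K := (scalar_field R k).
Context {V : normedModType K}.
Implicit Types (x : nat -> V) (f : nat -> V -> K).

(** Unconditionality in quantitative form: all signed partial expansions along the
    system are uniformly bounded operators. Quantifying over duplicate-free lists
    makes the notion invariant under reindexing. *)
Definition sign_bounded f x (C : R) : Prop :=
  forall (L : seq nat) (e : nat -> bool) u, uniq L ->
    rn (\sum_(i <- L) (-1) ^+ e i *: (f i u *: x i)) <= C * rn u.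

Definition biorthogonal f x : Prop := forall n m, f n (x m) = (n == m)%:R.

Definition linear_functionals f : Prop :=
  (forall n u v, f n (u + v) = f n u + f n v) /\
  (forall n a u, f n (a *: u) = a * f n u).

Lemma functional0 f n : linear_functionals f -> f n 0 = 0.
Proof. by case=> _ fZ; rewrite -(scale0r 0) fZ mul0r. Qed.

Lemma functionalN f n u : linear_functionals f -> f n (- u) = - f n u.
Proof. by case=> _ fZ; rewrite -scaleN1r fZ mulN1r. Qed.

Lemma functional_sum f n (I : Type) (s : seq I) (a : I -> K) (z : I -> V) :
  linear_functionals f ->
  f n (\sum_(i <- s) a i *: z i) = \sum_(i <- s) a i * f n (z i).
Proof.
move=> lf; have [fD fZ] := lf.
elim/big_rec2: _ => [|i a' z' _ h]; first exact: functional0.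
by rewrite fD fZ -h.
Qed.

Lemma biorthogonal_coef f x N (a : nat -> K) m : linear_functionals f -> biorthogonal f x ->
  (m < N)%N -> f m (\sum_(i < N) a i *: x i) = a m.
Proof.
move=> lf bx mN; rewrite functional_sum // (bigD1 (Ordinal mN)) //= bx eqxx mulr1.
rewrite big1 ?addr0 // => i /eqP im; rewrite bx.
by case: eqP => [mi|_]; rewrite ?mulr0 //; case: im; apply/val_inj.
Qed.

Lemma linear_functionals_reindex f (s : nat -> nat) :
  linear_functionals f -> linear_functionals (f \o s).
Proof. by case=> fD fZ; split=> n *; [apply: fD|apply: fZ]. Qed.

Definition fin_span x : set V :=
  [set u | exists (n : nat) (a : nat -> K), u = \sum_(i < n) a i *: x i].

Lemma fin_span_comb x c u v : fin_span x u -> fin_span x v -> fin_span x (c *: u + v).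
Proof.
move=> [N [a ->]] [M [b ->]].
pose f i := (if (i < N)%N then a i else 0); pose g i := (if (i < M)%N then b i else 0).
exists (maxn N M), (fun i => c * f i + g i).
rewrite (sum_widen x a (leq_maxl N M)) (sum_widen x b (leq_maxr N M)).
rewrite scaler_sumr -big_split /=; apply: eq_bigr => i _.
by rewrite scalerDl scalerA.
Qed.

Lemma fin_span0 x : fin_span x 0.
Proof. by exists 0%N, (fun=> 0); rewrite big_ord0. Qed.

Lemma fin_span_vec x n : fin_span x (x n).
Proof.
exists n.+1, (fun i => (i == n)%:R).
rewrite big_ord_recr /= eqxx scale1r big1 ?add0r // => i _.
by rewrite ltn_eqF // scale0r.
Qed.

Lemma fin_span_sub x u : fin_span x u -> closed_span x u.
Proof. exact: subset_closure. Qed.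

Lemma fin_span_min x (A : set V) : A 0 -> (forall c u v, A u -> A v -> A (c *: u + v)) ->
  (forall n, A (x n)) -> fin_span x `<=` A.
Proof.
move=> A0 AC Ax _ [n [a ->]]; elim: n => [|n ih]; first by rewrite big_ord0.
by rewrite big_ord_recr /= addrC; apply: AC.
Qed.

Lemma closed_span_sub x y : (forall n, fin_span y (x n)) ->
  closed_span x `<=` closed_span y.
Proof.
move=> h; apply: closureS.
by apply: fin_span_min => //; [exact: fin_span0|exact: fin_span_comb].
Qed.

Lemma series_bigE (v : nat -> V) n : series v n = \sum_(i < n) v i.
Proof. by rewrite /series /= big_mkord. Qed.

(** The expansion of [x n] along a biorthogonal system is eventually constant. *)
Lemma biorthogonal_series f x (y : nat -> V) n : biorthogonal f x ->
  tends (series (fun m => f m (x n) *: y m)) (y n).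
Proof.
move=> bx; apply: (@tends_eventually _ _ _ _ _ n.+1) => N nN.
rewrite series_bigE (bigD1 (Ordinal nN)) //= bx eqxx scale1r big1 ?addr0 // => i /eqP im.
by rewrite bx; case: eqP => [mi|_]; rewrite ?scale0r //; case: im; apply/val_inj.
Qed.

(** The functional applied to the partial sums of an expansion is eventually constant,
    and it is continuous. *)
Lemma functional_coef f x m (C : R) (a : nat -> K) u :
  linear_functionals f -> biorthogonal f x ->
  (forall u, modulus (f m u) <= C * rn u) ->
  tends (series (fun n => a n *: x n)) u -> f m u = a m.
Proof.
move=> lf bx fC au; have [fD fZ] := lf.
have h1 : tends (fun N => f m (series (fun n => a n *: x n) N) *: x m) (f m u *: x m).
  apply: (@tends_map _ _ _ _ (fun u => f m u *: x m) (C * rn (x m)) _ _ _ au) => N.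
  rewrite -scalerBl rnZ -(functionalN _ _ lf) -fD mulrAC.
  by rewrite ler_wpM2r ?rn_ge0.
have h2 : tends (fun N => f m (series (fun n => a n *: x n) N) *: x m) (a m *: x m).
  apply: (@tends_eventually _ _ _ _ _ m.+1) => N mN; congr (_ *: _).
  by rewrite series_bigE biorthogonal_coef.
have /(congr1 (f m)) := tends_unique h1 h2.
by rewrite !fZ bx eqxx !mulr1.
Qed.

(** Convergence of every rearrangement bounds, at each point, the sums over finite sets
    of coordinates. By uniform boundedness these sums are uniformly bounded operators,
    and a signed sum is a difference of two of them. *)
Lemma unconditional_sign_bounded f x :
  banach V -> linear_functionals f ->
  (forall n, exists C : R, forall u, modulus (f n u) <= C * rn u) ->
  unconditional_basic x -> projecting_functionals x f ->
  biorthogonal f x /\ exists2 C : R, 0 <= C & sign_bounded f x C.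
Proof.
move=> bV lf fbd ux [P [z [[cP PP rP] cz fz]]]; have [fD fZ] := lf.
have Pid u : closed_span x u -> P u = u by rewrite -rP => -[w _ <-].
have Pin u : closed_span x (P u) by rewrite -rP; exists u.
have xin n : closed_span x (x n) by apply/fin_span_sub/fin_span_vec.
have bx : biorthogonal f x.
  move=> n m; rewrite fz (Pid _ (xin m)).
  have bs : basic_sequence x by apply: (ux id); exists id.
  have [a [_ ua]] := bs.2 _ (xin m).
  have e1 : a = (fun n => z n (x m)) by apply: ua; apply: cz.
  have e2 : a = (fun n => (n == m)%:R).
    apply: ua; apply/tendsP/(@tends_eventually _ _ _ _ _ m.+1) => N mN.
    rewrite series_bigE (bigD1 (Ordinal mN)) //= eqxx scale1r big1 ?addr0 // => i /eqP im.
    by case: eqP => [mi|_]; rewrite ?scale0r //; case: im; apply/val_inj.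
  by rewrite -[z n (x m)]/((fun n => z n (x m)) n) -e1 e2.
have fP n u : f n (P u) = f n u by rewrite !fz PP.
split=> //.
have pt u : exists C : R, forall L : seq nat, uniq L -> rn (\sum_(i <- L) f i u *: x i) <= C.
  apply: bounded_partial_sums => s bs.
  have [sg Ks Kg] := bs.
  have Pu : closed_span (x \o s) (P u).
    apply: (@closed_span_sub x) (Pin u) => n.
    by rewrite -[n]Kg; apply: (@fin_span_vec (x \o s)).
  have [a [/tendsP ha _]] := (ux _ bs).2 _ Pu.
  exists (P u); suff -> : (fun n => f n u *: x n) \o s = (fun n => a n *: (x \o s) n) by [].
  apply/funext => m /=; congr (_ *: _).
  have [C hC] := fbd (s m).
  rewrite -fP; apply: (@functional_coef (f \o s) (x \o s) m C) ha => //.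
    exact: linear_functionals_reindex.
  by move=> i j; rewrite /= bx (inj_eq (can_inj Ks)).
have [C C0 hC] : exists2 C : R, 0 <= C &
    forall (i : {L : seq nat | uniq L}) u, rn (\sum_(j <- sval i) f j u *: x j) <= C * rn u.
  apply: uniform_boundedness => //.
  - move=> i u v; rewrite -big_split /=; apply: eq_bigr => j _.
    by rewrite fD scalerDl.
  - move=> i a u; rewrite scaler_sumr; apply: eq_bigr => j _.
    by rewrite fZ scalerA.
  - move=> [L _] /=; have [B hB] := choice fbd.
    exists (\sum_(j <- L) B j * rn (x j)) => u; apply: le_trans (rn_sum _ _) _.
    rewrite mulr_suml; apply: ler_sum => j _; rewrite rnZ mulrAC.
    by rewrite ler_wpM2r ?rn_ge0.
  - by move=> u; have [C hC] := pt u; exists C => -[L uL]; apply: hC.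
exists (2 * C) => [|L e u uL]; first by rewrite mulr_ge0.
rewrite (bigID e) /=.
have -> : \sum_(i <- L | e i) (-1) ^+ e i *: (f i u *: x i) =
    - \sum_(i <- [seq i <- L | e i]) f i u *: x i.
  rewrite -sumrN big_filter; apply: eq_bigr => i ->.
  by rewrite expr1 scaleN1r.
have -> : \sum_(i <- L | ~~ e i) (-1) ^+ e i *: (f i u *: x i) =
    \sum_(i <- [seq i <- L | ~~ e i]) f i u *: x i.
  by rewrite big_filter; apply: eq_bigr => i /negbTE ->; rewrite expr0 scale1r.
apply: le_trans (rnD _ _) _; rewrite rnN.
have := hC (exist (fun L => is_true (uniq L)) _ (filter_uniq e uL)) u.
have := hC (exist (fun L => is_true (uniq L)) _ (filter_uniq (predC e) uL)) u.
rewrite /=; lra.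
Qed.

Lemma iota_ord (a : nat -> V) N : \sum_(i <- iota 0 N) a i = \sum_(i < N) a i.
Proof. by rewrite -(big_mkord xpredT a) /index_iota subn0. Qed.

Lemma sign_bounded_ord f x (C : R) : sign_bounded f x C -> forall N (e : 'I_N -> bool) u,
  rn (\sum_(i < N) (-1) ^+ e i *: (f i u *: x i)) <= C * rn u.
Proof.
move=> h N e u; pose e' i := if insub i is Some j then e j else false.
have := h (iota 0 N) e' u (iota_uniq 0 N).
rewrite (iota_ord (fun i => (-1) ^+ e' i *: (f i u *: x i))).
congr (rn _ <= _); apply: eq_bigr => i _.
by rewrite /e' valK.
Qed.

Lemma signed_finite_sum f x C N (a : nat -> K) (e : 'I_N -> bool) :
  linear_functionals f -> biorthogonal f x -> sign_bounded f x C ->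
  rn (\sum_(i < N) (-1) ^+ e i *: (a i *: x i)) <= C * rn (\sum_(i < N) a i *: x i).
Proof.
move=> lf bx /sign_bounded_ord h; apply: le_trans (h N e _).
rewrite le_eqVlt; apply/orP; left; apply/eqP; congr rn; apply: eq_bigr => i _.
by rewrite biorthogonal_coef.
Qed.

Lemma sign_bounded_reindex f x C (s : nat -> nat) : injective s ->
  sign_bounded f x C -> sign_bounded (f \o s) (x \o s) C.
Proof.
move=> sI h L e u uL.
have := h (map s L) (fun j => `[< exists2 i, s i = j & e i >]) u.
rewrite map_inj_uniq // => /(_ uL); rewrite big_map.
have E i : `[< exists2 j, s j = s i & e j >] = e i.
  by apply/asboolP/idP => [[j /sI ->]|ei] //; exists i.
by under eq_bigr do rewrite E.
Qed.

Lemma biorthogonal_reindex f x (s : nat -> nat) : injective s ->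
  biorthogonal f x -> biorthogonal (f \o s) (x \o s).
Proof. by move=> sI h n m /=; rewrite h (inj_eq sI). Qed.

(** Sums over duplicate-free lists are initial sums with some coefficients set to zero;
    the bound [N] does not depend on the summands, so that two such sums can be
    compared. *)
Lemma sum_uniq_list (L : seq nat) : uniq L -> exists N, forall (W : normedModType K) (a : nat -> K) (y : nat -> W),
  \sum_(i <- L) a i *: y i = \sum_(i < N) (if nat_of_ord i \in L then a i else 0) *: y i.
Proof.
move=> uL; exists (\max_(i <- L) i).+1 => W a y.
set N := (\max_(i <- L) i).+1.
rewrite -(big_mkord xpredT (fun i => (if i \in L then a i else 0) *: y i)).
transitivity (\sum_(0 <= i < N) (if i \in L then a i *: y i else 0)); last first.
  by apply: eq_bigr => i _; case: ifP => //; rewrite scale0r.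
rewrite -big_mkcond /= -[RHS]big_filter; apply: perm_big; apply: uniq_perm => //.
  by rewrite filter_uniq // iota_uniq.
move=> i; rewrite mem_filter mem_index_iota leq0n /= ltnS.
by case iL: (i \in L) => //=; apply/esym; apply: leq_bigmax_seq.
Qed.

(** A bound for the expansion along [x] passes to any sequence dominated by [x], the
    functionals being unchanged. *)
Lemma sign_bounded_dominated f x (y : nat -> V) C D :
  0 <= D -> finite_dominated x y D -> sign_bounded f x C -> sign_bounded f y (D * C).
Proof.
move=> D0 xy h L e u uL; have := h L e u uL.
have [N hN] := sum_uniq_list uL.
have E (z : nat -> V) : \sum_(i <- L) (-1) ^+ e i *: (f i u *: z i) =
    \sum_(i < N) (if nat_of_ord i \in L then (-1) ^+ e i * f i u else 0) *: z i.
  rewrite -(hN _ (fun i => (-1) ^+ e i * f i u)).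
  by apply: eq_bigr => i _; rewrite scalerA.
rewrite !E => hx; rewrite -mulrA; apply: le_trans (ler_wpM2l D0 hx).
exact: (xy N (fun i => if i \in L then (-1) ^+ e i * f i u else 0)).
Qed.

(** A list with a single entry already bounds the corresponding functional. *)
Lemma sign_bounded_functional f x C n : linear_functionals f -> biorthogonal f x ->
  sign_bounded f x C -> exists D : R, forall u, modulus (f n u) <= D * rn u.
Proof.
move=> lf bx h.
have rx : 0 < rn (x n).
  rewrite lt_neqAle rn_ge0 andbT eq_sym; apply/eqP => /rn_eq0 xn0.
  have := bx n n; rewrite xn0 functional0 // eqxx => /eqP.
  by rewrite eq_sym oner_eq0.
exists (C / rn (x n)) => u; rewrite mulrAC ler_pdivlMr // -rnZ.
by have := h [:: n] (fun=> false) u isT; rewrite big_seq1 expr0 scale1r.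
Qed.

End sign_bounds.

(** * Cotype 2 and operators of biorthogonal systems *)

Section cotype.
Context {R : realType} {k : scalar_kind}.
Local Notation K := (scalar_field R k).

Lemma sc_mk_sum (I : Type) (s : seq I) (F : I -> R) :
  sc_mk k (\sum_(i <- s) F i) 0 = \sum_(i <- s) sc_mk k (F i) 0.
Proof. by apply: (big_morph (fun r => sc_mk k r 0)); [exact: sc_mkD|exact: sc_mk0]. Qed.

Lemma sc_mkX (r : R) n : sc_mk k (r ^+ n) 0 = sc_mk k r 0 ^+ n.
Proof. by elim: n => [|n ih]; rewrite ?expr0 ?sc_mk1 // !exprS sc_mkM ih. Qed.

Lemma sc_mkV (r : R) : sc_mk k r^-1 0 = (sc_mk k r 0)^-1.
Proof.
have [->|r0] := eqVneq r 0; first by rewrite invr0 sc_mk0 invr0.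
have n0 : sc_mk k r 0 != 0.
  by apply/eqP; rewrite -(sc_mk0 R k) => /sc_mk_inj /eqP; rewrite (negbTE r0).
by apply: (mulfI n0); rewrite -sc_mkM !mulfV // sc_mk1.
Qed.

Lemma sc_mk_ge0 (e : K) : 0 <= e -> 0 <= sc_re e /\ e = sc_mk k (sc_re e) 0.
Proof.
by move: e; case: (k) => //= -[a b]; rewrite lecE /= => /andP[/eqP -> ->].
Qed.

Context {V : normedModType K}.

(** The average over the signs is bounded by the largest signed sum. *)
Lemma cotype2_rn : rademacher_cotype2 V -> exists2 C : R, 0 <= C &
  forall n (x : 'I_n -> V) (B : R),
    (forall e : 'I_n -> bool, rn (\sum_(i < n) (-1) ^+ e i *: x i) <= B) ->
    \sum_(i < n) rn (x i) ^+ 2 <= (C * B) ^+ 2.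
Proof.
case=> c /sc_mk_ge0[]; move: (sc_re c) => c' c0 cE h; exists c' => // n x B hB.
have := h n x.
under eq_bigr do rewrite rnE -sc_mkX.
under [X in _ <= _ * (_ * X)]eq_bigr do rewrite rnE -sc_mkX.
rewrite -!sc_mk_sum cE -sc_mkX.
have -> : (2 : K) = sc_mk k 2 0 by rewrite -[2]/(1 + 1) sc_mkD !sc_mk1.
rewrite -sc_mkX -sc_mkV -!sc_mkM sc_mk_le => {}h; apply: le_trans h _.
rewrite exprMn ler_wpM2l ?sqr_ge0 // mulrC ler_pdivrMr ?exprn_gt0 //.
apply: le_trans (_ : \sum_(e : {ffun 'I_n -> bool}) B ^+ 2 <= _).
  apply: ler_sum => e _; have := hB e; have := rn_ge0 (\sum_(i < n) (-1) ^+ e i *: x i).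
  set r := rn _ => r0 rB; rewrite ler_pXn2r ?nnegrE //; exact: le_trans rB.
by rewrite sumr_const card_ffun card_bool card_ord -[leLHS]mulr_natr natrX.
Qed.

(** Blocks of a non-convergent series would be bounded below in norm, although all
    their signed sums are bounded: this is excluded by cotype. *)
Lemma cotype2_series_cvg (v : nat -> V) (B : R) :
  banach V -> rademacher_cotype2 V ->
  (forall N (e : nat -> bool), rn (\sum_(i < N) (-1) ^+ e i *: v i) <= B) ->
  exists l, tends (series v) l.
Proof.
move=> bV /cotype2_rn[C C0 hC] hB; apply: bV => d d0; apply: contrapT => no.
have /choice[g hg] : forall N, exists n, (N <= n)%N /\ d <= rn (series v n - series v N).
  move=> N; apply: contrapT => no'; apply: no; exists N => n Nn.
  by rewrite ltNge; apply/negP => h; apply: no'; exists n.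
pose N := fix N j := if j is i.+1 then g (N i) else 0%N.
pose b j := series v (N j.+1) - series v (N j).
have bE j : b j = \sum_(N j <= i < N j.+1) v i.
  rewrite /b /series /= (@big_cat_nat _ _ _ (N j) 0 (g (N j))) ?(hg (N j)).1 //=.
  by rewrite addrAC subrr add0r.
have signs J (e : nat -> bool) : exists e' : nat -> bool,
    \sum_(j < J) (-1) ^+ e j *: b j = \sum_(i < N J) (-1) ^+ e' i *: v i.
  elim: J => [|J [e' ih]]; first by exists e; rewrite !big_ord0.
  exists (fun i => if (i < N J)%N then e' i else e J).
  rewrite big_ord_recr /= ih bE scaler_sumr.
  rewrite -(big_mkord xpredT (fun i => (-1) ^+ e' i *: v i)).
  rewrite -(big_mkord xpredT (fun i => (-1) ^+ (if (i < N J)%N then e' i else e J) *: v i)).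
  rewrite (@big_cat_nat _ _ _ (N J) 0 (g (N J))) ?(hg (N J)).1 //=.
  congr (_ + _); apply: eq_big_nat => i /andP[h1 h2]; first by rewrite h2.
  by rewrite ltnNge h1.
have lower J : J%:R * d ^+ 2 <= (C * B) ^+ 2.
  apply: le_trans (hC J (fun j => b j) B _); last first.
    move=> e; have [e' he'] := signs J (fun j => if insub j is Some i then e i else false).
    have -> : \sum_(i < J) (-1) ^+ e i *: b i = \sum_(i < N J) (-1) ^+ e' i *: v i.
      by rewrite -he'; apply: eq_bigr => i _; rewrite valK.
    exact: hB.
  apply: le_trans (_ : \sum_(j < J) d ^+ 2 <= _).
    by rewrite sumr_const card_ord mulr_natl.
  apply: ler_sum => j _; rewrite ler_pXn2r ?nnegrE ?rn_ge0 ?(ltW d0) //.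
  exact: (hg _).2.
have d2 : 0 < d ^+ 2 by rewrite exprn_gt0.
have := lower (Num.truncn ((C * B) ^+ 2 / d ^+ 2)).+1.
by rewrite -ler_pdivlMr // leNgt truncnS_gt.
Qed.

End cotype.

Section operators.
Context {R : realType} {k : scalar_kind}.
Local Notation K := (scalar_field R k).
Context {V : normedModType K}.
Implicit Types (x y : nat -> V) (f g : nat -> V -> K).
Hypotheses (bV : banach V) (cV : rademacher_cotype2 V).

(** The operator [sum f_n(.) x_n]. It is a projection when [f] and [x] are
    biorthogonal, and otherwise maps one basic sequence to another. *)
Definition represents (U : V -> V) f x : Prop :=
  forall u, tends (series (fun n => f n u *: x n)) (U u).

(** All signed partial sums of the series are bounded by [C * rn u], so cotype gives
    convergence. *)
Lemma represents_exists f x C : linear_functionals f -> sign_bounded f x C ->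
  exists U : V -> V, [/\ represents U f x,
    forall u v, U (u + v) = U u + U v, forall a u, U (a *: u) = a *: U u &
    forall u, rn (U u) <= C * rn u].
Proof.
move=> [fD fZ] h.
have /choice[U hO] : forall u, exists l, tends (series (fun n => f n u *: x n)) l.
  move=> u; apply: (@cotype2_series_cvg _ _ _ _ (C * rn u)) => // N e.
  by rewrite -(iota_ord (fun i => (-1) ^+ e i *: (f i u *: x i))) h ?iota_uniq.
exists U; split=> // [u v|a u|u].
- apply: tends_unique (hO _) _.
  have -> : series (fun n => f n (u + v) *: x n) =
      (fun N => series (fun n => f n u *: x n) N + series (fun n => f n v *: x n) N).
    apply/funext => N; rewrite !series_bigE -big_split /=; apply: eq_bigr => i _.
    by rewrite fD scalerDl.
  exact: tendsD.
- apply: tends_unique (hO _) _.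
  have -> : series (fun n => f n (a *: u) *: x n) =
      (fun N => a *: series (fun n => f n u *: x n) N).
    apply/funext => N; rewrite !series_bigE scaler_sumr; apply: eq_bigr => i _.
    by rewrite fZ scalerA.
  exact: tendsZ.
apply: (@tends_rn_le _ _ _ _ _ _ 0%N _ (hO u)) => N _.
rewrite series_bigE -(iota_ord (fun i => f i u *: x i)).
have := h (iota 0 N) (fun=> false) u (iota_uniq 0 N).
by under eq_bigr do rewrite expr0 scale1r.
Qed.

(** If [f] and [y] are biorthogonal, then [sum f_n(.) x_n] maps [y n] to [x n], hence maps
    the expansion of [U' u] along [y] to the series of [U'' u]. *)
Lemma represents_comp (U U' U'' : V -> V) f x g y C :
  represents U f x -> represents U' g y -> represents U'' g x ->
  linear_functionals f -> biorthogonal f y ->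
  (forall u v, U (u + v) = U u + U v) -> (forall a u, U (a *: u) = a *: U u) ->
  (forall u, rn (U u) <= C * rn u) ->
  forall u, U (U' u) = U'' u.
Proof.
move=> hO hO' hO'' lf bfy OD OZ OC u.
have ON v : U (- v) = - U v by rewrite -scaleN1r OZ scaleN1r.
have O0 : U 0 = 0 by rewrite -(scale0r 0) OZ !scale0r.
have Oy n : U (y n) = x n.
  exact: tends_unique (hO _) (biorthogonal_series x n bfy).
apply: tends_unique (hO'' u).
have h : tends (fun N => U (series (fun n => g n u *: y n) N)) (U (U' u)).
  by apply: (@tends_map _ _ _ _ U C) (hO' u) => N; rewrite -ON -OD.
suff -> : series (fun n => g n u *: x n) = (fun N => U (series (fun n => g n u *: y n) N)) by [].
apply/funext => N; rewrite !series_bigE; elim: N => [|N ih]; first by rewrite !big_ord0 O0.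
by rewrite !big_ord_recr /= OD OZ Oy ih.
Qed.

Definition pack_linear {W : normedModType K} (U : V -> W)
    (lO : linear U) : {linear V -> W} :=
  HB.pack U (GRing.isLinear.Build _ _ _ _ _ lO).

Lemma lip_of_bound (U : V -> V) C : (forall u v, U (u + v) = U u + U v) ->
  (forall a u, U (a *: u) = a *: U u) -> (forall u, rn (U u) <= C * rn u) ->
  continuous U.
Proof.
move=> OD OZ OC; apply: (@lip_continuous _ _ _ _ _ C) => u v.
by rewrite -[- U v]scaleN1r -OZ -OD scaleN1r.
Qed.

(** The operator of the system fixes every [x n], hence their closed span, and its
    values are limits of combinations of the [x n]. *)
Lemma sign_bounded_projection f x C : linear_functionals f -> biorthogonal f x ->
  sign_bounded f x C ->
  exists P : {linear V -> V}, [/\ represents P f x, bounded_projection P (closed_span x) &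
    forall u, rn (P u) <= C * rn u].
Proof.
move=> lf bx h; have [P [hP PD PZ PC]] := represents_exists lf h.
have lP : linear P by move=> a u v; rewrite PD PZ.
exists (pack_linear lP); split=> //; split=> /=.
- exact: lip_of_bound PC.
- by move=> u; apply: (represents_comp hP hP hP lf bx PD PZ PC).
have PN v : P (- v) = - P v by rewrite -scaleN1r PZ scaleN1r.
have Pfix u : closed_span x u -> P u = u.
  move=> /closure_rnP hu; apply/subr0_eq/rn_eq0/eqP; rewrite eq_le rn_ge0 andbT.
  apply: eps_le0 => e e0; have m0 : 0 < `|C| + 1 by have := normr_ge0 C; lra.
  have [v Av uv] := hu _ (divr_gt0 e0 m0).
  have Pv : P v = v.
    move: v Av {uv}; apply: fin_span_min => [|c u' v Pu' Pv|n].
    - by rewrite -(scale0r 0) PZ !scale0r.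
    - by rewrite PD PZ Pu' Pv.
    exact: tends_unique (hP _) (biorthogonal_series x n bx).
  have -> : P u - u = P (u - v) - (u - v) by rewrite PD PN Pv opprB addrA subrK.
  move: uv; rewrite ltr_pdivlMr // => uv; apply: le_lt_trans uv.
  apply: le_trans (rnB _ _) _; have := PC (u - v).
  have := ler_wpM2r (rn_ge0 (u - v)) (ler_norm C); lra.
apply/seteqP; split=> [_ [u _ <-]|u /Pfix <-]; last by exists u.
apply/closure_rnP => e e0; have [N hN] := hP u _ e0.
exists (series (fun n => f n u *: x n) N); last by rewrite rn_distC hN.
by exists N, (fun n => f n u); rewrite series_bigE.
Qed.

Lemma sign_bounded_basic f x C : linear_functionals f -> biorthogonal f x ->
  sign_bounded f x C -> basic_sequence x.
Proof.
move=> lf bx h; have [P [hP [_ _ rP] _]] := sign_bounded_projection lf bx h.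
have PP u : closed_span x u -> P u = u.
  by have [P' [hP' [_ PP' rP'] _]] := sign_bounded_projection lf bx h;
     rewrite -rP' => -[w _ <-]; rewrite (tends_unique (hP _) (hP' _)) PP'.
split=> [n|u Xu]; first exact/fin_span_sub/fin_span_vec.
exists (fun n => f n u); split.
  by apply/tendsP; have := hP u; rewrite PP.
move=> a /tendsP au; apply/funext => n.
have [D hD] := sign_bounded_functional n lf bx h.
exact: functional_coef lf bx hD au.
Qed.

Lemma sign_bounded_unconditional f x C : linear_functionals f -> biorthogonal f x ->
  sign_bounded f x C -> unconditional_basic x.
Proof.
move=> lf bx h s /bij_inj sI.
apply: (@sign_bounded_basic (f \o s) (x \o s) C).
- exact: linear_functionals_reindex.
- exact: biorthogonal_reindex.
- exact: sign_bounded_reindex.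
Qed.

Lemma sign_bounded_projecting f x C : linear_functionals f -> biorthogonal f x ->
  sign_bounded f x C -> projecting_functionals x f.
Proof.
move=> lf bx h; have [P [hP bP PC]] := sign_bounded_projection lf bx h.
exists P, f; split=> //.
  move=> u; have [_ PP <-] := bP; case=> w _ <-; apply/tendsP.
  by have := hP (P w); rewrite PP.
move=> n u; have [D hD] := sign_bounded_functional n lf bx h.
exact/esym/(@functional_coef _ _ _ f x n D (fun m => f m u) (P u) lf bx hD (hP u)).
Qed.

(** A perturbation argument: let [P] and [Q] be the projections of the systems [f], [x]
    and [g], [phi], and let [U] be the operator with functionals [f] and vectors [phi].
    If [f] and [g] are close, then [1 + U - Q] is invertible, and the automorphism is
    [(1 + U - Q) (1 - P) + U]. *)
Lemma congruent_of_close f x g phi C :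
  linear_functionals f -> linear_functionals g ->
  biorthogonal f x -> biorthogonal g phi ->
  sign_bounded f x C -> sign_bounded g phi C ->
  sign_bounded g x C -> sign_bounded f phi C ->
  (forall N u, rn (\sum_(i < N) (f i u - g i u) *: phi i) <= 2^-1 * rn u) ->
  congruent x phi.
Proof.
move=> lf lg bf bg hP hQ hR hR' small.
have [P [rP PD PZ PC]] := represents_exists lf hP.
have [Q [rQ QD QZ QC]] := represents_exists lg hQ.
have [S [rS SD SZ SC]] := represents_exists lg hR.
have [U [rO OD OZ OC]] := represents_exists lf hR'.
have PN v : P (- v) = - P v by rewrite -scaleN1r PZ scaleN1r.
have QN v : Q (- v) = - Q v by rewrite -scaleN1r QZ scaleN1r.
have SN v : S (- v) = - S v by rewrite -scaleN1r SZ scaleN1r.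
have ON v : U (- v) = - U v by rewrite -scaleN1r OZ scaleN1r.
pose E u := U u - Q u.
have ED u v : E (u + v) = E u + E v by rewrite /E OD QD opprD addrACA.
have EZ a u : E (a *: u) = a *: E u by rewrite /E OZ QZ scalerBr.
have Ebd u : rn (E u) <= 2^-1 * rn u.
  have h : tends (fun N => series (fun n => f n u *: phi n) N +
      - series (fun n => g n u *: phi n) N) (E u).
    apply: tendsD (rO u) _; apply: (@tends_map _ _ _ _ (fun w => - w) 1) (rQ u) => N.
    by rewrite -opprD rnN mul1r.
  apply: (@tends_rn_le _ _ _ _ _ _ 0%N _ h) => N _.
  rewrite !series_bigE -sumrB; under eq_bigr do rewrite -scalerBl.
  exact: small.
have [T [TE ET TD TZ TC]] := neumann bV ED EZ Ebd.
have TN v : T (- v) = - T v by rewrite -scaleN1r TZ scaleN1r.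
have PP u : P (P u) = P u := represents_comp rP rP rP lf bf PD PZ PC u.
have QQ u : Q (Q u) = Q u := represents_comp rQ rQ rQ lg bg QD QZ QC u.
have OP u : U (P u) = U u := represents_comp rO rP rO lf bf OD OZ OC u.
have QO u : Q (U u) = U u := represents_comp rQ rO rO lg bg QD QZ QC u.
have SO u : S (U u) = P u := represents_comp rS rO rP lg bg SD SZ SC u.
have SQ u : S (Q u) = S u := represents_comp rS rQ rS lg bg SD SZ SC u.
(* [Q] and [S] are applied to the identity [T + E T = 1]. *)
have OT u : U (T u) = Q u.
  by have := congr1 Q (TE u); rewrite QD /E QD QN QO QQ addrCA subrr addr0.
have PT u : P (T u) = S u.
  by have := congr1 S (TE u); rewrite SD /E SD SN SO SQ addrCA subrr addr0.
clearbody E.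
(* [A] maps the kernel of [P] by [1 + E] and its range to that of [Q]; the inverse is
   found from the identities between [P], [Q], [S], [U] and [T] above. *)
pose A u := (u - P u) + E (u - P u) + U u.
pose B v := T v + P (T v) - T (U (T v)).
have AD u v : A (u + v) = A u + A v.
  rewrite /A PD opprD addrACA (ED (u - P u)) OD (addrACA (u - P u)).
  by rewrite (addrACA (u - P u + E (u - P u))).
have AZ a u : A (a *: u) = a *: A u.
  by rewrite /A PZ -scalerBr EZ OZ !scalerDr.
have BD u v : B (u + v) = B u + B v.
  rewrite /B !(TD, PD, OD) opprD (addrACA (T u)).
  by rewrite (addrACA (T u + P (T u))).
have BZ a u : B (a *: u) = a *: B u.
  by rewrite /B !(TZ, PZ, OZ) -scalerN !scalerDr.
have Abd u : rn (A u) <= (2 * (1 + `|C|) + `|C|) * rn u.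
  have h : rn (u - P u) <= (1 + `|C|) * rn u.
    apply: le_trans (rnB _ _) _; have := PC u.
    have := ler_wpM2r (rn_ge0 u) (ler_norm C); lra.
  have := rnD (u - P u + E (u - P u)) (U u); have := rnD (u - P u) (E (u - P u)).
  have := Ebd (u - P u); have := OC u; have := ler_wpM2r (rn_ge0 u) (ler_norm C).
  have := rn_ge0 (u - P u).
  by rewrite /A; lra.
have Bbd u : rn (B u) <= (2 + `|C| * 2 + 2 * `|C| * 2) * rn u.
  have h v : rn (P v) <= `|C| * rn v.
    by apply: le_trans (PC v) _; rewrite ler_wpM2r ?rn_ge0 ?ler_norm.
  have h' v : rn (U v) <= `|C| * rn v.
    by apply: le_trans (OC v) _; rewrite ler_wpM2r ?rn_ge0 ?ler_norm.
  have t := TC u.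
  have t1 := le_trans (h (T u)) (ler_wpM2l (normr_ge0 C) t).
  have t2 := le_trans (h' (T u)) (ler_wpM2l (normr_ge0 C) t).
  have t3 := TC (U (T u)).
  have := rnB (T u + P (T u)) (T (U (T u))); have := rnD (T u) (P (T u)).
  by rewrite /B; lra.
have BA : cancel A B.
  move=> u; have TA : T (A u) = u - P u + T (U u) by rewrite /A TD ET.
  have PA : P (T (A u)) = P u by rewrite TA (PD (u - P u)) (PD u) PN PP subrr add0r PT SO.
  have OA : U (T (A u)) = U u.
    by rewrite TA (OD (u - P u)) (OD u) ON OP subrr add0r OT QO.
  by rewrite /B PA OA TA addrAC addrK subrK.
have AB : cancel B A.
  move=> v; have PB : P (B v) = P (T v).
    rewrite /B (PD (T v + P (T v))) (PD (T v)) PN PP (PT (U (T v))) SO.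
    by rewrite addrK.
  have OB : U (B v) = U (T v).
    by rewrite /B (OD (T v + P (T v))) (OD (T v)) ON OP (OT (U (T v))) QO addrK.
  have BP : B v - P (B v) = T v - T (U (T v)).
    by rewrite PB /B addrAC addrK.
  rewrite /A BP OB -TN -TD TE.
  by rewrite subrK.
have lA : linear A by move=> a u v; rewrite AD AZ.
exists (pack_linear lA), B; split=> //.
- exact: lip_of_bound Abd.
- exact: lip_of_bound Bbd.
move=> n /=.
have fixP : P (x n) = x n := tends_unique (rP _) (biorthogonal_series x n bf).
have fixO : U (x n) = phi n := tends_unique (rO _) (biorthogonal_series phi n bf).
rewrite /A fixP fixO subrr -{2}(scale0r 0) EZ scale0r !add0r //.
Qed.

End operators.

(** * Norming functionals *)

Section hahn_banach.
Context {R : realType} {k : scalar_kind}.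
Local Notation K := (scalar_field R k).
Context {V : normedModType K}.
Local Notation "r %:S" := (sc_mk k r 0) (at level 2).

(** Finite-dimensional Hahn-Banach theorem, in coordinates: a norming functional of
    the first vector is extended one real dimension at a time. *)
Lemma real_norming_coefs (e : nat -> V) n : exists b : nat -> R,
  b 0%N = rn (e 0%N) /\
  forall w : nat -> R, \sum_(i < n.+1) w i * b i <= rn (\sum_(i < n.+1) (w i)%:S *: e i).
Proof.
elim: n => [|n [b [b0 hb]]].
  exists (fun=> rn (e 0%N)); split=> // w; rewrite !big_ord_recl !big_ord0 !addr0 rnZ.
  by rewrite modulus_mk ler_wpM2r ?rn_ge0 ?ler_norm.
pose A := [set s : R | exists w : nat -> R,
  s = \sum_(i < n.+1) w i * b i - rn (\sum_(i < n.+1) (w i)%:S *: e i - e n.+1)].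
have key (w w' : nat -> R) :
    \sum_(i < n.+1) w i * b i - rn (\sum_(i < n.+1) (w i)%:S *: e i - e n.+1) <=
    rn (\sum_(i < n.+1) (w' i)%:S *: e i + e n.+1) - \sum_(i < n.+1) w' i * b i.
  rewrite lerBlDr addrAC lerBrDr -big_split /=.
  have e1 : \sum_(i < n.+1) (w i + w' i) * b i =
      \sum_(i < n.+1) w i * b i + \sum_(i < n.+1) w' i * b i.
    by rewrite -big_split; apply: eq_bigr => i _; rewrite mulrDl.
  have e2 : \sum_(i < n.+1) (w i + w' i)%:S *: e i =
      \sum_(i < n.+1) (w i)%:S *: e i + \sum_(i < n.+1) (w' i)%:S *: e i.
    by rewrite -big_split; apply: eq_bigr => i _; rewrite sc_mkD scalerDl.
  have := hb (fun i => w i + w' i); rewrite big_split /= e1 e2 => h; apply: le_trans h _.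
  apply: le_trans (rnD _ _); rewrite le_eqVlt; apply/orP; left; apply/eqP; congr rn.
  by rewrite addrACA subrr addr0 addrC.
have A0 : A !=set0 by exists (\sum_(i < n.+1) 0 * b i - rn (\sum_(i < n.+1) (0)%:S *: e i - e n.+1)), (fun=> 0).
have ubA (w' : nat -> R) :
    ubound A (rn (\sum_(i < n.+1) (w' i)%:S *: e i + e n.+1) - \sum_(i < n.+1) w' i * b i).
  by move=> _ [w ->]; exact: key.
have hA : has_sup A by split=> //; eexists; exact: (ubA (fun=> 0)).
exists (fun i => if i == n.+1 then sup A else b i); split=> // w.
rewrite !(big_ord_recr n.+1) /= eqxx.
under eq_bigr => i _ do rewrite ltn_eqF ?(ltn_ord i) //.
set t := w n.+1.
have scale (c : R) (w' : nat -> R) : 0 < c ->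
    \sum_(i < n.+1) w i * b i = c * \sum_(i < n.+1) (c^-1 * w i) * b i /\
    \sum_(i < n.+1) (w i)%:S *: e i = c%:S *: \sum_(i < n.+1) (c^-1 * w i)%:S *: e i.
  move=> c0; rewrite mulr_sumr scaler_sumr; split; apply: eq_bigr => i _.
    by rewrite !mulrA divff ?gt_eqF // mul1r.
  by rewrite scalerA -sc_mkM mulrA divff ?gt_eqF // mul1r.
have [t0|t0|->] := ltgtP t 0; last by rewrite mul0r sc_mk0 scale0r !addr0.
- have nt0 : 0 < - t by rewrite oppr_gt0.
  have [-> ->] := scale _ w nt0.
  have -> : t%:S *: e n.+1 = (- t)%:S *: - e n.+1 by rewrite sc_mkN scaleNr scalerN opprK.
  rewrite -scalerDr rnZ modulus_mk (gtr0_norm nt0).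
  have -> : t * sup A = (- t) * - sup A by rewrite mulrNN.
  rewrite -mulrDr ler_pM2l // lerBlDr -lerBlDl.
  apply: sup_upper_bound => //; by exists (fun i => (- t)^-1 * w i).
- have [-> ->] := scale _ w t0.
  rewrite -(scalerDr t%:S) rnZ modulus_mk (gtr0_norm t0).
  rewrite -mulrDr ler_pM2l // addrC -lerBrDr.
  by apply: ge_sup => //; exact: ubA (fun i => t^-1 * w i).
Qed.

(** The [b i] are the values at the [x i] of a functional of norm at most one whose value
    at the given combination is its norm. They stand for a functional on the span of
    the [x i]. *)
Lemma norming_coefs (x : nat -> V) N (a : nat -> K) : exists b : nat -> K,
  sc_re (\sum_(i < N) a i * b i) = rn (\sum_(i < N) a i *: x i) /\
  forall w : nat -> K, sc_re (\sum_(i < N) w i * b i) <= rn (\sum_(i < N) w i *: x i).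
Proof.
pose iu : K := match k return scalar_field R k with
  | RealScalars => 0 | ComplexScalars => 'i%C end.
have wE (z : K) : z = (sc_re z)%:S + (sc_im z)%:S * iu.
  move: z; rewrite /iu; case: (k) => /= [z|[c d]]; first by rewrite mulr0 addr0.
  by apply/eqP; rewrite eq_complex /=; apply/andP; split; apply/eqP; ring.
pose v := \sum_(i < N) a i *: x i.
(* A real system whose span contains the vector to be normed, first, and all the
   [x i] and [iu *: x i]. *)
pose e n := if n is m.+1 then (if odd m then iu *: x m./2 else x m./2) else v.
have [c [c0 hc]] := real_norming_coefs e (2 * N)%N.
have sumE (U : nmodType) (F : nat -> U) :
    \sum_(i < (2 * N).+1) F i = F 0%N + \sum_(i < N) (F (2 * i).+1 + F (2 * i).+2).
  rewrite big_ord_recl /=; congr (_ + _).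
  elim: N {v e c c0 hc} => [|M ih]; first by rewrite muln0 !big_ord0.
  rewrite mulnS !addSn add0n !big_ord_recr /= ih -addrA.
  by [].
(* A complex functional with real part [phi] is [z |-> phi z - i phi (i z)]. *)
pose b i := match k return scalar_field R k with
  | RealScalars => sc_mk RealScalars (c (2 * i).+1) 0
  | ComplexScalars => sc_mk ComplexScalars (c (2 * i).+1) (- c (2 * i).+2) end.
have reb (z : K) i : sc_re (z * b i) = sc_re z * c (2 * i).+1 + sc_im z * c (2 * i).+2.
  move: z; rewrite /b; case: (k) => /= [z|[p q]]; first by rewrite mul0r addr0.
  by rewrite -[LHS]/(p * c (2 * i)%N.+1 - q * - c (2 * i)%N.+2) mulrN opprK.
have main t (w : nat -> K) :
    t * rn v + sc_re (\sum_(i < N) w i * b i) <= rn (t%:S *: v + \sum_(i < N) w i *: x i).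
  pose W n := if n is m.+1 then (if odd m then sc_im (w m./2) else sc_re (w m./2)) else t.
  have o i : odd (2 * i) = false by rewrite mul2n odd_double.
  have h i : ((2 * i)./2 = i)%N by rewrite mul2n doubleK.
  have u i : (uphalf (2 * i) = i)%N by rewrite mul2n uphalf_double.
  have E1 i : W (2 * i).+1%N * c (2 * i).+1%N + W (2 * i).+2%N * c (2 * i).+2%N = sc_re (w i * b i).
    by rewrite /W /= o h u reb.
  have E2 i : (W (2 * i).+1%N)%:S *: e (2 * i).+1%N + (W (2 * i).+2%N)%:S *: e (2 * i).+2%N = w i *: x i.
    by rewrite /W /e /= o h u [in RHS](wE (w i)) scalerDl scalerA.
  have := hc W.
  rewrite (sumE _ (fun n => W n * c n)) (sumE _ (fun n => (W n)%:S *: e n)) c0 sc_re_sum.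
  under eq_bigr => i _ do rewrite E1.
  by under [X in _ <= rn (_ + X) -> _]eq_bigr => i _ do rewrite E2.
exists b; split; last first.
  by move=> w; have := main 0 w; rewrite mul0r add0r sc_mk0 scale0r add0r.
apply/eqP; rewrite eq_le; apply/andP; split.
  by have := main 0 a; rewrite mul0r add0r sc_mk0 scale0r add0r.
have := main 1 (fun i => - a i); rewrite mul1r sc_mk1 scale1r.
under eq_bigr do rewrite mulNr.
under [X in _ <= rn (_ + X) -> _]eq_bigr do rewrite scaleNr.
by rewrite !sumrN sc_reN subrr rn0 subr_le0.
Qed.

End hahn_banach.

(** * Function norms and their spaces *)

Section function_norm_facts.
Context {d : measure_display} {T : measurableType d} {R : realType}.
Context {mu : {measure set T -> \bar R}}.
Variable rho : function_norm mu.
Local Open Scope ereal_scope.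
Implicit Types (f g : T -> \bar R).

Lemma nneg_measurable_ge0 f x : nneg_measurable f -> 0 <= f x.
Proof. by case. Qed.

Lemma nneg_measurable0 : nneg_measurable (fun=> 0 : \bar R) (T := T).
Proof. by split=> // x; exact: measurable_cst. Qed.

Lemma nneg_measurableD f g : nneg_measurable f -> nneg_measurable g ->
  nneg_measurable (fun x => f x + g x).
Proof.
by move=> [mf f0] [mg g0]; split=> [|x]; [exact: emeasurable_funD|exact: adde_ge0].
Qed.

Lemma nneg_measurable_sum (I : Type) (s : seq I) (f : I -> T -> \bar R) :
  (forall i, nneg_measurable (f i)) -> nneg_measurable (fun x => \sum_(i <- s) f i x).
Proof.
move=> nf; elim: s => [|i s ih].
  by rewrite (_ : (fun x => _) = fun=> 0) ?nneg_measurable0 //; apply/funext => x; rewrite big_nil.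
rewrite (_ : (fun x => _) = fun x => f i x + \sum_(j <- s) f j x).
  exact: nneg_measurableD.
by apply/funext => x; rewrite big_cons.
Qed.

Lemma nneg_measurableZ (t : R) f : (0 <= t)%R -> nneg_measurable f ->
  nneg_measurable (fun x => t%:E * f x).
Proof.
move=> t0 [mf f0]; split=> [|x]; last by rewrite mule_ge0.
exact: measurable_funeM.
Qed.

Lemma nneg_measurable_series (f : nat -> T -> \bar R) :
  (forall i, nneg_measurable (f i)) -> nneg_measurable (fun x => \sum_(0 <= i <oo) f i x).
Proof.
move=> nf; split=> [|x]; last by apply: nneseries_ge0 => i _ _; case: (nf i).
apply: ge0_emeasurable_sum => [i x _ _|i _]; by case: (nf i).
Qed.

Lemma fnorm_ae f g : nneg_measurable f -> nneg_measurable g ->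
  {ae mu, forall x, f x = g x} -> rho f = rho g.
Proof.
move=> nf ng fg; apply/eqP; rewrite eq_le !le_fnorm //.
  by apply: filterS fg => x ->.
by apply: filterS fg => x ->.
Qed.

Lemma fnorm_le f g : nneg_measurable f -> nneg_measurable g ->
  (forall x, f x <= g x) -> rho f <= rho g.
Proof. by move=> nf ng fg; apply: le_fnorm => //; exact: nearW. Qed.

Lemma fnorm0 : rho (fun=> 0) = 0.
Proof. by apply/(fnorm_eq0 rho nneg_measurable0); exact: nearW. Qed.

Lemma fnorm_sum (I : Type) (s : seq I) (f : I -> T -> \bar R) :
  (forall i, nneg_measurable (f i)) ->
  rho (fun x => \sum_(i <- s) f i x) <= \sum_(i <- s) rho (f i).
Proof.
move=> nf; elim: s => [|i s ih].
  by rewrite (_ : (fun x => _) = fun=> 0) ?fnorm0 ?big_nil //; apply/funext => x; rewrite big_nil.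
rewrite (_ : (fun x => _) = fun x => f i x + \sum_(j <- s) f j x); last first.
  by apply/funext => x; rewrite big_cons.
rewrite big_cons; apply: le_trans (fnormD _ _ _) _ => //; first exact: nneg_measurable_sum.
exact: leeD.
Qed.

(** Countable subadditivity, from the Fatou property. *)
Lemma fnorm_series (f : nat -> T -> \bar R) (B : \bar R) :
  (forall i, nneg_measurable (f i)) ->
  (forall N, \sum_(0 <= i < N) rho (f i) <= B) ->
  rho (fun x => \sum_(0 <= i <oo) f i x) <= B.
Proof.
move=> nf hB.
have nd x : nondecreasing_seq (fun n => \sum_(0 <= i < n) f i x).
  by apply: ereal_nondecreasing_series => i _ _; case: (nf i).
rewrite (@fnorm_lim _ _ _ mu rho (fun n x => \sum_(0 <= i < n) f i x)) //; last first.
  by move=> n; exact: nneg_measurable_sum.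
apply: lime_le.
  apply: ereal_nondecreasing_is_cvgn => m n mn.
  by apply: fnorm_le => [||x]; [exact: nneg_measurable_sum|exact: nneg_measurable_sum|exact: nd].
by apply: nearW => n; apply: le_trans (hB n); exact: fnorm_sum.
Qed.

(** The function is at least [n] times the indicator of its infinite part. *)
Lemma fnorm_ae_fin f : nneg_measurable f -> rho f < +oo ->
  {ae mu, forall x, f x < +oo}.
Proof.
move=> nf foo; have [mf f0] := nf.
pose E := [set x | f x = +oo].
have mE : measurable E.
  rewrite (_ : E = setT `&` f @^-1` [set +oo]); first exact: mf.
  by rewrite setTI.
have nE : nneg_measurable (EFin \o \1_E : T -> \bar R).
  by split=> [|x]; [exact/measurable_EFinP/measurable_indic|rewrite lee_fin].
have hn (n : nat) : n%:R%:E * rho (EFin \o \1_E) <= rho f.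
  rewrite -fnormZ //; apply: fnorm_le => // [|x]; first exact: nneg_measurableZ.
  rewrite /= indicE; case: (boolP (x \in E)) => [|_] /=; last by rewrite mule0.
  by rewrite inE /E /= => ->; rewrite leey.
have E0 : rho (EFin \o \1_E) = 0.
  have r0 := fnorm_ge0 rho nE.
  have [rf rE] : rho f \is a fin_num /\ rho (EFin \o \1_E) \is a fin_num.
    split; first by rewrite ge0_fin_numE // fnorm_ge0.
    by rewrite ge0_fin_numE //; apply: le_lt_trans foo; have := hn 1%N; rewrite mul1e.
  move: r0 hn; rewrite -(fineK rf) -(fineK rE) lee_fin; set b := fine _; set a := fine _.
  move=> b0 hn; congr EFin; apply/eqP; rewrite eq_le b0 andbT leNgt; apply/negP => bp.
  have := hn (Num.truncn (a / b)).+1; rewrite -EFinM lee_fin -ler_pdivlMr //.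
  by rewrite leNgt truncnS_gt.
have := (fnorm_eq0 rho nE).1 E0; apply: filterS => x /=; rewrite indicE => -[] h.
rewrite ltey; apply/eqP => fx; move: h; rewrite mem_set //= => /eqP.
by rewrite oner_eq0.
Qed.

End function_norm_facts.

Section Lrho_functions.
Context {d : measure_display} {T : measurableType d} {R : realType}.
Context {k : scalar_kind} {mu : {measure set T -> \bar R}} {rho : function_norm mu}.
Local Notation K := (scalar_field R k).
Implicit Types (u v : Lrho k rho) (f g : T -> K).

(* The functions underlying elements of [Lrho] are only determined almost everywhere,
   so the algebraic operations are computed almost everywhere. *)
Lemma Lrho_in_L u : in_L rho (u : T -> K).
Proof. exact: rfunP. Qed.

Lemma rn_Lrho u : (rn u)%:E = rho (eabs (u : T -> K)).
Proof. by rewrite -rfun_normE; congr EFin; rewrite /rn sc_re_mk. Qed.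

Lemma Lrho_nneg u : nneg_measurable (eabs (u : T -> K)).
Proof. exact/eabs_nneg/Lrho_in_L. Qed.

Lemma rfun_eq_ae (f g : rfun k rho) : Lclass f = Lclass g <-> {ae mu, forall x, f x = g x}.
Proof.
rewrite Lclass_eq; split=> [/null_predP /asboolP|h].
  by apply: filterS => x /subr0_eq.
by apply/null_predP/asboolP; apply: filterS h => x fg; apply/eqP; rewrite subr_eq0; apply/eqP.
Qed.

Lemma Lrepr_ae (f : rfun k rho) : {ae mu, forall x, Lclass f x = f x}.
Proof. by apply/rfun_eq_ae; rewrite LreprK. Qed.

(** The class of a function, and [0] when the function is not in the space: this avoids
    proofs of membership inside terms. *)
Definition Lof f : Lrho k rho :=
  match pselect (in_L rho f) with
  | left h => Lclass (MkRfun (asboolT h : f \in @rfun_pred _ _ _ k _ rho))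
  | right _ => 0
  end.

Lemma Lof_ae f : in_L rho f -> {ae mu, forall x, Lof f x = f x}.
Proof. by move=> h; rewrite /Lof; case: pselect => // h'; exact: Lrepr_ae. Qed.

Lemma rn_Lof f : in_L rho f -> (rn (Lof f))%:E = rho (eabs f).
Proof.
move=> h; rewrite rn_Lrho; apply: fnorm_ae; [exact: Lrho_nneg|exact: (eabs_nneg h)|].
by apply: filterS (Lof_ae h) => x; rewrite /eabs => ->.
Qed.

Lemma LrhoD_ae u v : {ae mu, forall x, Lrho_fun (u + v) x = u x + v x}.
Proof.
have -> : u + v = Lclass (Lrepr u + Lrepr v) by rewrite LclassD !LreprK.
exact: Lrepr_ae.
Qed.

Lemma LrhoZ_ae a u : {ae mu, forall x, Lrho_fun (a *: u) x = a * u x}.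
Proof. exact: Lrepr_ae. Qed.

Lemma Lrho0_ae : {ae mu, forall x, Lrho_fun (0 : Lrho k rho) x = 0}.
Proof. by have := LrhoZ_ae 0 0; rewrite scale0r; apply: filterS => x ->; rewrite mul0r. Qed.

Lemma LrhoB_ae u v : {ae mu, forall x, Lrho_fun (u - v) x = u x - v x}.
Proof.
rewrite -scaleN1r; apply: filterS2 (LrhoD_ae u (-1 *: v)) (LrhoZ_ae (-1) v).
by move=> x -> ->; rewrite mulN1r.
Qed.

Lemma Lrho_sum_ae (I : Type) (s : seq I) (a : I -> K) (u : I -> Lrho k rho) :
  {ae mu, forall x, Lrho_fun (\sum_(i <- s) a i *: u i) x = \sum_(i <- s) a i * u i x}.
Proof.
elim: s => [|i s ih].
  by rewrite big_nil; apply: filterS Lrho0_ae => x ->; rewrite big_nil.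
have h1 := LrhoD_ae (a i *: u i) (\sum_(j <- s) a j *: u j).
rewrite big_cons; apply: filterS3 h1 (LrhoZ_ae (a i) (u i)) ih => x.
by move=> -> -> ->; rewrite big_cons.
Qed.

Lemma in_L_le f (g : T -> \bar R) : sc_measurable f -> nneg_measurable g ->
  (forall x, (eabs f x <= g x)%E) -> (rho g < +oo)%E -> in_L rho f.
Proof.
move=> mf ng fg goo; split=> //; apply: le_lt_trans goo.
by apply: fnorm_le => //; exact: nneg_measurable_eabs.
Qed.

Lemma in_LD f g : in_L rho f -> in_L rho g -> in_L rho (fun x => f x + g x).
Proof.
move=> hf hg; have [mf foo] := hf; have [mg goo] := hg.
split; first exact: sc_measurableD.
by apply: le_lt_trans (fnorm_eabsD hf hg) _; exact: lte_add_pinfty.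
Qed.

End Lrho_functions.
Arguments Lof {d T R k mu} rho f.

(** * Completeness of the function space *)

Section completeness_of_Lrho.
Context {d : measure_display} {T : measurableType d} {R : realType}.
Context {k : scalar_kind} {mu : {measure set T -> \bar R}} {rho : function_norm mu}.
Local Notation K := (scalar_field R k).

Lemma sc_mk_im (a b : R) : sc_im (sc_mk k a b) = if k is ComplexScalars then b else 0.
Proof. by case: k. Qed.

Lemma sc_mk_re (a b : R) : sc_re (sc_mk k a b) = a.
Proof. by case: k. Qed.

Lemma sc_measurableB (f g : T -> K) :
  sc_measurable f -> sc_measurable g -> sc_measurable (fun x => f x - g x).
Proof.
move=> mf mg; have := sc_measurableD mf (sc_measurableZ (-1) mg).
by congr sc_measurable; apply/funext => x; rewrite mulN1r.
Qed.

Lemma summable_increments_cvg (r : nat -> R) (g : nat -> \bar R) :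
  (forall n, `|r n.+1 - r n|%:E <= g n)%E -> (\sum_(0 <= i <oo) g i < +oo)%E ->
  cvgn r.
Proof.
move=> rg goo.
have g0 n : (0 <= g n)%E by apply: le_trans (rg n); rewrite lee_fin.
suff : cvgn (series (telescope r)).
  move=> h; have -> : r = (fun n => r 0%N + series (telescope r) n).
    by apply/funext => n; rewrite telescopeK /= addrC subrK.
  by apply: is_cvgD => //; exact: is_cvg_cst.
apply: normed_cvg; apply: nondecreasing_is_cvgn.
  by apply: nondecreasing_series => n _ _; exact: normr_ge0.
exists (fine (\sum_(0 <= i <oo) g i)%E) => _ [n _ <-].
rewrite -lee_fin fineK; last first.
  by rewrite ge0_fin_numE //; apply: nneseries_ge0 => i _ _; exact: g0.
apply: le_trans (nneseries_lim_ge n _) => //.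
by rewrite /series /= -sumEFin; apply: lee_sum => i _; exact: rg.
Qed.

Lemma geometric_partial_sum n N :
  (\sum_(0 <= i < N) (2^-1 ^+ (n + i))%:E <= (2 * 2^-1 ^+ n : R)%:E)%E.
Proof.
rewrite sumEFin lee_fin.
suff -> : \sum_(0 <= i < N) (2^-1 ^+ (n + i)) = 2 * 2^-1 ^+ n - 2 * 2^-1 ^+ (n + N) :> R.
  by rewrite gerBl mulr_ge0 // exprn_ge0.
elim: N => [|N ih]; first by rewrite big_nil addn0 subrr.
by rewrite big_nat_recr //= ih addnS exprS; field.
Qed.

(** A Riesz-Fischer theorem: the series of increments of a rapidly Cauchy sequence
    is dominated by a function of finite norm, hence converges almost everywhere. *)
Lemma Lrho_banach : banach (Lrho k rho).
Proof.
apply: banach_of_rapid => u hu.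
pose U n : T -> K := Lrho_fun (u n).
have mU n : sc_measurable (U n) by case: (Lrho_in_L (u n)).
pose g n := eabs (fun x => U n.+1 x - U n x).
have ng n : nneg_measurable (g n) by apply/nneg_measurable_eabs/sc_measurableB.
have rg n : (rho (g n) <= (2^-1 ^+ n)%:E)%E.
  have <- : rho (eabs (Lrho_fun (u n.+1 - u n))) = rho (g n).
    apply: fnorm_ae => //; first exact: Lrho_nneg.
    by apply: filterS (LrhoB_ae (u n.+1) (u n)) => x; rewrite /g /eabs => ->.
  by rewrite -rn_Lrho lee_fin.
pose G n x := (\sum_(0 <= i <oo) g (n + i)%N x)%E.
have nG n : nneg_measurable (G n) by apply: nneg_measurable_series.
have rG n : (rho (G n) <= (2 * 2^-1 ^+ n)%:E)%E.
  apply: fnorm_series => // N.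
  apply: le_trans (geometric_partial_sum n N).
  by apply: lee_sum => i _; exact: rg.
have Gfin : {ae mu, forall x, (G 0%N x < +oo)%E}.
  by apply: (@fnorm_ae_fin _ _ _ _ rho) => //; apply: le_lt_trans (rG 0%N) _; exact: ltry.
pose D := [set x | (G 0%N x < +oo)%E].
have mD : measurable D.
  by rewrite -(setTI D); exact: (emeasurable_fun_infty_o measurableT (nG 0%N).1).
have gD n m x : (n <= m)%N -> ((modulus (U m x - U n x))%:E <= G n x)%E.
  move=> /subnKC <-; set j := (m - n)%N.
  apply: le_trans (nneseries_lim_ge j _); last by move=> i _ _; case: (ng (n + i)%N).
  elim: j => [|j ih]; first by rewrite addn0 subrr modulus0 big_nil.
  rewrite big_nat_recr //=; apply: le_trans (leeD ih (lexx _)).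
  rewrite /g /eabs -EFinD lee_fin addnS.
  by have := modulusD (U (n + j).+1 x - U (n + j)%N x) (U (n + j)%N x - U n x); rewrite subrKA; lra.
pose hr n x := sc_re (U n x) * \1_D x.
pose hi n x := sc_im (U n x) * \1_D x.
have g0E x : G 0%N x = (\sum_(0 <= i <oo) g i x)%E by [].
have chr x : cvgn (hr ^~ x).
  rewrite /hr indicE; case: (boolP (x \in D)) => [|_] /=; last first.
    by under eq_fun do rewrite mulr0; exact: is_cvg_cst.
  rewrite inE /D /= => Dx; under eq_fun do rewrite mulr1.
  apply: (@summable_increments_cvg _ (g^~ x)) => // n.
  by rewrite lee_fin -sc_reB abs_re_le.
have chi x : cvgn (hi ^~ x).
  rewrite /hi indicE; case: (boolP (x \in D)) => [|_] /=; last first.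
    by under eq_fun do rewrite mulr0; exact: is_cvg_cst.
  rewrite inE /D /= => Dx; under eq_fun do rewrite mulr1.
  apply: (@summable_increments_cvg _ (g^~ x)) => // n.
  by rewrite lee_fin -sc_imB abs_im_le.
pose fr x := limn (hr ^~ x); pose fi x := limn (hi ^~ x).
pose f x : K := sc_mk k (fr x) (fi x).
have mf : sc_measurable f.
  have mr : measurable_fun setT fr.
    apply: (@measurable_fun_cvg _ _ _ _ hr) => [n|x _]; last exact: chr.
    by apply: measurable_funM; [case: (mU n)|exact: measurable_indic].
  have mi : measurable_fun setT fi.
    apply: (@measurable_fun_cvg _ _ _ _ hi) => [n|x _]; last exact: chi.
    by apply: measurable_funM; [case: (mU n)|exact: measurable_indic].
  split; first by rewrite (_ : _ \o _ = fr) //; apply/funext => x /=; rewrite sc_mk_re.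
  rewrite (_ : _ \o _ = if k is ComplexScalars then fi else fun=> 0); first by case: (k).
  by apply/funext => x /=; rewrite sc_mk_im; case: (k).
have key n x : D x -> (eabs (fun x => f x - U n x)%R x <= G n x)%E.
  move=> Dx; rewrite /eabs.
  have := nneg_measurable_ge0 x (nG n); have := fun m => @gD n m x.
  case: (G n x) => [t|_ _|//]; last by rewrite leey.
  move=> ht _; rewrite lee_fin; apply/ler_addgt0Pr => e e0.
  have e2 : 0 < e / 2 by lra.
  near \oo => m.
  have nm : (n <= m)%N by near: m; exact: nbhs_infty_ge.
  have h1 : `|fr x - hr m x| < e / 2.
    by near: m; move/cvgrPdist_lt: (chr x); apply.
  have h2 : `|fi x - hi m x| < e / 2.
    by near: m; move/cvgrPdist_lt: (chi x); apply.
  have := ht m nm; rewrite lee_fin => h3.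
  have := modulusD (f x - U m x) (U m x - U n x); rewrite subrKA.
  have := modulus_le (f x - U m x).
  move: h1 h2; rewrite /hr /hi indicE mem_set // !mulr1 sc_reB sc_imB sc_mk_re sc_mk_im => h1 h2.
  have : `|(if k is ComplexScalars then fi x else 0) - sc_im (U m x)| <= `|fi x - sc_im (U m x)|.
    by move: (U m x); case: (k) => //= z; rewrite subrr normr0.
  lra.
have mfU n : nneg_measurable (eabs (fun x => f x - U n x)).
  exact/nneg_measurable_eabs/sc_measurableB.
have rfU n : (rho (eabs (fun x => f x - U n x)%R) <= (2 * 2^-1 ^+ n)%:E)%E.
  apply: le_trans (rG n); apply: le_fnorm => //.
  by apply: filterS Gfin => x; exact: key.
have Lf : in_L rho f.
  have -> : f = (fun x => (f x - U 0%N x) + U 0%N x) by apply/funext => x; rewrite subrK.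
  apply: in_LD; last exact: Lrho_in_L.
  split; first exact: sc_measurableB.
  by apply: le_lt_trans (rfU 0%N) _; exact: ltry.
exists (Lof rho f) => e e0; have [N hN] := half_pow_small 2 e0.
exists N => n Nn; apply: le_lt_trans hN.
apply: le_trans (_ : 2 * 2^-1 ^+ n <= _); last first.
  by rewrite ler_pM2l //; apply: ler_wiXn2l => //; lra.
rewrite -lee_fin rn_distC rn_Lrho; apply: le_trans (rfU n).
rewrite le_eqVlt; apply/orP; left; apply/eqP; apply: fnorm_ae => //; first exact: Lrho_nneg.
apply: filterS2 (LrhoB_ae (Lof rho f) (u n)) (Lof_ae Lf) => x.
by rewrite /eabs => -> ->.
Unshelve. all: end_near. Qed.

End completeness_of_Lrho.

(** * Sign averages and scalar integrals *)

Section sign_averages.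
Context {R : realType} {k : scalar_kind}.
Local Notation K := (scalar_field R k).

Lemma sum_signs (I : finType) (i j : I) :
  \sum_(e : {ffun I -> bool}) (-1) ^+ e i * (-1) ^+ e j = (2 ^ #|I|)%:R *+ (i == j) :> R.
Proof.
have [<-|ij] := eqVneq i j.
  under eq_bigr do rewrite -expr2 sqrr_sign.
  by rewrite sumr_const card_ffun card_bool mulr1n.
(* Changing the sign of index [i] reverses the sign of the sum. *)
pose flip (e : {ffun I -> bool}) := [ffun l => if l == i then ~~ e l else e l].
have flipK : involutive flip.
  by move=> e; apply/ffunP => l; rewrite !ffunE; case: (l == i) => //; rewrite negbK.
set S := \sum_(e : _) _; suff : S = - S by rewrite mulr0n; lra.
rewrite {1}/S (reindex_inj (can_inj flipK)) /= -sumrN; apply: eq_bigr => e _.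
by rewrite !ffunE eqxx [j == i]eq_sym (negbTE ij) signrN mulNr.
Qed.

(** The signs are orthonormal for the uniform measure. *)
Lemma sum_signs_sqr N (c : 'I_N -> R) :
  \sum_(e : {ffun 'I_N -> bool}) (\sum_(i < N) (-1) ^+ e i * c i) ^+ 2 =
  (2 ^ N)%:R * \sum_(i < N) c i ^+ 2.
Proof.
have E (e : {ffun 'I_N -> bool}) : (\sum_(i < N) (-1) ^+ e i * c i) ^+ 2 =
    \sum_(i < N) \sum_(j < N) ((-1) ^+ e i * (-1) ^+ e j) * (c i * c j).
  rewrite expr2 mulr_suml; apply: eq_bigr => i _; rewrite mulr_sumr.
  by apply: eq_bigr => j _; rewrite mulrACA.
under eq_bigr do rewrite E.
rewrite exchange_big /= mulr_sumr; apply: eq_bigr => i _.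
rewrite exchange_big /= (bigD1 i) //= [X in _ + X]big1 ?addr0 => [|j ji].
  by rewrite -mulr_suml sum_signs eqxx mulr1n card_ord expr2.
by rewrite -mulr_suml sum_signs eq_sym (negbTE ji) mulr0n mul0r.
Qed.

Lemma sum_signs_modulus_sqr N (c : 'I_N -> K) :
  \sum_(e : {ffun 'I_N -> bool}) modulus (\sum_(i < N) (-1) ^+ e i * c i) ^+ 2 =
  (2 ^ N)%:R * \sum_(i < N) modulus (c i) ^+ 2.
Proof.
under eq_bigr do rewrite modulus_sqr sc_re_sum sc_im_sum.
rewrite big_split /=.
under eq_bigr do under eq_bigr do rewrite sc_re_sign.
under [X in _ + X]eq_bigr do under eq_bigr do rewrite sc_im_sign.
rewrite !sum_signs_sqr -mulrDr -big_split /=; congr (_ * _).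
by apply: eq_bigr => i _; rewrite modulus_sqr.
Qed.

(** The average over [e] of [e_i] times the signed sum is [c i]. *)
Lemma modulus_le_sum_signs N (c : 'I_N -> K) i :
  (2 ^ N)%:R * modulus (c i) <=
  \sum_(e : {ffun 'I_N -> bool}) modulus (\sum_(j < N) (-1) ^+ e j * c j).
Proof.
have E : sc_mk k (2 ^ N)%:R 0 * c i =
    \sum_(e : {ffun 'I_N -> bool}) (-1) ^+ e i * \sum_(j < N) (-1) ^+ e j * c j.
  under eq_bigr do rewrite mulr_sumr.
  rewrite exchange_big /= (bigD1 i) //= [X in _ + X]big1 ?addr0 => [|j ji].
    under eq_bigr do rewrite mulrA -expr2 sqrr_sign mul1r.
    rewrite sumr_const card_ffun card_bool card_ord -[RHS]mulr_natl; congr (_ * _).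
    elim: (2 ^ N)%N => [|n ih]; first by rewrite sc_mk0.
    by rewrite -!natr1 sc_mkD ih sc_mk1.
  have -> : \sum_(e : {ffun 'I_N -> bool}) (-1) ^+ e i * ((-1) ^+ e j * c j) =
      sc_mk k (\sum_(e : {ffun 'I_N -> bool}) (-1) ^+ e i * (-1) ^+ e j) 0 * c j.
    rewrite (big_morph (fun r => sc_mk k r 0) (@sc_mkD R k) (@sc_mk0 R k)) mulr_suml.
    apply: eq_bigr => e _; rewrite mulrA sc_mkM.
    by case: (e i); case: (e j); rewrite ?expr1 ?expr0 ?sc_mkN ?sc_mk1.
  by rewrite sum_signs eq_sym (negbTE ji) mulr0n sc_mk0 mul0r.
have := congr1 modulus E; rewrite modulusM modulus_mk ger0_norm // => ->.
apply: le_trans (ler_modulus_sum _ _) _; apply: ler_sum => e _.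
by rewrite modulusM modulus_sign mul1r.
Qed.

End sign_averages.

Section scalar_integrals.
Context {d : measure_display} {T : measurableType d} {R : realType}.
Context {k : scalar_kind}.
Variable mu : {measure set T -> \bar R}.
Local Notation K := (scalar_field R k).
Implicit Types (F G : T -> K).

Definition sc_integrable F : Prop := sc_measurable F /\ (\int[mu]_x eabs F x < +oo)%E.

Lemma sc_measurableM F G : sc_measurable F -> sc_measurable G ->
  sc_measurable (fun x => F x * G x).
Proof.
move=> [fr fi] [gr gi]; split.
  rewrite (_ : _ \o _ = (fun x => (sc_re \o F) x * (sc_re \o G) x)
                     \- (fun x => (sc_im \o F) x * (sc_im \o G) x)).
    by apply: measurable_funB; apply: measurable_funM.
  by apply/funext => x /=; rewrite sc_reM.
rewrite (_ : _ \o _ = (fun x => (sc_re \o F) x * (sc_im \o G) x)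
                     \+ (fun x => (sc_im \o F) x * (sc_re \o G) x)).
  by apply: measurable_funD; apply: measurable_funM.
by apply/funext => x /=; rewrite sc_imM.
Qed.

Lemma sc_measurable_modulus F : sc_measurable F -> measurable_fun setT (fun x => modulus (F x)).
Proof. by move=> /nneg_measurable_eabs[/measurable_EFinP]. Qed.

Lemma measurable_sublevel F (M : R) : sc_measurable F -> measurable [set t | modulus (F t) <= M].
Proof.
move=> mf; rewrite -(setTI [set t | _]) -[[set t | _]]/([set t | modulus (F t) <= cst M t]).
by apply: measurable_fun_le => //; exact: sc_measurable_modulus.
Qed.

Lemma measurable_superlevel F (M : R) : sc_measurable F -> measurable [set t | M < modulus (F t)].
Proof.
move=> mf; have -> : [set t | M < modulus (F t)] = ~` [set t | modulus (F t) <= M].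
  by apply/seteqP; split=> t /=; rewrite ltNge => /negP.
exact/measurableC/measurable_sublevel.
Qed.

Lemma sc_measurable_mk (r : T -> R) : measurable_fun setT r ->
  sc_measurable (fun x => sc_mk k (r x) 0).
Proof.
move=> mr; split.
  by rewrite (_ : _ \o _ = r) //; apply/funext => x /=; rewrite sc_re_mk.
by rewrite (_ : _ \o _ = cst 0) //; apply/funext => x /=; rewrite sc_im_mk.
Qed.

Lemma sc_measurable_sum (I : Type) (s : seq I) (F : I -> T -> K) :
  (forall i, sc_measurable (F i)) -> sc_measurable (fun x => \sum_(i <- s) F i x).
Proof.
move=> mF; elim: s => [|i s ih].
  rewrite (_ : (fun x => _) = fun=> 0); first exact: sc_measurable0.
  by apply/funext => x; rewrite big_nil.
rewrite (_ : (fun x => _) = fun x => F i x + \sum_(j <- s) F j x).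
  exact: sc_measurableD.
by apply/funext => x; rewrite big_cons.
Qed.

Lemma sc_integrable_re F : sc_integrable F -> mu.-integrable setT (EFin \o (sc_re \o F)).
Proof.
move=> [mF Foo]; apply/integrableP; split; first by apply/measurable_EFinP; case: mF.
apply: le_lt_trans Foo; apply: ge0_le_integral => //=.
- by apply/measurable_EFinP; apply: measurableT_comp => //; case: mF.
- by case: (nneg_measurable_eabs mF).
- by move=> x _; rewrite lee_fin abs_re_le.
Qed.

Lemma sc_integrable_im F : sc_integrable F -> mu.-integrable setT (EFin \o (sc_im \o F)).
Proof.
move=> [mF Foo]; apply/integrableP; split; first by apply/measurable_EFinP; case: mF.
apply: le_lt_trans Foo; apply: ge0_le_integral => //=.
- by apply/measurable_EFinP; apply: measurableT_comp => //; case: mF.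
- by case: (nneg_measurable_eabs mF).
- by move=> x _; rewrite lee_fin abs_im_le.
Qed.

Lemma sc_integral_re F : sc_re (sc_integral mu F) = \int[mu]_x sc_re (F x).
Proof. by rewrite /sc_integral; case: (k) F. Qed.

Lemma sc_integral_im F : sc_im (sc_integral mu F) = \int[mu]_x sc_im (F x).
Proof.
rewrite /sc_integral; case: (k) F => //= F.
by rewrite /Rintegral integral0.
Qed.

Lemma sc_integrable_le F (g : T -> \bar R) : sc_measurable F -> nneg_measurable g ->
  (forall x, (eabs F x <= g x)%E) -> (\int[mu]_x g x < +oo)%E -> sc_integrable F.
Proof.
move=> mF [mg g0] Fg goo; have [nF F0] := nneg_measurable_eabs mF.
split=> //; apply: le_lt_trans goo; apply: ge0_le_integral => //.
Qed.

Lemma sc_integrableD F G : sc_integrable F -> sc_integrable G ->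
  sc_integrable (fun x => F x + G x).
Proof.
move=> [mF Foo] [mG Goo]; have [nF F0] := nneg_measurable_eabs mF.
have [nG G0] := nneg_measurable_eabs mG.
apply: (@sc_integrable_le _ (fun x => eabs F x + eabs G x)%E).
- exact: sc_measurableD.
- by split=> [|x]; [exact: emeasurable_funD|exact: adde_ge0].
- by move=> x; rewrite /eabs -EFinD lee_fin modulusD.
- by rewrite ge0_integralD //; exact: lte_add_pinfty.
Qed.

Lemma sc_integrableZ a F : sc_integrable F -> sc_integrable (fun x => a * F x).
Proof.
move=> [mF Foo]; have [nF F0] := nneg_measurable_eabs mF.
apply: (@sc_integrable_le _ (fun x => (modulus a)%:E * eabs F x)%E).
- exact: sc_measurableZ.
- by apply: nneg_measurableZ => //; exact: modulus_ge0.
- by move=> x; rewrite /eabs -EFinM lee_fin modulusM.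
- rewrite ge0_integralZl_EFin ?modulus_ge0 //.
  by apply: lte_mul_pinfty; rewrite ?lee_fin ?modulus_ge0.
Qed.

Lemma sc_integralD F G : sc_integrable F -> sc_integrable G ->
  sc_integral mu (fun x => F x + G x) = sc_integral mu F + sc_integral mu G.
Proof.
move=> iF iG; apply: sc_eqP.
  rewrite sc_reD !sc_integral_re -RintegralD //; try exact: sc_integrable_re.
  by apply: eq_Rintegral => x _; rewrite sc_reD.
rewrite sc_imD !sc_integral_im -RintegralD //; try exact: sc_integrable_im.
by apply: eq_Rintegral => x _; rewrite sc_imD.
Qed.

Lemma sc_integralZ a F : sc_integrable F ->
  sc_integral mu (fun x => a * F x) = a * sc_integral mu F.
Proof.
move=> iF; have [ir ii] := (sc_integrable_re iF, sc_integrable_im iF).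
have iZ (r : R) (h : T -> R) : mu.-integrable setT (EFin \o h) ->
    mu.-integrable setT (EFin \o (fun x => r * h x)).
  by move=> ih; rewrite (_ : _ \o _ = (fun x => r%:E * (EFin \o h) x)%E) //; exact: integrableZl.
apply: sc_eqP.
  rewrite sc_reM !sc_integral_re sc_integral_im -!RintegralZl // -RintegralB //; try exact: iZ.
  by apply: eq_Rintegral => x _; rewrite sc_reM.
rewrite sc_imM sc_integral_re !sc_integral_im -!RintegralZl // -RintegralD //; try exact: iZ.
by apply: eq_Rintegral => x _; rewrite sc_imM.
Qed.

Lemma sc_integral0 : sc_integral mu (fun=> 0 : K) = 0.
Proof.
apply: sc_eqP; rewrite ?sc_integral_re ?sc_integral_im ?sc_re0 ?sc_im0;
  by rewrite /Rintegral integral0.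
Qed.

Lemma sc_integrable0 : sc_integrable (fun=> 0).
Proof.
split; first exact: sc_measurable0.
by rewrite (eq_integral (cst 0%E)) ?integral0 // => x _; rewrite /eabs modulus0.
Qed.

Lemma sc_integrable_sum (I : Type) (s : seq I) (F : I -> T -> K) :
  (forall i, sc_integrable (F i)) -> sc_integrable (fun x => \sum_(i <- s) F i x).
Proof.
move=> iF; elim: s => [|i s ih].
  rewrite (_ : (fun x => _) = fun=> 0); first exact: sc_integrable0.
  by apply/funext => x; rewrite big_nil.
rewrite (_ : (fun x => _) = fun x => F i x + \sum_(j <- s) F j x).
  exact: sc_integrableD.
by apply/funext => x; rewrite big_cons.
Qed.

Lemma sc_integral_sum (I : Type) (s : seq I) (F : I -> T -> K) :
  (forall i, sc_integrable (F i)) ->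
  sc_integral mu (fun x => \sum_(i <- s) F i x) = \sum_(i <- s) sc_integral mu (F i).
Proof.
move=> iF; elim: s => [|i s ih].
  rewrite big_nil (_ : (fun x => _) = fun=> 0); first exact: sc_integral0.
  by apply/funext => x; rewrite big_nil.
rewrite big_cons -ih -sc_integralD //; last exact: sc_integrable_sum.
by congr sc_integral; apply/funext => x; rewrite big_cons.
Qed.

Lemma sc_integral_ae F G : sc_measurable F -> sc_measurable G ->
  {ae mu, forall x, F x = G x} -> sc_integral mu F = sc_integral mu G.
Proof.
move=> [fr fi] [gr gi] FG; apply: sc_eqP.
  rewrite !sc_integral_re /Rintegral; congr fine; apply: ae_eq_integral => //.
  - exact/measurable_EFinP.
  - exact/measurable_EFinP.
  - by apply: filterS FG => x ->.
rewrite !sc_integral_im /Rintegral; congr fine; apply: ae_eq_integral => //.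
- exact/measurable_EFinP.
- exact/measurable_EFinP.
- by apply: filterS FG => x ->.
Qed.

Lemma Rintegral_abs_le F (h : T -> R) : sc_integrable F ->
  measurable_fun setT h -> (forall x, `|h x| <= modulus (F x)) ->
  `|\int[mu]_x h x| <= fine (\int[mu]_x eabs F x).
Proof.
move=> [mF Foo] mh hF; have [nF F0] := nneg_measurable_eabs mF.
have ih : mu.-integrable setT (EFin \o h).
  apply/integrableP; split; first exact/measurable_EFinP.
  apply: le_lt_trans Foo; apply: ge0_le_integral => //=.
  - by apply/measurable_EFinP; apply: measurableT_comp.
  - by move=> x _; rewrite lee_fin.
apply: le_trans (le_normr_Rintegral measurableT ih) _.
rewrite /Rintegral; apply: fine_le.
- rewrite ge0_fin_numE; last by apply: integral_ge0 => x _; rewrite lee_fin.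
  by have /integrableP[_] := ih.
- by rewrite ge0_fin_numE // integral_ge0.
apply: ge0_le_integral => //=.
- by apply/measurable_EFinP; apply: measurableT_comp.
- by move=> x _; rewrite lee_fin.
Qed.

Lemma sc_integral_re_le F : sc_integrable F ->
  sc_re (sc_integral mu F) <= fine (\int[mu]_x eabs F x).
Proof.
move=> iF; rewrite sc_integral_re; apply: le_trans (ler_norm _) _.
by apply: Rintegral_abs_le => //; [case: iF => -[]|move=> x; exact: abs_re_le].
Qed.

(** Real and imaginary parts are estimated separately, whence the factor [2]. *)
Lemma modulus_sc_integral_le F : sc_integrable F ->
  modulus (sc_integral mu F) <= 2 * fine (\int[mu]_x eabs F x).
Proof.
move=> iF; apply: le_trans (modulus_le _) _; rewrite sc_integral_re sc_integral_im mulr_natl mulr2n.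
by apply: lerD; apply: Rintegral_abs_le => //;
  [case: iF => -[]|move=> x; exact: abs_re_le|case: iF => -[]|move=> x; exact: abs_im_le].
Qed.

(** The function [u] is [|v|] times the conjugate phase of [y], so that testing against
    [u] replaces an integral of [y] by one of its modulus. *)
Lemma phase_exists (y v : T -> K) : sc_measurable y -> sc_measurable v ->
  exists u : T -> K, [/\ sc_measurable u, forall x, modulus (u x) <= modulus (v x) &
    forall x, y x * u x = sc_mk k (modulus (y x) * modulus (v x)) 0].
Proof.
move=> my mv; have [yr yi] := my.
pose r x := modulus (v x) * (modulus (y x) `^ (-1)).
have mr : measurable_fun setT r.
  apply: measurable_funM; first exact: sc_measurable_modulus.
  apply: (@measurableT_comp _ _ _ _ _ _ (fun a : R => a `^ (-1)) _ (fun x => modulus (y x))).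
    exact: measurable_powR.
  exact: sc_measurable_modulus.
pose cj (z : K) := sc_mk k (sc_re z) (- sc_im z).
have cjr z : sc_re (cj z) = sc_re z by rewrite /cj; case: (k) z.
have cji z : sc_im (cj z) = - sc_im z by rewrite /cj; case: (k) z => //= z; rewrite oppr0.
have mcj : sc_measurable (cj \o y).
  split; first by rewrite (_ : _ \o _ = sc_re \o y) //; apply/funext => x /=; rewrite cjr.
  rewrite (_ : _ \o _ = \- (sc_im \o y)); last by apply/funext => x /=; rewrite cji.
  exact: measurableT_comp.
have mm z : modulus (cj z) = modulus z by rewrite !modulusE cjr cji sqrrN.
exists (fun x => sc_mk k (r x) 0 * cj (y x)); split.
- by apply: sc_measurableM => //; exact: sc_measurable_mk.
- move=> x; rewrite modulusM modulus_mk mm /r powR_inv1 ?modulus_ge0 //.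
  rewrite ger0_norm ?mulr_ge0 ?invr_ge0 ?modulus_ge0 //.
  have [->|m0] := eqVneq (modulus (y x)) 0; first by rewrite mulr0 modulus_ge0.
  by rewrite divfK.
- move=> x; have e : y x * cj (y x) = sc_mk k (modulus (y x) ^+ 2) 0.
    apply: sc_eqP; rewrite ?sc_reM ?sc_imM cjr cji ?sc_re_mk ?sc_im_mk ?modulus_sqr; ring.
  rewrite mulrCA e -sc_mkM; congr sc_mk; rewrite /r powR_inv1 ?modulus_ge0 //.
  have [->|m0] := eqVneq (modulus (y x)) 0; first by rewrite expr0n /= mulr0 mul0r.
  by field.
Qed.

End scalar_integrals.

(** * The associate norm *)

Section associate_norm.
Context {d : measure_display} {T : measurableType d} {R : realType}.
Context {mu : {measure set T -> \bar R}}.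
Variable rho : function_norm mu.
Local Notation rhos := (assoc_fnorm mu rho).
Local Open Scope ereal_scope.
Implicit Types (f g : T -> \bar R).

Lemma nneg_measurableM f g : nneg_measurable f -> nneg_measurable g ->
  nneg_measurable (fun x => f x * g x).
Proof.
by move=> [mf f0] [mg g0]; split=> [|x]; [exact: emeasurable_funM|exact: mule_ge0].
Qed.

Lemma nneg_integral_ge0 f : nneg_measurable f -> 0 <= \int[mu]_x f x.
Proof. by case=> _ f0; exact: integral_ge0. Qed.

Lemma nneg_integral_le f g : nneg_measurable f -> nneg_measurable g ->
  {ae mu, forall x, f x <= g x} -> \int[mu]_x f x <= \int[mu]_x g x.
Proof.
move=> [mf f0] [mg g0] fg; apply: ae_ge0_le_integral => //.
by apply: filterS fg.
Qed.

Lemma assoc_ub f g : nneg_measurable g -> rho g <= 1 ->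
  \int[mu]_x (f x * g x) <= rhos f.
Proof. by move=> ng g1; apply: ereal_sup_ubound; exists g. Qed.

Lemma assoc_lub f (c : \bar R) :
  (forall g, nneg_measurable g -> rho g <= 1 -> \int[mu]_x (f x * g x) <= c) ->
  rhos f <= c.
Proof. by move=> h; apply: ge_ereal_sup => _ [g [ng g1] <-]; exact: h. Qed.

Lemma assoc_ge0 f : 0 <= rhos f.
Proof.
have := @assoc_ub f (fun=> 0) nneg_measurable0.
rewrite fnorm0 => /(_ lee01); apply: le_trans.
by rewrite (eq_integral (cst 0)) ?integral0 // => x _; rewrite mule0.
Qed.

(** By homogeneity from the definition of the associate norm; when [rho g = 0] the
    integrand vanishes almost everywhere. *)
Lemma assoc_holder f g : nneg_measurable f -> nneg_measurable g -> rho g < +oo ->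
  \int[mu]_x (f x * g x) <= rhos f * rho g.
Proof.
move=> nf ng goo; have g0 := fnorm_ge0 rho ng.
have gfin : rho g \is a fin_num by rewrite ge0_fin_numE.
have [r0|r0] := eqVneq (rho g) 0.
  rewrite r0 mule0; have g00 := (fnorm_eq0 rho ng).1 r0.
  have n0 := @nneg_measurable0 _ T R.
  have -> : \int[mu]_x (f x * g x) = \int[mu]_x cst 0 x; last by rewrite integral0.
  apply: ae_eq_integral => //; first by case: (nneg_measurableM nf ng).
  by apply: filterS g00 => x -> _; rewrite mule0.
have rp : (0 < fine (rho g))%R by rewrite fine_gt0 // lt_def r0 g0 goo.
set t := (fine (rho g))^-1%R; have t0 : (0 <= t)%R by rewrite invr_ge0 ltW.
have := @assoc_ub f (fun x => t%:E * g x) (nneg_measurableZ t0 ng).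
rewrite fnormZ // -{1}(fineK gfin) -EFinM mulVf ?gt_eqF // => /(_ (lexx _)).
have -> : \int[mu]_x (f x * (t%:E * g x)) = t%:E * \int[mu]_x (f x * g x).
  rewrite -ge0_integralZl_EFin //.
  - by apply: eq_integral => x _; rewrite muleCA.
  - by move=> x _; have [_] := nneg_measurableM nf ng.
  - by case: (nneg_measurableM nf ng).
move=> h; rewrite -[leLHS]mul1e -[1%E]/(1%:E) -(@divff _ (fine (rho g))) ?gt_eqF //.
rewrite EFinM -muleA muleC fineK //.
by apply: lee_wpmul2r.
Qed.

Lemma assoc_le f g : nneg_measurable f -> nneg_measurable g ->
  {ae mu, forall x, f x <= g x} -> rhos f <= rhos g.
Proof.
move=> nf ng fg; apply: assoc_lub => h nh h1; apply: le_trans (assoc_ub g nh h1).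
apply: nneg_integral_le; try exact: nneg_measurableM.
by apply: filterS fg => x fgx; apply: lee_wpmul2r => //; case: nh.
Qed.

Lemma assocD f g : nneg_measurable f -> nneg_measurable g ->
  rhos (fun x => f x + g x) <= rhos f + rhos g.
Proof.
move=> nf ng; apply: assoc_lub => h nh h1.
have [m1 p1] := nneg_measurableM nf nh; have [m2 p2] := nneg_measurableM ng nh.
rewrite (eq_integral (fun x => f x * h x + g x * h x)); last first.
  by move=> x _; rewrite ge0_muleDl //; [case: nf|case: ng].
by rewrite ge0_integralD //; apply: leeD; exact: assoc_ub.
Qed.

Lemma assocZ (t : R) f : (0 <= t)%R -> nneg_measurable f ->
  rhos (fun x => t%:E * f x) <= t%:E * rhos f.
Proof.
move=> t0 nf; apply: assoc_lub => h nh h1.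
have [m1 p1] := nneg_measurableM nf nh.
rewrite (eq_integral (fun x => t%:E * (f x * h x))); last by move=> x _; rewrite muleA.
by rewrite ge0_integralZl_EFin //; apply: lee_wpmul2l; [rewrite lee_fin|exact: assoc_ub].
Qed.

End associate_norm.

Section pairings.
Context {d : measure_display} {T : measurableType d} {R : realType}.
Context {k : scalar_kind} {mu : {measure set T -> \bar R}} {rho : function_norm mu}.
Local Notation K := (scalar_field R k).
Local Notation rhos := (assoc_fnorm mu rho).
Implicit Types (u : Lrho k rho).

Lemma eabsM (f g : T -> K) x : eabs (fun x => f x * g x) x = (eabs f x * eabs g x)%E.
Proof. by rewrite /eabs modulusM EFinM. Qed.

Lemma pairing_integral_le (y u : T -> K) : in_L rhos y -> in_L rho u ->
  (\int[mu]_x (eabs y x * eabs u x) <= rhos (eabs y) * rho (eabs u))%E.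
Proof.
move=> [my yoo] [mv uoo]; apply: assoc_holder => //; exact: nneg_measurable_eabs.
Qed.

Lemma pairing_integrable (y u : T -> K) : in_L rhos y -> in_L rho u ->
  sc_integrable mu (fun x => y x * u x).
Proof.
move=> hy hu; have [my yoo] := hy; have [mv uoo] := hu.
split; first exact: sc_measurableM.
under eq_integral do rewrite eabsM.
apply: le_lt_trans (pairing_integral_le hy hu) _.
have yf : rhos (eabs y) \is a fin_num by rewrite ge0_fin_numE // assoc_ge0.
have uf : rho (eabs u) \is a fin_num.
  by rewrite ge0_fin_numE // fnorm_ge0 //; exact: nneg_measurable_eabs.
by rewrite -(fineK yf) -(fineK uf) -EFinM ltry.
Qed.

Lemma pairing_bound (y : T -> K) u : in_L rhos y ->
  modulus (pairing mu y u) <= 2 * fine (rhos (eabs y)) * rn u.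
Proof.
move=> hy; have hu := Lrho_in_L u; have iyu := pairing_integrable hy hu.
apply: le_trans (modulus_sc_integral_le iyu) _; rewrite -mulrA ler_wpM2l //.
have yf : rhos (eabs y) \is a fin_num by rewrite ge0_fin_numE ?assoc_ge0 //; case: hy.
rewrite -lee_fin EFinM rn_Lrho fineK; last first.
  rewrite ge0_fin_numE; first by case: iyu.
  by apply/nneg_integral_ge0/nneg_measurable_eabs; case: iyu.
by rewrite fineK //; under eq_integral do rewrite eabsM; exact: pairing_integral_le.
Qed.

Lemma pairing_ae (y u v : T -> K) : sc_measurable y -> sc_measurable u -> sc_measurable v ->
  {ae mu, forall x, u x = v x} -> pairing mu y u = pairing mu y v.
Proof.
move=> my mu' mv uv; apply: sc_integral_ae; try exact: sc_measurableM.
by apply: filterS uv => x ->.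
Qed.

Lemma function_functionals_linear (y : nat -> T -> K) : (forall n, in_L rhos (y n)) ->
  linear_functionals (function_functionals (rho := rho) y).
Proof.
move=> hy; have m (u : Lrho k rho) : sc_measurable (Lrho_fun u) by case: (Lrho_in_L u).
split=> [n u v|n a u]; have [my _] := hy n; rewrite /function_functionals.
  rewrite (@pairing_ae _ _ (fun x => Lrho_fun u x + Lrho_fun v x)) //; last exact: LrhoD_ae.
    rewrite /pairing -sc_integralD; try exact: (pairing_integrable (hy n) (Lrho_in_L _)).
    by congr sc_integral; apply/funext => x; rewrite mulrDr.
  exact: sc_measurableD.
rewrite (@pairing_ae _ _ (fun x => a * Lrho_fun u x)) //; last exact: LrhoZ_ae.
  rewrite /pairing -sc_integralZ; last exact: (pairing_integrable (hy n) (Lrho_in_L _)).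
  by congr sc_integral; apply/funext => x; rewrite mulrCA.
exact: sc_measurableZ.
Qed.

End pairings.

Section disjoint_domination.
Context {R : realType} {k : scalar_kind}.
Local Notation K := (scalar_field R k).

(** This is how disjointness is used: the modulus of a sum with at most one nonzero
    term is that of this term, and a term is at most the average of the signed sums. *)
Lemma disjoint_sum_le_signs N (c : R) (p q : 'I_N -> K) : 0 <= c ->
  (forall i j, i != j -> p i = 0 \/ p j = 0) ->
  (forall i, modulus (p i) <= c * modulus (q i)) ->
  modulus (\sum_(i < N) p i) <=
  \sum_(e : {ffun 'I_N -> bool}) c / (2 ^ N)%:R * modulus (\sum_(j < N) (-1) ^+ e j * q j).
Proof.
move=> c0 dp pq; rewrite -mulr_sumr.
have S0 : 0 <= \sum_(e : {ffun 'I_N -> bool}) modulus (\sum_(j < N) (-1) ^+ e j * q j).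
  by apply: sumr_ge0 => e _; exact: modulus_ge0.
have p2 : 0 < (2 ^ N)%:R :> R by rewrite ltr0n expn_gt0.
have [[i pi]|no] := pselect (exists i, p i != 0); last first.
  rewrite big1 ?modulus0; first by rewrite mulr_ge0 // divr_ge0 // ltW.
  by move=> i _; apply/eqP/negPn/negP => pi; apply: no; exists i.
rewrite (bigD1 i) //= big1 ?addr0; last first.
  by move=> j ji; have [|/eqP] := dp _ _ ji; [|rewrite (negbTE pi)].
apply: le_trans (pq i) _; rewrite -mulrA ler_wpM2l // mulrC ler_pdivlMr // mulrC.
exact: modulus_le_sum_signs.
Qed.

End disjoint_domination.

(** * Disjoint blocks *)

Section blocks.
Context {d : measure_display} {T : measurableType d} {R : realType}.
Context {k : scalar_kind} {mu : {measure set T -> \bar R}} {rho : function_norm mu}.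
Local Notation K := (scalar_field R k).
Local Notation rhos := (assoc_fnorm mu rho).
Variables (x : nat -> Lrho k rho) (y : nat -> T -> K) (C : R).
Hypothesis C0 : 0 <= C.
Hypothesis Ly : forall n, in_L rhos (y n).
Hypothesis bxy : biorthogonal (function_functionals (rho := rho) y) x.
Hypothesis sxy : sign_bounded (function_functionals (rho := rho) y) x C.

Lemma rn_Lof_le (f g : T -> K) : in_L rho f -> in_L rho g ->
  (forall t, modulus (f t) <= modulus (g t)) -> rn (Lof rho f) <= rn (Lof rho g).
Proof.
move=> Lf Lg fg; rewrite -lee_fin !rn_Lof //; apply: fnorm_le.
- exact: eabs_nneg Lf.
- exact: eabs_nneg Lg.
- by move=> t; rewrite lee_fin.
Qed.

Lemma pairing_Lof (g f : T -> K) : sc_measurable g -> in_L rho f ->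
  pairing mu g (Lof rho f) = pairing mu g f.
Proof.
move=> mg Lf; apply: pairing_ae => //; last exact: Lof_ae.
- by case: (Lrho_in_L (Lof rho f)).
- by case: Lf.
Qed.

Definition signed_sum N (e : 'I_N -> bool) (b : nat -> K) (z : nat -> T -> K) : T -> K :=
  fun t => \sum_(i < N) (-1) ^+ e i * (b i * z i t).

Lemma signed_sum_measurable N e b (z : nat -> T -> K) :
  (forall n, sc_measurable (z n)) -> sc_measurable (@signed_sum N e b z).
Proof. by move=> mz; apply: sc_measurable_sum => i; do 2 apply: sc_measurableZ. Qed.

(** The coefficients of a norming functional, with arbitrary signs, give functions
    [sum b_i y_i] that are bounded in the associate norm: the phase of such a function
    turns its modulus into the functional [sum b_i y_i], whose value is that of the
    norming functional at a signed partial sum of the expansion. *)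
Lemma dual_bound N (b : nat -> K) (e : 'I_N -> bool) (v : T -> K) :
  (forall w : nat -> K, sc_re (\sum_(i < N) w i * b i) <= rn (\sum_(i < N) w i *: x i)) ->
  in_L rho v ->
  (\int[mu]_t (eabs (signed_sum e b y) t * eabs v t) <=
    C%:E * rho (eabs v))%E.
Proof.
move=> hb Lv; set g := signed_sum e b y.
have mg : sc_measurable g by apply: signed_sum_measurable => i; case: (Ly i).
have gE (u : T -> K) : (fun t => g t * u t) =
    (fun t => \sum_(i < N) (-1) ^+ e i * b i * (y i t * u t)).
  apply/funext => t; rewrite /g /signed_sum mulr_suml; apply: eq_bigr => i _.
  by rewrite !mulrA.
have [u [mU uv gu]] := phase_exists mg Lv.1.
have Lu : in_L rho u.
  apply: (in_L_le mU (eabs_nneg Lv) _ Lv.2) => t.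
  by rewrite lee_fin.
pose f := function_functionals (rho := rho) y.
have E : sc_integral mu (fun t => g t * u t) = \sum_(i < N) (-1) ^+ e i * f i (Lof rho u) * b i.
  rewrite gE.
  rewrite sc_integral_sum; last first.
    by move=> i; apply/sc_integrableZ/pairing_integrable.
  apply: eq_bigr => i _; rewrite sc_integralZ; last exact: pairing_integrable.
  rewrite -/(pairing mu (y i) u) -pairing_Lof //; last by case: (Ly i).
  by rewrite mulrAC.
have igu : sc_integrable mu (fun t => g t * u t).
  rewrite gE.
  by apply: sc_integrable_sum => i; apply/sc_integrableZ/pairing_integrable.
have I1 : (\int[mu]_t (eabs g t * eabs v t))%E = (\int[mu]_t (sc_re (g t * u t)%R)%:E)%E.
  by apply: eq_integral => t _; rewrite gu sc_re_mk EFinM.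
rewrite I1 -[leLHS]fineK; last exact/integrable_fin_num/sc_integrable_re.
rewrite -[fine _]/(\int[mu]_t (sc_re (g t * u t))) -sc_integral_re E.
rewrite -rn_Lof // -EFinM lee_fin.
pose e' i := if insub i is Some j then e j else false.
have h1 := hb (fun i => (-1) ^+ e' i * f i (Lof rho u)).
have eE (i : 'I_N) : e' i = e i by rewrite /e' valK.
under eq_bigr do rewrite -eE.
apply: le_trans h1 _.
under eq_bigr do rewrite -scalerA eE.
by apply: le_trans (sign_bounded_ord sxy _ _) _; rewrite ler_wpM2l //; exact: rn_Lof_le.
Qed.

Variables (B : nat -> set T) (phi psi : nat -> T -> K).
Hypothesis dB : forall i j t, i != j -> B i t -> B j t -> False.
Hypothesis mphi : forall n, sc_measurable (phi n).
Hypothesis mpsi : forall n, sc_measurable (psi n).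
Hypothesis phi0 : forall n t, ~ B n t -> phi n t = 0.
Hypothesis psi0 : forall n t, ~ B n t -> psi n t = 0.
Hypothesis phi_le : forall n t, modulus (phi n t) <= 2 * modulus (Lrho_fun (x n) t).
Hypothesis psi_le : forall n t, modulus (psi n t) <= modulus (y n t).
Hypothesis pair1 : forall n, pairing mu (psi n) (phi n) = 1.

Lemma block_in_L n : in_L rho (phi n).
Proof.
have Lx := Lrho_in_L (sc_mk k 2 0 *: x n).
have Lx' : in_L rho (fun t => sc_mk k 2 0 * Lrho_fun (x n) t).
  split; first by apply: sc_measurableZ; case: (Lrho_in_L (x n)).
  rewrite fnorm_eabsZ; last exact: Lrho_in_L.
  by rewrite -rn_Lrho -EFinM ltry.
apply: (in_L_le (mphi n) (eabs_nneg Lx') _ Lx'.2) => t.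
by rewrite lee_fin modulusM modulus_mk ger0_norm.
Qed.

Lemma block_in_L_assoc n : in_L rhos (psi n).
Proof.
split=> //; apply: le_lt_trans (Ly n).2; apply: assoc_le.
- exact: nneg_measurable_eabs.
- by apply: nneg_measurable_eabs; case: (Ly n).
- by apply: nearW => t; rewrite lee_fin.
Qed.

Local Notation Phi := (fun n => Lof rho (phi n)).
Local Notation fpsi := (function_functionals (rho := rho) psi).

Lemma disjoint_zero (p q : nat -> T -> K) : (forall n t, ~ B n t -> p n t = 0) ->
  (forall n t, ~ B n t -> q n t = 0) ->
  forall i j t, i != j -> p i t = 0 \/ q j t = 0.
Proof.
move=> p0 q0 i j t ij; have [Bi|nBi] := pselect (B i t); last by left; exact: p0.
by right; apply: q0 => Bj; exact: dB ij Bi Bj.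
Qed.

Lemma block_linear : linear_functionals fpsi.
Proof. exact: function_functionals_linear block_in_L_assoc. Qed.

Lemma block_biorthogonal : biorthogonal fpsi Phi.
Proof.
move=> n m; rewrite /function_functionals pairing_Lof //; last exact: block_in_L.
have [->|nm] := eqVneq n m; first exact: pair1.
rewrite /pairing (_ : (fun t => _) = fun=> 0); first exact: sc_integral0.
apply/funext => t; have [->|->] := disjoint_zero psi0 phi0 t nm; first by rewrite mul0r.
by rewrite mulr0.
Qed.

(** At each point at most one block is nonzero, so that a combination of the blocks is
    at most twice the average of the moduli of the signed combinations of the [x n],
    whose norms are bounded by [C] times that of the unsigned one. *)
Lemma block_dominated : finite_dominated x Phi (2 * C).
Proof.
move=> N a; set M := rn (\sum_(i < N) a i *: x i).
pose X n := Lrho_fun (x n).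
have mX n : sc_measurable (X n) by case: (Lrho_in_L (x n)).
have hM (e : {ffun 'I_N -> bool}) : (rho (eabs (signed_sum e a X)) <= (C * M)%:E)%E.
  have h := signed_finite_sum a e (function_functionals_linear Ly) bxy sxy.
  have aeS := Lrho_sum_ae (index_enum 'I_N) (fun i => (-1) ^+ e i * a i) (fun i : 'I_N => x i).
  have -> : rho (eabs (signed_sum e a X)) =
      rho (eabs (Lrho_fun (\sum_(i < N) ((-1) ^+ e i * a i) *: x i))).
    apply: fnorm_ae; [exact/nneg_measurable_eabs/signed_sum_measurable|exact: Lrho_nneg|].
    apply: filterS aeS => t; rewrite /eabs => ->; congr (modulus _)%:E.
    by apply: eq_bigr => i _; rewrite mulrA.
  rewrite -rn_Lrho lee_fin; apply: le_trans h.
  by rewrite le_eqVlt; apply/orP; left; apply/eqP; congr rn; apply: eq_bigr => i _; rewrite scalerA.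
pose p t := \sum_(i < N) a i * phi i t.
have mp : sc_measurable p by apply: sc_measurable_sum => i; exact: sc_measurableZ.
rewrite -lee_fin rn_Lrho.
have -> : rho (eabs (Lrho_fun (\sum_(i < N) a i *: Phi i))) = rho (eabs p).
  apply: fnorm_ae; [exact: Lrho_nneg|exact: nneg_measurable_eabs|].
  have aeP : {ae mu, forall t, forall n, Lrho_fun (Phi n) t = phi n t}.
    by apply/ae_foralln => n; exact/Lof_ae/block_in_L.
  apply: filterS2 (Lrho_sum_ae (index_enum 'I_N) (fun i => a i) (fun i : 'I_N => Phi i)) aeP.
  by move=> t; rewrite /eabs => -> ht; congr (modulus _)%:E; apply: eq_bigr => i _; rewrite ht.
pose c := 2 / (2 ^ N)%:R : R.
have c0 : 0 <= c by rewrite divr_ge0.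
have nS (e : {ffun 'I_N -> bool}) : nneg_measurable (fun t => c%:E * eabs (signed_sum e a X) t)%E.
  by apply: nneg_measurableZ => //; exact/nneg_measurable_eabs/signed_sum_measurable.
apply: (@le_trans _ _ (rho (fun t => \sum_(e : {ffun 'I_N -> bool}) c%:E * eabs (signed_sum e a X) t)%E)).
  apply: fnorm_le; [exact: nneg_measurable_eabs|exact: nneg_measurable_sum|move=> t].
  rewrite /eabs; under eq_bigr do rewrite -EFinM.
  rewrite sumEFin lee_fin; apply: disjoint_sum_le_signs => // [i j ij|i].
    by have [->|->] := disjoint_zero phi0 phi0 t ij; rewrite mulr0; [left|right].
  by rewrite !modulusM mulrCA ler_wpM2l ?modulus_ge0.
apply: le_trans (fnorm_sum _ _ nS) _.
apply: (@le_trans _ _ (\sum_(e : {ffun 'I_N -> bool}) (c * (C * M))%:E)%E).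
  apply: lee_sum => e _; rewrite fnormZ //; last exact/nneg_measurable_eabs/signed_sum_measurable.
  by rewrite [leRHS]EFinM; apply: lee_wpmul2l; rewrite ?lee_fin.
rewrite sumEFin lee_fin sumr_const card_ffun card_bool card_ord -[leLHS]mulr_natl /c.
have p0 : (2 ^ N)%:R != 0 :> R by rewrite pnatr_eq0 expn_eq0.
by rewrite le_eqVlt; apply/orP; left; apply/eqP; field.
Qed.

(** The same domination by averages for the disjoint functionals [psi n]: the averaged
    functions are those of [dual_bound]. *)
Lemma block_functional_bound N (b th : nat -> K) (u : Lrho k rho) :
  (forall w : nat -> K, sc_re (\sum_(i < N) w i * b i) <= rn (\sum_(i < N) w i *: x i)) ->
  (forall i, modulus (th i) <= 1) ->
  sc_re (\sum_(i < N) th i * fpsi i u * b i) <= C * rn u.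
Proof.
move=> hb hth; have Lu := Lrho_in_L u.
pose p t := \sum_(i < N) (th i * b i) * psi i t.
have E : sc_integral mu (fun t => p t * Lrho_fun u t) = \sum_(i < N) th i * fpsi i u * b i.
  rewrite (_ : (fun t => _) = (fun t => \sum_(i < N) (th i * b i) * (psi i t * Lrho_fun u t))).
    rewrite sc_integral_sum; last first.
      by move=> i; exact/sc_integrableZ/(pairing_integrable (block_in_L_assoc i) Lu).
    apply: eq_bigr => i _; rewrite sc_integralZ; first by rewrite mulrAC.
    exact: pairing_integrable (block_in_L_assoc i) Lu.
  by apply/funext => t; rewrite /p mulr_suml; apply: eq_bigr => i _; rewrite mulrA.
have ipu : sc_integrable mu (fun t => p t * Lrho_fun u t).
  rewrite (_ : (fun t => _) = (fun t => \sum_(i < N) (th i * b i) * (psi i t * Lrho_fun u t))).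
    apply: sc_integrable_sum => i; exact/sc_integrableZ/(pairing_integrable (block_in_L_assoc i) Lu).
  by apply/funext => t; rewrite /p mulr_suml; apply: eq_bigr => i _; rewrite mulrA.
rewrite -E; apply: le_trans (sc_integral_re_le ipu) _.
rewrite -lee_fin fineK; last first.
  rewrite ge0_fin_numE; first by case: ipu.
  by apply/nneg_integral_ge0/nneg_measurable_eabs; case: ipu.
under eq_integral do rewrite eabsM.
pose c := 1 / (2 ^ N)%:R : R.
have c0 : 0 <= c by rewrite divr_ge0.
have my n : sc_measurable (y n) by case: (Ly n).
have ng (e : {ffun 'I_N -> bool}) :
    nneg_measurable (fun t => eabs (signed_sum e b y) t * eabs (Lrho_fun u) t)%E.
  apply: nneg_measurableM; last exact: eabs_nneg Lu.
  exact/nneg_measurable_eabs/signed_sum_measurable.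
have ngc (e : {ffun 'I_N -> bool}) :
    nneg_measurable (fun t => c%:E * (eabs (signed_sum e b y) t * eabs (Lrho_fun u) t))%E.
  exact: nneg_measurableZ.
apply: (@le_trans _ _ (\int[mu]_t (\sum_(e : {ffun 'I_N -> bool})
    c%:E * (eabs (signed_sum e b y) t * eabs (Lrho_fun u) t)))%E).
  apply: nneg_integral_le; [|exact: nneg_measurable_sum|apply: nearW => t].
    apply: nneg_measurableM; last exact: eabs_nneg Lu.
    by apply: nneg_measurable_eabs; apply: sc_measurable_sum => i; exact: sc_measurableZ.
  rewrite /eabs; under eq_bigr do rewrite -!EFinM mulrA.
  rewrite sumEFin -EFinM lee_fin -mulr_suml ler_wpM2r ?modulus_ge0 //.
  apply: disjoint_sum_le_signs => // [i j ij|i].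
    by have [->|->] := disjoint_zero psi0 psi0 t ij; rewrite mulr0; [left|right].
  rewrite !modulusM mul1r -mulrA; apply: le_trans (ler_piMl _ (hth i)) _.
    by rewrite mulr_ge0 ?modulus_ge0.
  by rewrite ler_wpM2l ?modulus_ge0.
rewrite ge0_integral_sum //; last 2 first.
- by move=> e; case: (ngc e).
- by move=> e t _; case: (ngc e).
apply: (@le_trans _ _ (\sum_(e : {ffun 'I_N -> bool}) (c * (C * rn u))%:E)%E).
  apply: lee_sum => e _; have [m0 p0] := ng e.
  rewrite ge0_integralZl_EFin // [leRHS]EFinM; apply: lee_wpmul2l; rewrite ?lee_fin //.
  by rewrite EFinM rn_Lrho; exact: dual_bound.
rewrite sumEFin lee_fin sumr_const card_ffun card_bool card_ord -[leLHS]mulr_natl /c.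
have p0 : (2 ^ N)%:R != 0 :> R by rewrite pnatr_eq0 expn_eq0.
by rewrite le_eqVlt; apply/orP; left; apply/eqP; field.
Qed.

(** A norming functional of [sum a_i x_i] has, by [block_functional_bound], a counterpart
    on the blocks with the same values and norm at most [C]. *)
Lemma block_dominates : finite_dominated Phi x C.
Proof.
move=> N a; have [b [hb1 hb2]] := norming_coefs x N a.
rewrite -hb1; have := @block_functional_bound N b (fun=> 1) (\sum_(i < N) a i *: Phi i) hb2.
move=> /(_ (fun=> _)); rewrite modulus1 => /(_ (lexx _)).
congr (sc_re _ <= _); apply: eq_bigr => i _; rewrite mul1r; congr (_ * _).
exact: biorthogonal_coef block_linear block_biorthogonal (ltn_ord i).
Qed.

(** The signed expansion along the blocks is dominated by a combination of the [x n], which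
    is normed by coefficients [b] and estimated through [block_functional_bound]; the
    factors [th i] carry the signs and the selection of indices. *)
Lemma block_sign_bounded : sign_bounded fpsi Phi (2 * C * C).
Proof.
move=> L e u uL; have [N hN] := @sum_uniq_list R k _ uL.
pose th i : K := if i \in L then (-1) ^+ e i else 0.
have hth i : modulus (th i) <= 1.
  by rewrite /th; case: ifP; rewrite ?modulus_sign ?modulus0.
pose a i := th i * fpsi i u.
have -> : \sum_(i <- L) (-1) ^+ e i *: (fpsi i u *: Phi i) = \sum_(i < N) a i *: Phi i.
  transitivity (\sum_(i <- L) ((-1) ^+ e i * fpsi i u) *: Phi i).
    by apply: eq_bigr => i _; rewrite scalerA.
  rewrite (hN _ (fun i => (-1) ^+ e i * fpsi i u)); apply: eq_bigr => i _.
  by rewrite /a /th; case: ifP; rewrite ?mul0r.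
apply: le_trans (block_dominated N a) _; rewrite -[leRHS]mulrA ler_wpM2l ?mulr_ge0 //.
have [b [hb1 hb2]] := norming_coefs x N a.
by rewrite -hb1; exact: block_functional_bound.
Qed.

End blocks.

(** * The inclusion of square integrable functions *)

Section norm2_facts.
Context {d : measure_display} {T : measurableType d} {R : realType}.
Context {k : scalar_kind}.
Variable mu : {measure set T -> \bar R}.
Local Notation K := (scalar_field R k).
Implicit Types (f : T -> K).

Lemma le_sqr_poweR (X : \bar R) (D : R) : (0 <= X)%E -> 0 <= D ->
  (X <= D%:E)%E = (X `^ 2 <= (D ^+ 2)%:E)%E /\ (D%:E <= X)%E = ((D ^+ 2)%:E <= X `^ 2)%E.
Proof.
move=> + D0; case: X => [r| |] //.
  rewrite lee_fin => r0; have -> : (r%:E `^ 2)%E = (r ^+ 2)%:E by rewrite poweR_EFin powR_mulrn.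
  by rewrite !lee_fin !ler_pXn2r ?nnegrE.
move=> _; rewrite poweRyr ?pnatr_eq0 //.
by rewrite !leye_eq !leey.
Qed.

Lemma norm2_sqr f : (norm2 mu (eabs f) `^ 2 = \int[mu]_x (modulus (f x) ^+ 2)%:E)%E.
Proof.
rewrite /norm2 poweR_Lnorm ?pnatr_eq0 //; apply: eq_integral => x _.
by rewrite /eabs /= ger0_norm ?modulus_ge0 // powR_mulrn ?modulus_ge0.
Qed.

Lemma norm2_eabs_ge0 f : (0 <= norm2 mu (eabs f))%E.
Proof. exact: Lnorm_ge0. Qed.

Lemma norm2_leP f (D : R) : 0 <= D ->
  (norm2 mu (eabs f) <= D%:E)%E = (\int[mu]_x (modulus (f x) ^+ 2)%:E <= (D ^+ 2)%:E)%E.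
Proof. by move=> D0; rewrite (le_sqr_poweR (norm2_eabs_ge0 f) D0).1 norm2_sqr. Qed.

Lemma norm2_geP f (D : R) : 0 <= D ->
  (D%:E <= norm2 mu (eabs f))%E = ((D ^+ 2)%:E <= \int[mu]_x (modulus (f x) ^+ 2)%:E)%E.
Proof. by move=> D0; rewrite (le_sqr_poweR (norm2_eabs_ge0 f) D0).2 norm2_sqr. Qed.

(** If the inclusion were unbounded, there would be functions of norm [2^-n] in [L_2] and
    of norm at least [2^n] for [rho]; their sum is in [L_2] but not in [L_rho]. *)
Lemma L2_embedding (rho : function_norm mu) :
  (forall f : T -> K, in_L (norm2 mu) f -> in_L rho f) ->
  exists2 C : R, 0 <= C & forall g : T -> \bar R, nneg_measurable g ->
    (norm2 mu g < +oo)%E -> (rho g <= C%:E * norm2 mu g)%E.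
Proof.
move=> incl; apply: contrapT => no.
have /choice[g hg] : forall n : nat, exists g : T -> \bar R, nneg_measurable g /\
    exists N : R, [/\ 0 < N, norm2 mu g = N%:E & ((4 ^+ n * N)%:E < rho g)%E].
  move=> n; apply: contrapT => no'; apply: no; exists (4 ^+ n); first by rewrite exprn_ge0.
  move=> g ng goo; rewrite leNgt; apply/negP => h; apply: no'; exists g; split=> //.
  have g0 : (0 <= norm2 mu g)%E by exact: Lnorm_ge0.
  have gfin : norm2 mu g \is a fin_num by rewrite ge0_fin_numE.
  exists (fine (norm2 mu g)); split; last first.
  - by rewrite EFinM fineK.
  - by rewrite fineK.
  rewrite fine_gt0 // goo andbT lt_def g0 andbT; apply/eqP => z.
  have ae0 : {ae mu, forall x, g x = 0%E} by apply/(fnorm_eq0 (L2_fnorm mu) ng).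
  by move: h; rewrite (fnorm_eq0 rho ng).2 // z mule0 ltxx.
have /choice[N hN] := fun n => (hg n).2.
pose c n : R := 2^-1 ^+ n / N n.
have N0 n : 0 < N n by case: (hN n).
have c0 n : 0 <= c n by rewrite divr_ge0 ?exprn_ge0 // ltW.
pose h n x := ((c n)%:E * g n x)%E.
have nh n : nneg_measurable (h n) by apply: nneg_measurableZ => //; case: (hg n).
have h2 n : norm2 mu (h n) = (2^-1 ^+ n)%:E.
  rewrite -[norm2 mu]/(fnorm (L2_fnorm mu)) fnormZ //; last by case: (hg n).
  rewrite /= (let: And3 _ e _ := hN n in e) -EFinM /c divfK //.
  by rewrite gt_eqF.
have hrho n : ((2 ^+ n)%:E <= rho (h n))%E.
  rewrite fnormZ //; last by case: (hg n).
  have [_ _ /ltW lt] := hN n; apply: le_trans (lee_wpmul2l _ lt); last by rewrite lee_fin.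
  have e : 2^-1 * 4 = 2 :> R by lra.
  have -> : 2 ^+ n = c n * (4 ^+ n * N n).
    by rewrite /c -{1}e exprMn; set p := _ ^+ n; field; rewrite gt_eqF.
  by rewrite -EFinM.
pose H x := (\sum_(0 <= i <oo) h i x)%E.
have nH : nneg_measurable H by exact: nneg_measurable_series.
have H2 : (norm2 mu H <= 2%:E)%E.
  apply: (@fnorm_series _ _ _ mu (L2_fnorm mu) h) => // M /=.
  have := @geometric_partial_sum R 0 M; rewrite expr0 mulr1; apply: le_trans.
  by apply: lee_sum => i _; rewrite h2 add0n.
have Hfin : {ae mu, forall x, (H x < +oo)%E}.
  by apply: (@fnorm_ae_fin _ _ _ _ (L2_fnorm mu)) => //; apply: le_lt_trans H2 _; exact: ltry.
pose f x : K := sc_mk k (fine (H x)) 0.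
have mf : sc_measurable f.
  by apply: sc_measurable_mk; apply: measurableT_comp => //; case: nH.
have fH : {ae mu, forall x, eabs f x = H x}.
  apply: filterS Hfin => x Hx; rewrite /eabs modulus_mk.
  have H0 := nneg_measurable_ge0 x nH.
  by rewrite ger0_norm ?fine_ge0 // fineK // ge0_fin_numE.
have [_ foo] : in_L rho f.
  apply: incl; split=> //.
  rewrite -[norm2 mu]/(fnorm (L2_fnorm mu)) (@fnorm_ae _ _ _ _ (L2_fnorm mu) _ H) //.
    by apply: le_lt_trans H2 _; exact: ltry.
  exact: nneg_measurable_eabs.
have low n : ((2 ^+ n)%:E <= rho (eabs f))%E.
  apply: le_trans (hrho n) _; apply: le_fnorm => //; first exact: nneg_measurable_eabs.
  apply: filterS fH => x ->; rewrite /H.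
  apply: le_trans (nneseries_lim_ge n.+1 _); last first.
    by move=> i _ _; case: (nh i).
  rewrite big_nat_recr //= leeDr //; apply: sume_ge0 => i _; by case: (nh i).
have rf : rho (eabs f) \is a fin_num.
  by rewrite ge0_fin_numE // fnorm_ge0 //; exact: nneg_measurable_eabs.
have := low (Num.truncn (fine (rho (eabs f)))).+1.
rewrite -(fineK rf) lee_fin leNgt => /negP; apply.
apply: lt_trans (truncnS_gt _) _.
by rewrite -natrX ltr_nat ltn_expl.
Qed.

End norm2_facts.

Section ell2_norm.
Context {R : realType} {k : scalar_kind}.
Local Notation K := (scalar_field R k).

(** The space is that of the counting measure, where a finite combination of unit
    vectors is a finitely supported function. *)
Lemma rn_ell2_sum N (a : nat -> K) :
  rn (\sum_(i < N) a i *: @ell2_unit R k i : ell2 R k) ^+ 2 = \sum_(i < N) modulus (a i) ^+ 2.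
Proof.
set u : ell2 R k := \sum_(i < N) _.
pose f (t : nat) : K := if (t < N)%N then a t else 0.
have mf : sc_measurable f by split=> _ Y mY.
have uf : {ae @counting nat R, forall t, Lrho_fun u t = f t}.
  have h1 := @Lrho_sum_ae _ _ R k _ (L2_fnorm (@counting nat R)) _ (index_enum 'I_N)
    (fun i => a i) (fun i : 'I_N => @ell2_unit R k i).
  have h2 : {ae @counting nat R, forall t, forall n, Lrho_fun (@ell2_unit R k n) t = @unit_seq R k n t}.
    by apply/ae_foralln => n; exact: Lrepr_ae.
  apply: filterS2 h1 h2 => t -> ht; under eq_bigr do rewrite ht /unit_seq.
  rewrite /f; case: ltnP => tN.
    rewrite (bigD1 (Ordinal tN)) //= eqxx mulr1 big1 ?addr0 // => i /eqP it.
    by case: eqP => [e|_]; rewrite ?mulr0 //; case: it; apply/val_inj.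
  by rewrite big1 // => i _; rewrite gtn_eqF ?mulr0 // (leq_trans (ltn_ord i)).
apply: EFin_inj.
have -> : (rn u ^+ 2)%:E = (norm2 (@counting nat R) (eabs f) `^ 2)%E.
  have <- : (rn u)%:E = norm2 (@counting nat R) (eabs f).
    rewrite rn_Lrho; apply: (@fnorm_ae _ _ _ _ (L2_fnorm (@counting nat R))).
    - exact: Lrho_nneg.
    - exact: nneg_measurable_eabs.
    - by apply: filterS uf => t; rewrite /eabs => ->.
  by rewrite poweR_EFin powR_mulrn ?rn_ge0.
rewrite norm2_sqr ge0_integral_count => [|t]; last by rewrite lee_fin sqr_ge0.
rewrite (@nneseries_split _ _ 0 N) => [|t _]; last by rewrite lee_fin sqr_ge0.
rewrite add0n [X in (_ + X)%E]eseries0 => [|t Nt _]; last first.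
  by rewrite /f ltnNge Nt /= modulus0 expr0n.
rewrite adde0 sumEFin big_mkord; congr EFin; apply: eq_bigr => i _.
by rewrite /f ltn_ord.
Qed.

End ell2_norm.

Section hilbert_case.
Context {d : measure_display} {T : measurableType d} {R : realType}.
Context {k : scalar_kind} {mu : {finite_measure set T -> \bar R}} {rho : function_norm mu}.
Local Notation K := (scalar_field R k).
Local Notation rhos := (assoc_fnorm mu rho).
Variables (x : nat -> Lrho k rho) (y : nat -> T -> K) (C D : R).
Hypothesis C0 : 0 <= C.
Hypothesis D0 : 0 <= D.
Hypothesis Ly : forall n, in_L rhos (y n).
Hypothesis sxy : sign_bounded (function_functionals (rho := rho) y) x C.
Hypothesis hD : forall g : T -> \bar R, nneg_measurable g ->
    (norm2 mu g < +oo)%E -> (rho g <= D%:E * norm2 mu g)%E.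

(** Testing a functional [g] that is bounded on [L_rho], hence on [L_2], against its
    own bounded truncations bounds its [L_2] norm. *)
Lemma norm2_signed_sum N (b : nat -> K) (e : 'I_N -> bool) :
  (forall w : nat -> K, sc_re (\sum_(i < N) w i * b i) <= rn (\sum_(i < N) w i *: x i)) ->
  (norm2 mu (eabs (signed_sum e b y)) <= (C * D)%:E)%E.
Proof.
move=> hb; set g := signed_sum e b y.
have mg : sc_measurable g by apply: signed_sum_measurable => i; case: (Ly i).
have mm := sc_measurable_modulus mg.
pose A n := [set t | modulus (g t) <= n%:R].
have mA n : measurable (A n) by exact: measurable_sublevel.
(* On the truncation [v n] the integral of [|g| |v n|] is the square
   of the [L_2] norm of [v n], which can be cancelled. *)
pose v n t : K := sc_mk k (modulus (g t) * \1_(A n) t) 0.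
have mv n : sc_measurable (v n).
  by apply: sc_measurable_mk; apply: measurable_funM => //; exact: measurable_indic.
have vE n t : modulus (v n t) = modulus (g t) * \1_(A n) t.
  by rewrite modulus_mk ger0_norm // mulr_ge0 ?modulus_ge0.
have vn n t : modulus (v n t) <= n%:R.
  rewrite vE indicE; case: (boolP (t \in A n)) => [|_]; last by rewrite mulr0.
  by rewrite inE mulr1.
have v2 n : (norm2 mu (eabs (v n)) <= (C * D)%:E)%E.
  have fin2 : (norm2 mu (eabs (v n)) < +oo)%E.
    have n0 : (0 : R) <= n%:R by [].
    apply: le_lt_trans (_ : norm2 mu (fun t => n%:R%:E * (EFin \o \1_setT) t)%E < _)%E.
      apply: (@fnorm_le _ _ _ _ (L2_fnorm mu)).
      - exact: nneg_measurable_eabs.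
      - apply: nneg_measurableZ => //; split=> [|t]; last by rewrite lee_fin.
        exact/measurable_EFinP/measurable_indic.
      - by move=> t; rewrite /= indicT mule1 lee_fin.
    rewrite -[norm2 mu]/(fnorm (L2_fnorm mu)) fnormZ //; last first.
      split=> [|t]; last by rewrite lee_fin.
      exact/measurable_EFinP/measurable_indic.
    apply: lte_mul_pinfty; rewrite ?lee_fin //.
    by apply: (fnorm_indic (L2_fnorm mu)) => //; rewrite ltey_eq fin_num_measure.
  have Lv : in_L rho (v n).
    split=> //; apply: le_lt_trans (hD (nneg_measurable_eabs (mv n)) fin2) _.
    by apply: lte_mul_pinfty; rewrite ?lee_fin.
  have f2 : norm2 mu (eabs (v n)) \is a fin_num by rewrite ge0_fin_numE ?norm2_eabs_ge0.
  have r0 : 0 <= fine (norm2 mu (eabs (v n))) by rewrite fine_ge0 ?norm2_eabs_ge0.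
  have := dual_bound C0 Ly sxy e hb Lv.
  have -> : (\int[mu]_t (eabs (signed_sum e b y) t * eabs (v n) t) =
      norm2 mu (eabs (v n)) `^ 2)%E.
    rewrite norm2_sqr; apply: eq_integral => t _; rewrite /eabs -EFinM !vE -/g; congr EFin.
    by rewrite indicE; case: (t \in A n); rewrite ?mulr1 // !mulr0 expr0n.
  move=> h; have := le_trans h (lee_wpmul2l _ (hD (nneg_measurable_eabs (mv n)) fin2)).
  rewrite lee_fin => /(_ C0); rewrite -(fineK f2) poweR_EFin powR_mulrn //.
  rewrite muleA -!EFinM !lee_fin expr2.
  have [->|n0] := eqVneq (fine (norm2 mu (eabs (v n)))) 0; first by rewrite mulr_ge0.
  by rewrite ler_pM2r // lt_def n0.
have lim : eabs g = fun t => limn (fun n => eabs (v n) t).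
  apply/funext => t; apply/esym/cvg_lim => //.
  apply: cvg_near_cst; near=> n; rewrite /eabs vE indicE mem_set ?mulr1 //.
  rewrite /A /=; near: n; exists (Num.truncn (modulus (g t))).+1 => // m /= tm.
  apply: le_trans (ltW (truncnS_gt _)) _; by rewrite ler_nat.
rewrite lim; apply: le_trans (_ : limn (fun n => norm2 mu (eabs (v n))) <= _)%E.
  rewrite -[norm2 mu]/(fnorm (L2_fnorm mu)) fnorm_lim // => [n|t m n mn].
    exact: nneg_measurable_eabs.
  rewrite /eabs lee_fin !vE ler_wpM2l ?modulus_ge0 // !indicE.
  case: (boolP (t \in A m)) => // tA; rewrite mem_set //.
  by move: tA; rewrite inE /A /= => /le_trans; apply; rewrite ler_nat.
apply: lime_le; last exact: nearW.
apply: ereal_nondecreasing_is_cvgn => m n mn.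
apply: (@fnorm_le _ _ _ _ (L2_fnorm mu)); try exact: nneg_measurable_eabs.
move=> t; rewrite /eabs lee_fin !vE ler_wpM2l ?modulus_ge0 // !indicE.
case: (boolP (t \in A m)) => // tA; rewrite mem_set //.
by move: tA; rewrite inE /A /= => /le_trans; apply; rewrite ler_nat.
Unshelve. all: by end_near. Qed.

(** Averaging [norm2_signed_sum] over all signs turns the left side into the integral of
    [sum |b_i|^2 |y_i|^2], which is at least [dl^2 sum |b_i|^2]. *)
Lemma norming_coefs_l2 N (b : nat -> K) (dl : R) : 0 <= dl ->
  (forall n, (dl%:E <= norm2 mu (eabs (y n)))%E) ->
  (forall w : nat -> K, sc_re (\sum_(i < N) w i * b i) <= rn (\sum_(i < N) w i *: x i)) ->
  dl ^+ 2 * \sum_(i < N) modulus (b i) ^+ 2 <= (C * D) ^+ 2.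
Proof.
move=> dl0 hdl hb.
have CD0 : 0 <= C * D by rewrite mulr_ge0.
have my n : sc_measurable (y n) by case: (Ly n).
have sq (f : T -> K) : sc_measurable f -> nneg_measurable (fun t => (modulus (f t) ^+ 2)%:E).
  move=> mf; split=> [|t]; last by rewrite lee_fin sqr_ge0.
  apply/measurable_EFinP; apply: measurable_funX; exact: sc_measurable_modulus.
have p0 : 0 < (2 ^ N)%:R :> R by rewrite ltr0n expn_gt0.
have hi : (\sum_(e : {ffun 'I_N -> bool}) \int[mu]_t (modulus (signed_sum e b y t) ^+ 2)%:E <=
    ((2 ^ N)%:R * (C * D) ^+ 2)%:E)%E.
  apply: (@le_trans _ _ (\sum_(e : {ffun 'I_N -> bool}) ((C * D) ^+ 2)%:E)%E).
    by apply: lee_sum => e _; rewrite -norm2_leP //; exact: norm2_signed_sum.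
  by rewrite sumEFin lee_fin sumr_const card_ffun card_bool card_ord mulr_natl.
have lo : (((2 ^ N)%:R * (dl ^+ 2 * \sum_(i < N) modulus (b i) ^+ 2))%:E <=
    \sum_(e : {ffun 'I_N -> bool}) \int[mu]_t (modulus (signed_sum e b y t) ^+ 2)%:E)%E.
  rewrite -ge0_integral_sum //; last 2 first.
  - by move=> e; case: (sq _ (signed_sum_measurable e b my)).
  - by move=> e t _; rewrite lee_fin sqr_ge0.
  under eq_integral do rewrite sumEFin sum_signs_modulus_sqr EFinM -sumEFin.
  have nm (i : 'I_N) : nneg_measurable (fun t => (modulus (b i * y i t) ^+ 2)%:E).
    exact/sq/sc_measurableZ.
  rewrite ge0_integralZl_EFin //; last 2 first.
  - by move=> t _; apply: sume_ge0 => i _; rewrite lee_fin sqr_ge0.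
  - by case: (nneg_measurable_sum (index_enum 'I_N) nm).
  rewrite EFinM; apply: lee_wpmul2l; first by rewrite lee_fin ltW.
  rewrite ge0_integral_sum //; last 2 first.
  - by move=> i; case: (nm i).
  - by move=> i t _; case: (nm i).
  rewrite mulr_sumr -sumEFin; apply: lee_sum => i _.
  have [mi i0] := sq _ (my i).
  under eq_integral do rewrite modulusM exprMn EFinM.
  rewrite ge0_integralZl_EFin ?sqr_ge0 // mulrC EFinM.
  by apply: lee_wpmul2l; rewrite ?lee_fin ?sqr_ge0 // -norm2_geP.
have := le_trans lo hi; rewrite lee_fin ler_pM2l //.
Qed.

Lemma cauchy_schwarz_sum N (p q : 'I_N -> R) (M : R) : 0 < M ->
  (forall i, 0 <= p i) -> (forall i, 0 <= q i) -> \sum_(i < N) q i ^+ 2 <= M ^+ 2 ->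
  (\sum_(i < N) p i * q i) <= M * Num.sqrt (\sum_(i < N) p i ^+ 2).
Proof.
move=> M0 p0 q0 hq; set S := \sum_(i < N) p i ^+ 2.
have S0 : 0 <= S by apply: sumr_ge0 => i _; rewrite sqr_ge0.
set s := Num.sqrt S; have s0 : 0 <= s by exact: sqrtr_ge0.
have ss : s ^+ 2 = S by rewrite sqr_sqrtr.
have [sz|sn] := eqVneq s 0.
  have Sz : S = 0 by rewrite -ss sz expr0n.
  rewrite sz mulr0 big1 // => i _.
  have := Sz; rewrite /S => /eqP; rewrite psumr_eq0 => [/allP/(_ i)|j _]; last exact: sqr_ge0.
  by rewrite mem_index_enum sqrf_eq0 => /(_ isT)/eqP ->; rewrite mul0r.
have sp : 0 < s by rewrite lt_def sn.
have -> : M * s = (M / s * S + s / M * M ^+ 2) / 2.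
  by rewrite -ss; field; rewrite sn gt_eqF.
apply: le_trans (_ : \sum_(i < N) (M / s * p i ^+ 2 + s / M * q i ^+ 2) / 2 <= _).
  apply: ler_sum => i _; rewrite ler_pdivlMr // -subr_ge0.
  have -> : M / s * p i ^+ 2 + s / M * q i ^+ 2 - p i * q i * 2 = (M * p i - s * q i) ^+ 2 / (s * M).
    by field; rewrite sn gt_eqF.
  by rewrite divr_ge0 ?sqr_ge0 // mulr_ge0 // ltW.
rewrite -mulr_suml ler_pM2r // big_split /= -!mulr_sumr lerD2l ler_wpM2l //.
by rewrite divr_ge0 // ltW.
Qed.

End hilbert_case.

(** * The Hilbertian case and rounding *)

Section hilbert_equivalence.
Context {d : measure_display} {T : measurableType d} {R : realType}.
Context {k : scalar_kind} {mu : {finite_measure set T -> \bar R}} {rho : function_norm mu}.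
Local Notation K := (scalar_field R k).
Local Notation rhos := (assoc_fnorm mu rho).

(** Cotype [2] and unconditionality give the lower estimate. The upper estimate is
    the duality with [norming_coefs_l2]: the coefficients of a norming functional are
    square summable. *)
Lemma equivalent_ell2 (x : nat -> Lrho k rho) (y : nat -> T -> K) (C D a dl : R) :
  0 <= C -> 0 <= D -> 0 < a -> 0 < dl ->
  rademacher_cotype2 (Lrho k rho) -> (forall n, in_L rhos (y n)) ->
  biorthogonal (function_functionals (rho := rho) y) x ->
  sign_bounded (function_functionals (rho := rho) y) x C ->
  (forall g : T -> \bar R, nneg_measurable g ->
    (norm2 mu g < +oo)%E -> (rho g <= D%:E * norm2 mu g)%E) ->
  (forall n, a <= rn (x n)) ->
  (forall n, (dl%:E <= norm2 mu (eabs (y n)))%E) ->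
  equivalent_seq x (@ell2_unit R k).
Proof.
move=> C0 D0 a0 dl0 /cotype2_rn[C2 C20 hC2] Ly bx sx hD ha hdl.
have lf := function_functionals_linear Ly.
have CD0 : 0 <= C * D by rewrite mulr_ge0.
apply: (@equivalent_seq_of_dominated _ _ _ _ x (fun n => ell2_unit R k n : ell2 R k)
  (C2 * C / a) ((C * D + 1) / dl)) => //; try exact: Lrho_banach.
- move=> N c; set S := rn (\sum_(i < N) c i *: x i); have S0 : 0 <= S by exact: rn_ge0.
  have := hC2 N (fun i => c i *: x i) (C * S) (fun e => signed_finite_sum c e lf bx sx).
  have : a ^+ 2 * \sum_(i < N) modulus (c i) ^+ 2 <= \sum_(i < N) rn (c i *: x i) ^+ 2.
    rewrite mulr_sumr; apply: ler_sum => i _; rewrite rnZ exprMn mulrC ler_wpM2l ?sqr_ge0 //.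
    by rewrite ler_pXn2r ?nnegrE ?rn_ge0 // ltW.
  move=> /le_trans h /h; rewrite -rn_ell2_sum -exprMn ler_pXn2r ?nnegrE ?mulr_ge0 ?rn_ge0 ?(ltW a0) //.
  rewrite -ler_pdivlMl //; set r := rn _ => {}h; apply: le_trans h _.
  by rewrite le_eqVlt; apply/orP; left; apply/eqP; field; rewrite gt_eqF.
move=> N c; have [b [hb1 hb2]] := norming_coefs x N c.
set M := (C * D + 1) / dl; have M0 : 0 < M by rewrite divr_gt0 //; lra.
have hb3 := norming_coefs_l2 C0 D0 Ly sx hD (ltW dl0) hdl hb2.
have hb4 : \sum_(i < N) modulus (b i) ^+ 2 <= M ^+ 2.
  rewrite /M expr_div_n ler_pdivlMr ?exprn_gt0 // mulrC; apply: le_trans hb3 _.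
  by rewrite ler_pXn2r ?nnegrE //; lra.
have := @cauchy_schwarz_sum R N (fun i => modulus (c i)) (fun i => modulus (b i)) M M0
  (fun i => modulus_ge0 _) (fun i => modulus_ge0 _) hb4.
rewrite -(rn_ell2_sum N c) sqrtr_sqr ger0_norm ?rn_ge0 //; apply: le_trans.
rewrite -hb1 sc_re_sum; apply: ler_sum => i _.
by rewrite -modulusM re_le_modulus.
Qed.

End hilbert_equivalence.

Section rounding.
Context {R : realType} {k : scalar_kind}.
Local Notation K := (scalar_field R k).

(** Truncation towards zero on the grid of mesh [1 / (p + 1)]; one of the two truncated
    numbers vanishes. *)
Definition round_real (p : nat) (a : R) : R :=
  ((Num.truncn (a * p.+1%:R))%:R - (Num.truncn (- a * p.+1%:R))%:R) / p.+1%:R.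

Lemma truncn_le0 (b : R) : b <= 0 -> Num.truncn b = 0%N.
Proof.
move=> b0; apply/eqP; rewrite -leqn0 truncn_le_nat.
by apply: le_lt_trans b0 _.
Qed.

Lemma round_realN p a : round_real p (- a) = - round_real p a.
Proof. by rewrite /round_real opprK -mulNr opprB. Qed.

Lemma round_real_ge0 p a : 0 <= a ->
  0 <= round_real p a <= a /\ a - round_real p a <= p.+1%:R^-1.
Proof.
move=> a0; have q0 : 0 < p.+1%:R :> R by [].
have ap : 0 <= a * p.+1%:R by rewrite mulr_ge0.
rewrite /round_real (@truncn_le0 (- a * _)); last by rewrite mulNr oppr_le0.
rewrite subr0; have /andP[h1 h2] := truncn_itv ap; split.
  by rewrite divr_ge0 //= ler_pdivrMr.
rewrite lerBlDr -(ler_pM2r q0) mulrDl divfK ?gt_eqF // mulVf ?gt_eqF //.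
by move: h2; set b := Num.truncn _; rewrite -[b.+1%:R]natr1 => h2; lra.
Qed.

Lemma round_real_abs p a : `|round_real p a| <= `|a| /\ `|a - round_real p a| <= p.+1%:R^-1.
Proof.
wlog a0 : a / 0 <= a => [h|].
  have [|a0] := leP 0 a; first exact: h.
  have [|h1 h2] := h (- a); first by rewrite oppr_ge0 ltW.
  have e : - a - round_real p (- a) = - (a - round_real p a).
    by rewrite round_realN opprK opprB addrC.
  by move: h1 h2; rewrite e round_realN !normrN.
have [/andP[h1 h2] h3] := round_real_ge0 p a0.
by rewrite (ger0_norm h1) (ger0_norm a0) ger0_norm // subr_ge0.
Qed.

Lemma round_real_measurable p : measurable_fun setT (round_real p).
Proof.
apply: nondecreasing_measurable => // a b ab.
rewrite /round_real ler_pM2r ?invr_gt0 // lerB // ler_nat le_truncn //.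
  by rewrite ler_pM2r.
by rewrite ler_pM2r // lerN2.
Qed.

Lemma round_real_finite p : finite_set [set round_real p a | a in [set a | `|a| <= p%:R]].
Proof.
pose N := (p * p.+1).+1.
apply: (@sub_finite_set _ _ [set (m%:R - n%:R) / p.+1%:R | m in `I_N & n in `I_N]); last first.
  by apply: finite_image2; exact: finite_II.
move=> _ [a /= ap <-].
have lt (b : R) : `|b| <= p%:R -> (Num.truncn (b * p.+1%:R) < N)%N.
  move=> bp; rewrite /N ltnS truncn_le_nat -[(p * p.+1).+1%:R]natr1 natrM.
  apply: le_lt_trans (_ : p%:R * p.+1%:R < _); last by rewrite ltrDl.
  by rewrite ler_pM2r // (le_trans (ler_norm b)).
by exists (Num.truncn (a * p.+1%:R)); [exact: lt|];
   exists (Num.truncn (- a * p.+1%:R)); [apply: lt; rewrite normrN|].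
Qed.

Context {d : measure_display} {T : measurableType d}.

(** Besides rounding, values of modulus above [p] are replaced by [0]: the function then
    has finite range, and its modulus does not increase. *)
Definition round_fun (p : nat) (f : T -> K) : T -> K := fun t =>
  if modulus (f t) <= p%:R then sc_mk k (round_real p (sc_re (f t))) (round_real p (sc_im (f t)))
  else 0.

Lemma round_real0 p : round_real p 0 = 0.
Proof. by rewrite /round_real oppr0 mul0r subrr mul0r. Qed.

Lemma round_re p f t : modulus (f t) <= p%:R -> sc_re (round_fun p f t) = round_real p (sc_re (f t)).
Proof. by rewrite /round_fun => ->; case: (k) f. Qed.

Lemma round_im p f t : modulus (f t) <= p%:R -> sc_im (round_fun p f t) = round_real p (sc_im (f t)).
Proof. by rewrite /round_fun => ->; case: (k) f => //= f; rewrite round_real0. Qed.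

Lemma round_fun_le p f t : modulus (round_fun p f t) <= modulus (f t).
Proof.
have [h|h] := boolP (modulus (f t) <= p%:R); last first.
  by rewrite /round_fun (negbTE h) modulus0 modulus_ge0.
rewrite !modulusE ler_wsqrtr // round_re // round_im // lerD //.
  rewrite -[leLHS]real_normK ?num_real // -[leRHS]real_normK ?num_real //.
  by rewrite ler_pXn2r ?nnegrE //; case: (round_real_abs p (sc_re (f t))).
rewrite -[leLHS]real_normK ?num_real // -[leRHS]real_normK ?num_real //.
by rewrite ler_pXn2r ?nnegrE //; case: (round_real_abs p (sc_im (f t))).
Qed.

Lemma round_fun_dist p f t : modulus (f t) <= p%:R ->
  modulus (f t - round_fun p f t) <= 2 / p.+1%:R.
Proof.
move=> h; apply: le_trans (modulus_le _) _; rewrite sc_reB sc_imB round_re // round_im //.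
have [_ h1] := round_real_abs p (sc_re (f t)); have [_ h2] := round_real_abs p (sc_im (f t)).
by apply: le_trans (lerD h1 h2) _; rewrite -mulr2n mulr_natl.
Qed.

Lemma round_fun_measurable p f : sc_measurable f -> sc_measurable (round_fun p f).
Proof.
move=> mf; have mA := measurable_sublevel p%:R mf.
have E (c : K -> R) : c 0 = 0 -> (forall t, modulus (f t) <= p%:R -> c (round_fun p f t) = round_real p (c (f t))) ->
    measurable_fun setT (c \o f) -> measurable_fun setT (c \o round_fun p f).
  move=> c0 cr mc; rewrite (_ : _ \o _ = (fun t => round_real p (c (f t)) * \1_[set t | modulus (f t) <= p%:R] t)).
    apply: measurable_funM; last exact: measurable_indic.
    apply: (@measurableT_comp _ _ _ _ _ _ (round_real p) _ (c \o f)) => //.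
    exact: round_real_measurable.
  apply/funext => t /=; rewrite indicE; case: (boolP (modulus (f t) <= p%:R)) => h.
    by rewrite cr // mem_set // mulr1.
  by rewrite memNset ?mulr0 //; [rewrite /round_fun (negbTE h)|exact/negP].
case: mf => mr mi; split; apply: E => //.
- exact: sc_re0.
- by move=> t; exact: round_re.
- exact: sc_im0.
- by move=> t; exact: round_im.
Qed.

Lemma round_fun_finite p f : finite_set (range (round_fun p f)).
Proof.
pose S := [set round_real p a | a in [set a | `|a| <= p%:R]].
apply: (@sub_finite_set _ _ ([set 0] `|` [set sc_mk k u v | u in S & v in S])); last first.
  rewrite finite_setU; split; first exact: finite_set1.
  by apply: finite_image2; exact: round_real_finite.
move=> _ [t _ <-]; rewrite /round_fun; case: ifP => h; [right|by left].
exists (round_real p (sc_re (f t))); first by exists (sc_re (f t)) => //=; apply: le_trans (abs_re_le _) h.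
by exists (round_real p (sc_im (f t))) => //; exists (sc_im (f t)) => //=; apply: le_trans (abs_im_le _) h.
Qed.

End rounding.

(** * Small sets and diagonal selection *)

Section small_sets.
Context {d : measure_display} {T : measurableType d} {R : realType}.
Variable mu : {measure set T -> \bar R}.
Local Open Scope ereal_scope.

Lemma cvge0P (u : nat -> \bar R) : (forall n, 0 <= u n) ->
  (u @ \oo --> 0 <-> forall e : R, (0 < e)%R -> exists N, forall n, (N <= n)%N -> u n <= e%:E).
Proof.
move=> u0; split=> [/fine_cvgP[[N1 _ h1] /cvgrPdist_le h2] e e0|h].
  have [N2 _ h3] := h2 _ e0; exists (maxn N1 N2) => n; rewrite geq_max => /andP[n1 n2].
  rewrite -(fineK (h1 n n1)) lee_fin; have := h3 n n2; rewrite sub0r normrN.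
  exact/le_trans/ler_norm.
apply/fine_cvgP; split.
  have [N hN] := h 1%R ltac:(lra); exists N => // n /hN un.
  by rewrite ge0_fin_numE //; apply: le_lt_trans un _; exact: ltry.
apply/cvgrPdist_le => e e0; have [N hN] := h e e0; exists N => // n /hN un /=.
by rewrite sub0r normrN ger0_norm ?fine_ge0 // -lee_fin fineK // ge0_fin_numE //;
  apply: le_lt_trans un _; exact: ltry.
Qed.

Lemma measure_tail_le (A : nat -> set T) (c : R) : (forall i, measurable (A i)) ->
  (forall i, mu (A i) <= (c * 2^-1 ^+ i)%:E) -> (0 <= c)%R ->
  mu (\bigcup_i A i) <= (2 * c)%:E.
Proof.
move=> mA hA c0.
apply: le_trans (_ : \sum_(0 <= i <oo) mu (A i) <= _).
  by apply: measure_sigma_subadditive => //; exact: bigcup_measurable.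
apply: lime_le; first exact: is_cvg_nneseries.
apply: nearW => N; apply: le_trans (_ : \sum_(0 <= i < N) c%:E * (2^-1 ^+ (0 + i))%:E <= _).
  by apply: lee_sum => i _; rewrite -EFinM add0n; exact: hA.
rewrite -ge0_sume_distrr; last by move=> i _; rewrite lee_fin exprn_ge0.
apply: le_trans (lee_wpmul2l _ (geometric_partial_sum 0 N)) _; first by rewrite lee_fin.
by rewrite -EFinM lee_fin expr0 mulr1 mulrC.
Qed.

(** Otherwise there are sets of measure at most [2^-n] that violate the bound; the unions
    of their tails decrease to a null set and violate it too. *)
Lemma small_sets (N : set T -> \bar R) :
  (forall A B, measurable A -> measurable B -> A `<=` B -> N A <= N B) ->
  (forall A, 0 <= N A) ->
  (forall A : nat -> set T, (forall n, measurable (A n)) -> nonincreasing_seq A ->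
     mu (A n) @[n --> \oo] --> 0 -> N (A n) @[n --> \oo] --> 0) ->
  forall e : R, (0 < e)%R -> exists2 dl : R, (0 < dl)%R &
    forall A, measurable A -> mu A <= dl%:E -> N A <= e%:E.
Proof.
move=> Nmono N0 Ncont e e0; apply: contrapT => no.
have /choice[A hA] : forall n : nat, exists A, [/\ measurable A, mu A <= (2^-1 ^+ n)%:E & e%:E < N A].
  move=> n; apply: contrapT => no'; apply: no; exists (2^-1 ^+ n)%R; first by rewrite exprn_gt0 // invr_gt0.
  by move=> A mA Am; rewrite leNgt; apply/negP => h; apply: no'; exists A.
pose B n := \bigcup_i A (n + i)%N.
have mB n : measurable (B n) by apply: bigcup_measurable => i _; case: (hA (n + i)%N).
have AB n : A n `<=` B n by move=> x Ax; exists 0%N => //; rewrite addn0.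
have Bdec : nonincreasing_seq B.
  move=> m n mn; apply/subsetPset => x [i _ Ax]; exists (n - m + i)%N => //.
  by rewrite addnA subnKC.
have muB n : mu (B n) <= (2 * 2^-1 ^+ n)%:E.
  apply: measure_tail_le => [i|i|]; last by rewrite exprn_ge0.
    by case: (hA (n + i)%N).
  by rewrite -exprD; case: (hA (n + i)%N).
have muB0 : mu (B n) @[n --> \oo] --> 0.
  apply/cvge0P => // r r0; have [M hM] := half_pow_small 2 r0; exists M => n Mn.
  apply: le_trans (muB n) _; rewrite lee_fin ltW //; apply: le_lt_trans hM.
  by rewrite ler_pM2l // ler_wiXn2l //; lra.
have /cvge0P := Ncont B mB Bdec muB0; move=> /(_ (fun n => N0 _)) /(_ _ e0)[M hM].
have := hM M (leqnn M); have [mA _ lt] := hA M.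
by rewrite leNgt => /negP; apply; apply: lt_le_trans lt _; exact: Nmono.
Qed.

(** Diagonal choice: the sets selected after the [j]-th step are so small that their
    union is negligible for the objects selected at that step. *)
Lemma selection (E : R -> nat -> set T) (good : nat -> R -> nat -> Prop)
    (dl : nat -> nat -> R) :
  (forall M n, measurable (E M n)) -> (forall j n, (0 < dl j n)%R) ->
  (forall j (b : R), (0 < b)%R -> exists2 M : R, (j%:R <= M)%R &
     forall N, exists n, [/\ (N <= n)%N, good j M n & mu (E M n) <= b%:E]) ->
  exists (s : nat -> nat) (M : nat -> R),
   [/\ {homo s : m n / (m < n)%N}, forall j, (j%:R <= M j)%R,
       forall j, good j (M j) (s j) &
       forall j, mu (\bigcup_i E (M (j + i).+1) (s (j + i).+1)) <= (dl j (s j))%:E].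
Proof.
move=> mE dl0 H.
have /choice[g hg] : forall q : nat * R * nat, exists p : R * nat, (0 < q.1.2)%R ->
    [/\ (q.1.1%:R <= p.1)%R, (q.2 <= p.2)%N, good q.1.1 p.1 p.2 & mu (E p.1 p.2) <= (q.1.2)%:E].
  move=> [[j b] N] /=; have [b0|nb] := pselect (0 < b)%R; last by exists (0%R, 0%N) => /nb.
  have [M jM /(_ N)[n [Nn gn En]]] := H j b b0.
  by exists (M, n).
(* The budget [b] bounds the measure of the next set; halving it at each step, after
   taking the minimum with [dl], keeps the measure of all later sets below [dl]. *)
pose nxt j (b : R) N := let p := g (j, b, N) in
  (p, Num.min b (dl j p.2) / 2)%R.
pose st := fix st j := if j is i.+1 then nxt j (st i).2 (st i).1.2.+1 else nxt 0%N 1%R 0%N.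
pose b j := if j is i.+1 then (st i).2 else 1%R.
pose s j := (st j).1.2; pose M j := (st j).1.1.
have b0 j : (0 < b j)%R.
  suff h i : (0 < (st i).2)%R by case: j.
  elim: i => [|i ih] /=; rewrite divr_gt0 // lt_min dl0 ?ih //; lra.
have stE j : (st j).1 = g (j, b j, if j is i.+1 then (s i).+1 else 0%N) by case: j.
have spec j : [/\ (j%:R <= M j)%R, ((if j is i.+1 then (s i).+1 else 0) <= s j)%N,
    good j (M j) (s j) & mu (E (M j) (s j)) <= (b j)%:E].
  by rewrite /M /s stE; exact: (hg (j, b j, if j is i.+1 then (s i).+1 else 0%N) (b0 j)).
have bS j : b j.+1 = (Num.min (b j) (dl j (s j)) / 2)%R by case: j.
exists s, M; split.
- have sS j : (s j < s j.+1)%N by have [] := spec j.+1.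
  move=> m n; elim: n => // n ih; rewrite ltnS leq_eqVlt => /predU1P[->//|/ih h].
  exact: ltn_trans h (sS n).
- by move=> j; case: (spec j).
- by move=> j; case: (spec j).
move=> j.
have bi i : (b (j + i).+1 <= b j.+1 * 2^-1 ^+ i)%R.
  elim: i => [|i ih]; first by rewrite addn0 mulr1.
  rewrite addnS bS exprS mulrCA [leRHS]mulrC ler_pM2r; last lra.
  by apply: le_trans ih; rewrite ge_min lexx.
apply: le_trans (@measure_tail_le (fun i => E (M (j + i).+1) (s (j + i).+1)) (b j.+1) _ _ _) _.
- by move=> i; exact: mE.
- move=> i; have [_ _ _ h] := spec (j + i).+1; apply: le_trans h _.
  by rewrite lee_fin.
- exact: ltW.
rewrite lee_fin bS mulrC divfK ?pnatr_eq0 //.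
by rewrite ge_min lexx orbT.
Qed.

Lemma measure_superlevel_le {k : scalar_kind} (f : T -> scalar_field R k) (I M : R) :
  sc_measurable f -> \int[mu]_t eabs f t <= I%:E -> (0 < M)%R ->
  mu [set t | (M < modulus (f t))%R] <= (I / M)%:E.
Proof.
move=> mf hI M0; set A := [set t | _].
have mA : measurable A by exact: measurable_superlevel.
have h : M%:E * mu A <= I%:E.
  apply: le_trans hI; rewrite -{1}(setIT A) -integral_indic // -ge0_integralZl_EFin //; last 2 first.
  - exact/measurable_EFinP/measurable_indic.
  - exact: ltW.
  have [nf f0] := nneg_measurable_eabs mf.
  apply: ge0_le_integral => //.
  - by move=> t _; rewrite mule_ge0 // lee_fin ltW.
  - by apply: measurable_funeM; exact/measurable_EFinP/measurable_indic.
  move=> t _; rewrite indicE; case: (boolP (t \in A)) => [|_] /=; last by rewrite mule0.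
  by rewrite inE /A /= mule1 => /ltW.
by rewrite EFinM lee_pdivlMr // muleC.
Qed.

End small_sets.

(** * Construction of one block *)

Section simple_blocks.
Context {d : measure_display} {T : measurableType d} {R : realType}.
Context {k : scalar_kind} {mu : {measure set T -> \bar R}}.
Local Notation K := (scalar_field R k).
Implicit Types (A B : set T) (f : T -> K).

Definition cutoff A f : T -> K := fun t => if t \in A then f t else 0.

Lemma cutoff_in A f t : A t -> cutoff A f t = f t.
Proof. by move=> At; rewrite /cutoff mem_set. Qed.

Lemma cutoff_out A f t : ~ A t -> cutoff A f t = 0.
Proof. by move=> At; rewrite /cutoff memNset. Qed.

Lemma cutoff_le A f t : modulus (cutoff A f t) <= modulus (f t).
Proof. by rewrite /cutoff; case: ifP => // _; rewrite modulus0 modulus_ge0. Qed.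

Lemma cutoff_measurable A f : measurable A -> sc_measurable f -> sc_measurable (cutoff A f).
Proof.
move=> mA mf; rewrite (_ : cutoff A f = fun t => sc_mk k (\1_A t) 0 * f t).
  by apply: sc_measurableM => //; apply: sc_measurable_mk; exact: measurable_indic.
apply/funext => t; rewrite /cutoff indicE; case: (t \in A) => /=.
  by rewrite sc_mk1 mul1r.
by rewrite sc_mk0 mul0r.
Qed.

Lemma cutoff_finite A f : finite_set (range f) -> finite_set (range (cutoff A f)).
Proof.
move=> h; apply: (@sub_finite_set _ _ ([set 0] `|` range f)).
  by move=> _ [t _ <-]; rewrite /cutoff; case: ifP => _; [right; exists t|left].
by rewrite finite_setU; split => //; exact: finite_set1.
Qed.

Lemma eabs_cutoff A f t : eabs (cutoff A f) t = (eabs f t * (\1_A t)%:E)%E.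
Proof.
rewrite /eabs /cutoff indicE; case: (t \in A); first by rewrite mule1.
by rewrite mule0 modulus0.
Qed.

Lemma sc_integrable_cutoff A f : measurable A -> sc_integrable mu f -> sc_integrable mu (cutoff A f).
Proof.
move=> mA [mf foo]; apply: (@sc_integrable_le _ _ _ _ _ _ (eabs f)) => //.
- exact: cutoff_measurable.
- exact: nneg_measurable_eabs.
- by move=> t; rewrite lee_fin cutoff_le.
Qed.

(** The product [y X] has integral [1] and contributes at most [1/8] off [A], hence at most
    [1/4] after real and imaginary parts are separated; by dominated convergence the
    rounded product is as close as needed to it on [A]. *)
Lemma rounded_pairing (X y : T -> K) A B : measurable A -> measurable B -> A `<=` B ->
  sc_measurable X -> sc_measurable y -> sc_integrable mu (fun t => y t * X t) ->
  pairing mu y X = 1 ->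
  (\int[mu]_t eabs (cutoff (~` A) (fun t => y t * X t)%R) t <= (8^-1)%:E)%E ->
  exists p0, forall p, (p0 <= p)%N ->
    2^-1 <= modulus (pairing mu (cutoff B (round_fun p y)) (cutoff A (round_fun p X))) <= 2.
Proof.
move=> mA mB AB mX my iF pF hA; set F := fun t => y t * X t.
pose D p t := cutoff B (round_fun p y) t * cutoff A (round_fun p X) t.
have mF : sc_measurable F by case: iF.
have mD p : sc_measurable (D p).
  by apply: sc_measurableM; apply: cutoff_measurable => //; exact: round_fun_measurable.
pose W p t := cutoff A F t - D p t.
have mW p : sc_measurable (W p) by apply: sc_measurableB => //; exact: cutoff_measurable.
have DF p t : modulus (D p t) <= modulus (F t).
  rewrite !modulusM; apply: ler_pM; rewrite ?modulus_ge0 //;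
    apply: le_trans (cutoff_le _ _ _) (round_fun_le _ _ _).
have W2 p t : modulus (W p t) <= 2 * modulus (F t).
  rewrite mulr_natl mulr2n; apply: le_trans (modulusD _ _) _; rewrite modulusN.
  by rewrite lerD // cutoff_le.
have Wcvg t : (fun p => eabs (W p) t) @ \oo --> 0%E.
  apply/cvge0P => [p|e e0]; first by rewrite lee_fin modulus_ge0.
  have [At|nAt] := pselect (A t); last first.
    exists 0%N => p _; rewrite /eabs /W /D !(cutoff_out _ nAt) mulr0 subr0 modulus0.
    by rewrite lee_fin ltW.
  pose c := modulus (y t) + modulus (X t).
  have c0 : 0 <= c by rewrite addr_ge0 ?modulus_ge0.
  exists (Num.truncn (2 * c / e) + (Num.truncn c).+1)%N => p hp.
  have pc : c <= p%:R.
    apply: le_trans (ltW (truncnS_gt _)) _; rewrite ler_nat.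
    by apply: leq_trans hp; rewrite leq_addl.
  have pe : 2 * c / p.+1%:R <= e.
    rewrite ler_pdivrMr // [e * _]mulrC -ler_pdivrMr //; apply: le_trans (ltW (truncnS_gt _)) _.
    by rewrite ler_nat ltnS; apply: leq_trans hp; rewrite leq_addr.
  have yp : modulus (y t) <= p%:R by apply: le_trans pc; rewrite lerDl modulus_ge0.
  have Xp : modulus (X t) <= p%:R by apply: le_trans pc; rewrite lerDr modulus_ge0.
  rewrite lee_fin /W /D !(cutoff_in _ At) (cutoff_in _ (AB _ At)) /F.
  have -> : y t * X t - round_fun p y t * round_fun p X t =
      y t * (X t - round_fun p X t) + (y t - round_fun p y t) * round_fun p X t by ring.
  apply: le_trans pe; apply: le_trans (modulusD _ _) _; rewrite !modulusM.
  have h1 := round_fun_dist Xp; have h2 := round_fun_dist yp; have h3 := round_fun_le p X t.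
  have -> : 2 * c / p.+1%:R = modulus (y t) * (2 / p.+1%:R) + 2 / p.+1%:R * modulus (X t).
    by rewrite /c; set q := p.+1%:R^-1; ring.
  by apply: lerD; apply: ler_pM; rewrite ?modulus_ge0.
have h1 p : measurable_fun setT (eabs (W p)) by case: (nneg_measurable_eabs (mW p)).
have h2 : {ae mu, forall t, setT t -> (fun p => eabs (W p) t) @ \oo --> cst 0%E t}.
  by apply: nearW => t _; exact: Wcvg.
have h3 : mu.-integrable setT (fun t => 2%:E * eabs F t)%E.
  have [nF F0] := nneg_measurable_eabs mF.
  apply: integrableZl => //; apply/integrableP; split=> //.
  by under eq_integral do rewrite gee0_abs //; case: iF.
have h4 : {ae mu, forall t (p : nat), setT t -> (`|eabs (W p) t| <= 2%:E * eabs F t)%E}.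
  by apply: nearW => t p _; rewrite gee0_abs ?lee_fin ?modulus_ge0 // W2.
have [_ _ cvgW] := @dominated_convergence _ _ _ mu setT measurableT
  (fun p => eabs (W p)) (cst 0%E) _ h1 (measurable_cst _) h2 h3 h4.
rewrite integral0 in cvgW.
have I0 p : (0 <= \int[mu]_t eabs (W p) t)%E by apply/nneg_integral_ge0/nneg_measurable_eabs.
have [p0 hp0] := (cvge0P I0).1 cvgW 8^-1 ltac:(lra).
exists p0 => p /hp0 Wp.
have iC := sc_integrable_cutoff (measurableC mA) iF.
have iW : sc_integrable mu (W p) by split=> //; apply: le_lt_trans Wp _; exact: ltry.
have iD : sc_integrable mu (D p).
  apply: (@sc_integrable_le _ _ _ _ _ _ (eabs F)) => //.
  - exact: nneg_measurable_eabs.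
  - by move=> t; rewrite lee_fin.
  - by case: iF.
have split1 : 1 = sc_integral mu (cutoff (~` A) F) + sc_integral mu (W p) + sc_integral mu (D p).
  rewrite -pF /pairing -sc_integralD // -sc_integralD //; last exact: sc_integrableD.
  congr sc_integral; apply/funext => t; rewrite /W addrA subrK -/F.
  by have [At|nAt] := pselect (A t); [rewrite cutoff_out ?cutoff_in ?add0r // => /(_ At)|
    rewrite cutoff_in ?(cutoff_out _ nAt) ?addr0].
have small f : sc_integrable mu f -> (\int[mu]_t eabs f t <= (8^-1)%:E)%E ->
    modulus (sc_integral mu f) <= 4^-1.
  move=> iff hf; apply: le_trans (modulus_sc_integral_le iff) _.
  have : fine (\int[mu]_t eabs f t)%E <= 8^-1.
    rewrite -lee_fin fineK // ge0_fin_numE; first by case: iff.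
    by apply/nneg_integral_ge0/nneg_measurable_eabs; case: iff.
  lra.
have s1 := small _ iC hA; have s2 := small _ iW Wp.
rewrite -[pairing mu _ _]/(sc_integral mu (D p)).
set u := sc_integral mu (cutoff _ _) in split1 s1; set w := sc_integral mu (W p) in split1 s2.
set v := sc_integral mu (D p) in split1 *.
have e1 : v = 1 - (u + w) by rewrite split1 addrC addKr.
have d1 := modulusD u w; have d2 := modulusD 1 (- (u + w)).
have d3 := modulusD (u + w) v; rewrite -split1 modulus1 in d3.
rewrite -e1 modulusN modulus1 in d2.
by apply/andP; split; lra.
Qed.

(** A block is made of roundings of [X] on [A] and of [y] on [B], normalized to have
    pairing [1]. The lower bounds on the supports are what makes the sequences of
    blocks escape to infinity, and the last part keeps [psi] close to [y]. *)
Definition simple_block (X y : T -> K) A B p (phi psi : T -> K) : Prop :=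
  [/\ [/\ sc_measurable phi, sc_measurable psi, finite_set (range phi) & finite_set (range psi)],
      [/\ forall t, ~ B t -> phi t = 0, forall t, ~ B t -> psi t = 0,
          forall t, modulus (phi t) <= 2 * modulus (X t) &
          forall t, modulus (psi t) <= modulus (y t)],
      pairing mu psi phi = 1,
      (forall t, phi t != 0 -> A t /\ modulus (X t) - 2 <= 2 * modulus (phi t)) /\
      (forall t, psi t != 0 -> B t /\ modulus (y t) - 2 <= modulus (psi t)) &
      forall t, B t -> psi t = round_fun p y t].

Lemma round_fun_large p f t : round_fun p f t != 0 -> modulus (f t) - 2 <= modulus (round_fun p f t).
Proof.
have [h _|h] := boolP (modulus (f t) <= p%:R); last first.
  by rewrite /round_fun (negbTE h) eqxx.
have d1 := round_fun_dist h; have := modulusD (f t - round_fun p f t) (round_fun p f t).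
have d2 : 2 / p.+1%:R <= 2 :> R by rewrite ler_pdivrMr // ler_peMr // ler1n.
rewrite subrK => d3; rewrite lerBlDr; apply: le_trans d3 _.
by rewrite addrC lerD2l; exact: le_trans d1 d2.
Qed.

Lemma simple_block_exists (X y : T -> K) A B : measurable A -> measurable B -> A `<=` B ->
  sc_measurable X -> sc_measurable y -> sc_integrable mu (fun t => y t * X t) ->
  pairing mu y X = 1 ->
  (\int[mu]_t eabs (cutoff (~` A) (fun t => y t * X t)%R) t <= (8^-1)%:E)%E ->
  exists p0, forall p, (p0 <= p)%N -> exists phi psi, simple_block X y A B p phi psi.
Proof.
move=> mA mB AB mX my iF pF hA.
have [p0 hp0] := rounded_pairing mA mB AB mX my iF pF hA.
exists p0 => p /hp0; set h := cutoff A _; set g := cutoff B _; set v := pairing mu g h => /andP[v1 v2].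
have vp : 0 < modulus v by lra.
have v0 : v != 0 by rewrite -modulus_gt0.
(* Dividing by the pairing [v] costs a factor [2] in the domination of [phi]. *)
have vi : (modulus v)^-1 <= 2.
  by rewrite -[leRHS]invrK lef_pV2 ?posrE ?invr_gt0.
have mg : sc_measurable g by apply: cutoff_measurable => //; exact: round_fun_measurable.
have mh : sc_measurable h by apply: cutoff_measurable => //; exact: round_fun_measurable.
have gy t : modulus (g t) <= modulus (y t) by apply: le_trans (cutoff_le _ _ _) (round_fun_le _ _ _).
have hX t : modulus (h t) <= modulus (X t) by apply: le_trans (cutoff_le _ _ _) (round_fun_le _ _ _).
exists (fun t => v^-1 * h t), g; split.
- split=> //; first exact: sc_measurableZ.
    rewrite -[X in range X]/((fun z => v^-1 * z) \o h) -image_comp; apply: finite_image.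
    exact/cutoff_finite/round_fun_finite.
  exact/cutoff_finite/round_fun_finite.
- split=> [t nB|t nB|t|//].
  + by rewrite /h cutoff_out ?mulr0 // => /AB.
  + by rewrite /g cutoff_out.
  + rewrite modulusM modulusV; apply: ler_pM; rewrite ?invr_ge0 ?modulus_ge0 //.
- have igh : sc_integrable mu (fun t => g t * h t).
    apply: (@sc_integrable_le _ _ _ _ _ _ (eabs (fun t => y t * X t))).
    + exact: sc_measurableM.
    + by apply: nneg_measurable_eabs; case: iF.
    + by move=> t; rewrite lee_fin !modulusM; apply: ler_pM; rewrite ?modulus_ge0.
    + by case: iF.
  rewrite /pairing (_ : (fun t => _) = (fun t => v^-1 * (g t * h t))).
    by rewrite sc_integralZ // -[sc_integral _ _]/v mulVf.
  by apply/funext => t; rewrite mulrCA.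
- split=> t.
    have [At|nAt] := pselect (A t); last by rewrite /h cutoff_out // mulr0 eqxx.
    rewrite mulf_eq0 negb_or => /andP[_ ht]; split=> //.
    have := ht; rewrite {1}/h cutoff_in // => /round_fun_large hl.
    apply: le_trans hl _; rewrite modulusM modulusV mulrA -{1}(cutoff_in _ At) -/h.
    by rewrite ler_peMl ?modulus_ge0 // ler_pdivlMr // mul1r.
  have [Bt|nBt] := pselect (B t); last by rewrite /g cutoff_out // eqxx.
  by rewrite /g cutoff_in // => /round_fun_large.
- by move=> t Bt; rewrite /g cutoff_in.
Qed.

End simple_blocks.

(** * Absolute continuity *)

Section cut_estimates.
Context {d : measure_display} {T : measurableType d} {R : realType}.
Context {k : scalar_kind} {mu : {finite_measure set T -> \bar R}} {rho : function_norm mu}.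
Local Notation K := (scalar_field R k).
Local Notation rhos := (assoc_fnorm mu rho).
Implicit Types (A B : set T) (f y : T -> K).

Lemma cutoff_cover A A1 A2 f (t : T) : A `<=` A1 `|` A2 ->
  (eabs (cutoff A f) t <= eabs (cutoff A1 f) t + eabs (cutoff A2 f) t)%E.
Proof.
move=> AU; rewrite /eabs -EFinD lee_fin.
have [At|nAt] := pselect (A t); last by rewrite (cutoff_out _ nAt) modulus0 addr_ge0 ?modulus_ge0.
by have [h|h] := AU t At; rewrite (cutoff_in _ At) (cutoff_in _ h) ?lerDl ?lerDr modulus_ge0.
Qed.

Lemma integral_cutoff_cover A A1 A2 f : measurable A -> measurable A1 -> measurable A2 ->
  sc_measurable f -> A `<=` A1 `|` A2 ->
  (\int[mu]_t eabs (cutoff A f) t <= \int[mu]_t eabs (cutoff A1 f) t + \int[mu]_t eabs (cutoff A2 f) t)%E.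
Proof.
move=> mA m1 m2 mf AU.
have n1 := nneg_measurable_eabs (cutoff_measurable m1 mf).
have n2 := nneg_measurable_eabs (cutoff_measurable m2 mf).
rewrite -ge0_integralD //; [|by case: n1|by case: n1|by case: n2|by case: n2].
apply: nneg_integral_le; first exact/nneg_measurable_eabs/cutoff_measurable.
  exact: nneg_measurableD.
by apply: nearW => t; exact: cutoff_cover.
Qed.

Lemma integral_small f (e : R) : sc_integrable mu f -> 0 < e ->
  exists2 dl : R, 0 < dl & forall A, measurable A -> (mu A <= dl%:E)%E ->
    (\int[mu]_t eabs (cutoff A f) t <= e%:E)%E.
Proof.
move=> [mf foo] e0; have [nf f0] := nneg_measurable_eabs mf.
have im : mu.-integrable setT (EFin \o (fun t => modulus (f t))).
  apply/integrableP; split=> //.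
  by under eq_integral do rewrite /= ger0_norm ?modulus_ge0 //.
have [dl [dl0 hdl]] := integral_normr_continuous im e0.
exists (dl / 2); first lra.
move=> A mA Adl; have := hdl A mA.
have -> : (mu A < dl%:E)%E by apply: le_lt_trans Adl _; rewrite lte_fin; lra.
move=> /(_ isT) /ltW; rewrite -lee_fin; apply: le_trans.
rewrite /Rintegral fineK.
  rewrite integral_mkcond le_eqVlt; apply/orP; left; apply/eqP.
  apply: eq_integral => t _; rewrite patchE /eabs /cutoff.
  by case: ifP; rewrite ?modulus0 // ger0_norm ?modulus_ge0.
apply: integrable_fin_num => //; apply: (integrableS measurableT) => //.
exact: (integrable_abse im).
Qed.

Lemma assoc_one : in_L rhos (fun=> 1 : K).
Proof.
split.
  split; [rewrite (_ : _ \o _ = cst 1)|rewrite (_ : _ \o _ = cst 0)];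
    try exact: measurable_cst; apply/funext => t /=; first by rewrite sc_re1.
  by rewrite sc_im1.
have [c hc] := fnorm_integral rho measurableT (fin_num_fun_lty (@fin_num_measure _ _ _ mu)).
apply: (@le_lt_trans _ _ `|c|%:E); last exact: ltry.
apply: assoc_lub => g ng g1.
under eq_integral do rewrite /eabs modulus1 mul1e.
apply: le_trans (hc g ng) _; apply: le_trans (_ : `|c|%:E * rho g <= _)%E.
  by apply: lee_wpmul2r; [exact: fnorm_ge0|rewrite lee_fin ler_norm].
by rewrite -[leRHS]mule1; apply: lee_wpmul2l; rewrite ?lee_fin.
Qed.

Hypothesis rhos_ac : absolutely_continuous_fnorm mu rhos.

(** Absolute continuity, which speaks of decreasing sequences of sets, controls all sets
    of small measure. *)
Lemma assoc_small y (e : R) : in_L rhos y -> 0 < e ->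
  exists2 dl : R, 0 < dl & forall A, measurable A -> (mu A <= dl%:E)%E ->
    (rhos (eabs (cutoff A y)) <= e%:E)%E.
Proof.
move=> [my yoo]; apply: (@small_sets _ _ _ mu (fun A => rhos (eabs (cutoff A y)))).
- move=> A B mA mB AB; apply: assoc_le; try exact/nneg_measurable_eabs/cutoff_measurable.
  apply: nearW => t; rewrite lee_fin.
  have [At|nAt] := pselect (A t); first by rewrite !cutoff_in //; exact: AB.
  by rewrite (cutoff_out _ nAt) modulus0 modulus_ge0.
- by move=> A; exact: assoc_ge0.
- move=> A mA dA A0.
  have E : (fun n => rhos (eabs (cutoff (A n) y))) =
      fun n => rhos (fun t => eabs y t * (\1_(A n) t)%:E)%E.
    by apply/funext => n; congr rhos; apply/funext => t; exact: eabs_cutoff.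
  by rewrite E; exact: rhos_ac (nneg_measurable_eabs my) yoo mA dA A0.
Qed.

Lemma fnorm_one : in_L rho (fun=> 1 : K).
Proof.
split; first by case: assoc_one.
rewrite (_ : eabs _ = EFin \o \1_[set: T]).
  exact/fnorm_indic/(fin_num_fun_lty (@fin_num_measure _ _ _ mu)).
by apply/funext => t; rewrite /eabs /= modulus1 indicT.
Qed.

Lemma measure_superlevel_small y (b : R) : in_L rhos y -> 0 < b ->
  exists p0, forall p, (p0 <= p)%N -> (mu [set t | (p%:R < modulus (y t))%R] <= b%:E)%E.
Proof.
move=> Ly b0; have [my' yoo] : sc_integrable mu y.
  have := pairing_integrable Ly fnorm_one.
  by rewrite (_ : (fun t => _) = y) //; apply/funext => t; rewrite mulr1.
have I0 : (0 <= \int[mu]_t eabs y t)%E by exact/nneg_integral_ge0/nneg_measurable_eabs.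
set I := (\int[mu]_t eabs y t)%E in yoo I0.
have If : I \is a fin_num by rewrite ge0_fin_numE.
exists (Num.truncn (fine I / b)).+1 => p hp.
have p0 : 0 < p%:R :> R by rewrite ltr0n; exact: leq_trans hp.
have hI : (\int[mu]_t eabs y t <= (fine I)%:E)%E by rewrite fineK.
apply: le_trans (measure_superlevel_le my' hI p0) _.
rewrite lee_fin ler_pdivrMr // mulrC -ler_pdivrMr // ltW //.
by apply: lt_le_trans (truncnS_gt _) _; rewrite ler_nat.
Qed.

(** Rounding changes [y] by at most [2 / (p + 1)] where [|y| <= p], and the set where
    [|y| > p] has small measure. *)
Lemma assoc_round_small y (e : R) : in_L rhos y -> 0 < e ->
  exists p0, forall p, (p0 <= p)%N ->
    (rhos (eabs (fun t => (y t - round_fun p y t)%R)) <= e%:E)%E.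
Proof.
move=> Ly e0; have [my yoo] := Ly; have [m1 l1] := assoc_one.
have [dl dl0 hdl] := @assoc_small y (e / 2) Ly ltac:(lra).
have [p1 hp1] := measure_superlevel_small Ly dl0.
have r1f : rhos (eabs (fun=> 1 : K) : T -> \bar R) \is a fin_num by rewrite ge0_fin_numE ?assoc_ge0.
set r1 := fine (rhos (eabs (fun=> 1 : K) : T -> \bar R)).
have r10 : 0 <= r1 by rewrite fine_ge0 ?assoc_ge0.
exists (maxn p1 (Num.truncn (4 * r1 / e)).+1) => p; rewrite geq_max => /andP[pp1 pe].
set A := [set t | p%:R < modulus (y t)].
have mA : measurable A by exact: measurable_superlevel.
have n1 := nneg_measurable_eabs m1.
have n2 := nneg_measurable_eabs (cutoff_measurable mA my).
have q0 : 0 <= 2 / p.+1%:R :> R by rewrite divr_ge0.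
apply: (@le_trans _ _ (rhos (fun t => ((2 / p.+1%:R)%:E * eabs (fun=> 1%R : K) t + eabs (cutoff A y) t)%E))).
  apply: assoc_le.
  - by apply/nneg_measurable_eabs/sc_measurableB => //; exact: round_fun_measurable.
  - by apply: nneg_measurableD => //; exact: nneg_measurableZ.
  - apply: nearW => t; rewrite /eabs modulus1 mule1 -EFinD lee_fin.
    have [At|nAt] := pselect (A t).
      rewrite (cutoff_in _ At) /round_fun [modulus (y t) <= _]leNgt (_ : _ < _ = true) //=.
      by rewrite subr0 lerDr.
    rewrite (cutoff_out _ nAt) modulus0 addr0; apply: round_fun_dist.
    by rewrite leNgt; apply/negP.
apply: le_trans (assocD _ _ _) _ => //; first exact: nneg_measurableZ.
apply: le_trans (leeD (assocZ rho q0 n1) (hdl A mA (hp1 p pp1))) _.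
rewrite -(fineK r1f) -EFinM -EFinD lee_fin -/r1.
have : 2 / p.+1%:R * r1 <= e / 2.
  rewrite mulrAC ler_pdivrMr // mulrAC ler_pdivlMr // [e * _]mulrC -ler_pdivrMr //.
  rewrite (_ : 2 * r1 * 2 = 4 * r1); last by ring.
  by apply: le_trans (ltW (truncnS_gt _)) _; rewrite ler_nat; exact: leq_trans pe _.
by set z := _ * r1; lra.
Qed.

End cut_estimates.

(** * Selection of the blocks *)

Section selecting_blocks.
Context {d : measure_display} {T : measurableType d} {R : realType}.
Context {k : scalar_kind} {mu : {finite_measure set T -> \bar R}} {rho : function_norm mu}.
Local Notation K := (scalar_field R k).
Local Notation rhos := (assoc_fnorm mu rho).

(** An infimum that is not attained is approached by infinitely many terms. *)
Lemma frequently_small (u : nat -> \bar R) : (forall n, (0 < u n)%E) ->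
  ereal_inf (range u) = 0%E ->
  forall (e : R) N, 0 < e -> exists2 n, (N <= n)%N & (u n <= e%:E)%E.
Proof.
move=> u0 iu e N e0.
have [c c0 hc] : exists2 c : R, 0 < c & forall n, (n < N)%N -> (c%:E <= u n)%E.
  elim: N => [|N [c c0 hc]]; first by exists 1.
  have [a a0 ha] : exists2 a : R, 0 < a & (a%:E <= u N)%E.
    have := u0 N; case: (u N) => [r| |] // r0; last by exists 1 => //; rewrite leey.
    by exists r => //; rewrite -lte_fin.
  exists (Num.min a c); first by rewrite lt_min a0.
  move=> n; rewrite ltnS leq_eqVlt => /predU1P[->|/hc h].
    by apply: le_trans ha; rewrite lee_fin ge_min lexx.
  by apply: le_trans h; rewrite lee_fin ge_min lexx orbT.
have : (ereal_inf (range u) < (Num.min c e)%:E)%E by rewrite iu lte_fin lt_min c0.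
move=> /ereal_inf_lt[_ [n _ <-] un]; exists n; last first.
  by apply: le_trans (ltW un) _; rewrite lee_fin ge_min lexx orbT.
rewrite leqNgt; apply/negP => /hc h; have := le_lt_trans h un.
by rewrite lte_fin lt_min ltxx.
Qed.

(** The later sets are removed, rather than the earlier ones, because they can be
    chosen small for the functions selected before. *)
Definition remove_later (E : nat -> set T) j := E j `\` \bigcup_i E (j + i).+1.

Lemma remove_later_disjoint E i j t : i != j ->
  remove_later E i t -> remove_later E j t -> False.
Proof.
wlog ij : i j / (i < j)%N => [h|_ [_ n] [Ej _]].
  rewrite neq_ltn => /orP[ij|ji] hi hj; [apply: (h i j)|apply: (h j i)] => //.
    by rewrite ltn_eqF.
  by rewrite ltn_eqF.
by apply: n; exists (j - i.+1)%N => //; rewrite -addSn subnKC.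
Qed.

Lemma remove_later_measurable E j : (forall i, measurable (E i)) -> measurable (remove_later E j).
Proof. by move=> mE; apply: measurableD => //; exact: bigcup_measurable. Qed.

Variables (x : nat -> Lrho k rho) (y : nat -> T -> K) (b : R).
Local Notation X := (fun n => Lrho_fun (x n)).
Local Notation F := (fun n t => y n t * Lrho_fun (x n) t).
Hypothesis Ly : forall n, in_L rhos (y n).
Hypothesis pairF : forall n, pairing mu (y n) (x n) = 1.
Hypothesis b0 : 0 <= b.
Hypothesis xb : forall n, rn (x n) <= b.
Hypothesis small : forall (e : R) N, 0 < e ->
  exists2 n, (N <= n)%N & (norm2 mu (eabs (y n)) <= e%:E)%E.

Let mX n : sc_measurable (X n). Proof. by case: (Lrho_in_L (x n)). Qed.
Let my n : sc_measurable (y n). Proof. by case: (Ly n). Qed.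
Let iF n : sc_integrable mu (F n).
Proof. exact: pairing_integrable (Ly n) (Lrho_in_L _). Qed.
Let mF n : sc_measurable (F n). Proof. by case: (iF n). Qed.

Lemma integral_le_norm2 : exists2 c : R, 0 < c & forall f : T -> K, sc_measurable f ->
  (\int[mu]_t eabs f t <= c%:E * norm2 mu (eabs f))%E.
Proof.
have [c hc] := fnorm_integral (L2_fnorm mu) measurableT (fin_num_fun_lty (@fin_num_measure _ _ _ mu)).
exists (`|c| + 1) => [|f mf]; first by rewrite ltr_wpDl.
apply: le_trans (hc _ (nneg_measurable_eabs mf)) _.
apply: lee_wpmul2r; first exact: Lnorm_ge0.
by rewrite lee_fin; have := ler_norm c; lra.
Qed.

(** Where [|X| <= M] the product [y X] is controlled by [M |y|]: a functional that is small
    in [L_2] takes almost all of its pairing where [X] is large. *)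
Lemma integral_cutoff_sublevel (M : R) n : 0 <= M ->
  (\int[mu]_t eabs (cutoff [set t | (modulus (X n t) <= M)%R] (F n)) t <=
   M%:E * \int[mu]_t eabs (y n) t)%E.
Proof.
move=> M0; have nY := nneg_measurable_eabs (my n).
rewrite -ge0_integralZl_EFin //; [|by case: nY|by case: nY].
apply: nneg_integral_le.
- by apply: nneg_measurable_eabs; apply: cutoff_measurable => //; exact: measurable_sublevel.
- exact: nneg_measurableZ.
- apply: nearW => t; rewrite -EFinM lee_fin.
  have [At|nAt] := pselect ([set t | (modulus (X n t) <= M)%R] t).
    by rewrite (cutoff_in _ At) modulusM mulrC ler_wpM2r ?modulus_ge0.
  by rewrite (cutoff_out _ nAt) modulus0 mulr_ge0 ?modulus_ge0.
Qed.

(** The bound [q] on the rounding parameters leaves room for further requirements. *)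
Lemma blocks_of_sets (s : nat -> nat) (A B : nat -> set T) (q : nat -> nat) :
  (forall j, measurable (A j)) -> (forall j, measurable (B j)) ->
  (forall j, A j `<=` B j) ->
  (forall j, \int[mu]_t eabs (cutoff (~` A j) (F (s j))) t <= (8^-1)%:E)%E ->
  exists p (phi psi : nat -> T -> K), forall j, (q j <= p j)%N /\
    simple_block (mu := mu) (X (s j)) (y (s j)) (A j) (B j) (p j) (phi j) (psi j).
Proof.
move=> mA mB AB hA.
have /choice[g hg] : forall j, exists g : nat * (T -> K) * (T -> K), (q j <= g.1.1)%N /\
    simple_block (mu := mu) (X (s j)) (y (s j)) (A j) (B j) g.1.1 g.1.2 g.2.
  move=> j; have [p0 hp0] := simple_block_exists (mA j) (mB j) (@AB j) (mX (s j)) (my (s j))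
    (iF (s j)) (pairF (s j)) (hA j).
  have [phi [psi h]] := hp0 (maxn p0 (q j)) (leq_maxl _ _).
  by exists (maxn p0 (q j), phi, psi); split=> //=; rewrite leq_maxr.
by exists (fun j => (g j).1.1), (fun j => (g j).1.2), (fun j => (g j).2).
Qed.

(** The blocks live where [|X_n|] exceeds a level that grows with the step. The sets
    have small measure since the [X_n] are bounded in [L_1], and they carry most of the
    pairing since [y_n] is small in [L_2]. *)
Lemma select_blocks : exists (s : nat -> nat) (A B : nat -> set T) p (phi psi : nat -> T -> K),
  [/\ {homo s : m n / (m < n)%N},
      forall i j t, i != j -> B i t -> B j t -> False,
      forall j, simple_block (mu := mu) (X (s j)) (y (s j)) (A j) (B j) (p j) (phi j) (psi j) &
      forall j t, A j t -> j%:R <= modulus (X (s j) t)].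
Proof.
have [c c0 hc] := integral_le_norm2.
pose E (M : R) n := [set t | M < modulus (X n t)].
pose good (j : nat) (M : R) n :=
  (\int[mu]_t eabs (cutoff [set t | (modulus (X n t) <= M)%R] (F n)) t <= (16^-1)%:E)%E.
have /choice[dl hdl] : forall n, exists dl : R, 0 < dl /\ forall A, measurable A ->
    (mu A <= dl%:E)%E -> (\int[mu]_t eabs (cutoff A (F n)) t <= (16^-1)%:E)%E.
  move=> n; have [dl dl0 h] := @integral_small _ _ _ _ _ _ 16^-1 (iF n) ltac:(lra).
  by exists dl.
have mE M n : measurable (E M n) by exact: measurable_superlevel.
have [I I0 hI] : exists2 I : R, 0 <= I & forall n, (\int[mu]_t eabs (X n) t <= I%:E)%E.
  have [c' hc'] := fnorm_integral rho measurableT (fin_num_fun_lty (@fin_num_measure _ _ _ mu)).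
  exists (`|c'| * b); first by rewrite mulr_ge0.
  move=> n; apply: le_trans (hc' _ (Lrho_nneg (x n))) _.
  rewrite -rn_Lrho -EFinM lee_fin; apply: le_trans (_ : `|c'| * rn (x n) <= _).
    by rewrite ler_wpM2r ?rn_ge0 ?ler_norm.
  by rewrite ler_wpM2l.
have [|j e e0|s [M [hs hM hgood htail]]] := @selection _ _ _ mu E good (fun _ n => dl n) mE.
- by move=> _ n; case: (hdl n).
- have Ie : 0 <= I / e by rewrite divr_ge0 // ltW.
  have j0 : 0 <= j%:R :> R by [].
  exists (j%:R + I / e + 1); first lra.
  set M := _ + 1; have M0 : 0 < M by rewrite /M; lra.
  move=> N; have [n Nn hn] := @small ((16 * M * c)^-1) N ltac:(by rewrite invr_gt0 !mulr_gt0).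
  exists n; split=> //.
    apply: le_trans (integral_cutoff_sublevel n (ltW M0)) _.
    apply: le_trans (lee_wpmul2l _ (hc _ (my n))) _; first by rewrite lee_fin ltW.
    apply: le_trans (lee_wpmul2l _ (lee_wpmul2l _ hn)) _; try by rewrite lee_fin ltW.
    rewrite -!EFinM lee_fin le_eqVlt; apply/orP; left; apply/eqP; field.
    by rewrite !gt_eqF.
  apply: le_trans (measure_superlevel_le (mX n) (hI n) M0) _.
  by rewrite lee_fin ler_pdivrMr // mulrC -ler_pdivrMr // /M; lra.
pose Es j := E (M j) (s j); pose B := remove_later Es.
have mEs j : measurable (Es j) by exact: mE.
have mB j : measurable (B j) by exact: remove_later_measurable.
have hcut j : (\int[mu]_t eabs (cutoff (~` B j) (F (s j))) t <= (8^-1)%:E)%E.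
  pose S := [set t | modulus (X (s j) t) <= M j].
  pose G := \bigcup_i Es (j + i).+1.
  have mS : measurable S by exact: measurable_sublevel.
  have mG : measurable G by exact: bigcup_measurable.
  have sub : ~` B j `<=` S `|` G.
    move=> t nB; have [Gt|nG] := pselect (G t); [by right|left].
    by rewrite /S /= leNgt; apply/negP => Et; apply: nB.
  apply: le_trans (integral_cutoff_cover (measurableC (mB j)) mS mG (mF (s j)) sub) _.
  apply: le_trans (leeD (hgood j) ((hdl (s j)).2 G mG (htail j))) _.
  by rewrite -EFinD lee_fin; lra.
have [p [phi [psi h]]] := @blocks_of_sets s B B (fun=> 0%N) mB mB (fun j => @subset_refl _ (B j)) hcut.
exists s, B, B, p, phi, psi; split=> //.
- exact: remove_later_disjoint.
- by move=> j; case: (h j).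
- by move=> j t [Et _]; apply: le_trans (hM j) (ltW Et).
Qed.

Section absolutely_continuous.
Hypothesis rhos_ac : absolutely_continuous_fnorm mu rhos.

(** The part of [y n] below the level [M] is at most a small constant plus [M] on a set
    that has small measure because [y n] is small in [L_2]. *)
Lemma assoc_cutoff_sublevel (M e : R) : 0 < M -> 0 < e ->
  exists2 h : R, 0 < h & forall n, (norm2 mu (eabs (y n)) <= h%:E)%E ->
    (rhos (eabs (cutoff [set t | (modulus (y n t) <= M)%R] (y n))) <= e%:E)%E.
Proof.
move=> M0 e0; have [c c0 hc] := integral_le_norm2.
have L1 : in_L rhos (fun=> 1 : K) by exact: assoc_one.
have [m1 l1] := L1; have n1 := nneg_measurable_eabs m1.
have r1f : rhos (eabs (fun=> 1 : K) : T -> \bar R) \is a fin_num by rewrite ge0_fin_numE ?assoc_ge0.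
set r1 := fine (rhos (eabs (fun=> 1 : K) : T -> \bar R)).
have r10 : 0 <= r1 by rewrite fine_ge0 ?assoc_ge0.
pose a := e / 2 / (r1 + 1).
have a0 : 0 < a by rewrite !divr_gt0 //; lra.
have eM0 : 0 < e / 2 / M by rewrite !divr_gt0.
have [dl dl0 hdl] := assoc_small rhos_ac L1 eM0.
exists (a * dl / c) => [|n hn]; first by apply: divr_gt0 => //; exact: mulr_gt0.
pose S := [set t | modulus (y n t) <= M]; rewrite -/S.
have mS : measurable S by exact: measurable_sublevel.
pose A := [set t | a < modulus (y n t)].
have mA : measurable A by exact: measurable_superlevel.
have muA : (mu A <= dl%:E)%E.
  have hI := le_trans (hc _ (my n)) (lee_wpmul2l (ltW c0 : (0 <= c%:E)%E) hn).
  rewrite -EFinM in hI; apply: le_trans (measure_superlevel_le (my n) hI a0) _.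
  by rewrite lee_fin le_eqVlt; apply/orP; left; apply/eqP; field; rewrite !gt_eqF.
have nA := nneg_measurable_eabs (cutoff_measurable mA m1).
apply: (@le_trans _ _ (rhos (fun t => (a%:E * eabs (fun=> 1%R : K) t +
    M%:E * eabs (cutoff A (fun=> 1%R)) t)%E))).
  apply: assoc_le; first exact/nneg_measurable_eabs/cutoff_measurable.
    by apply: nneg_measurableD; apply: nneg_measurableZ; [exact: ltW|exact: n1|exact: ltW|exact: nA].
  apply: nearW => t; rewrite /eabs modulus1 mule1 -EFinM -EFinD lee_fin.
  have [St|nSt] := pselect (S t); last first.
    rewrite (cutoff_out _ nSt) modulus0; apply: addr_ge0; first exact: ltW.
    by apply: mulr_ge0; [exact: ltW|exact: modulus_ge0].
  rewrite (cutoff_in _ St); have [At|nAt] := pselect (A t).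
    by rewrite (cutoff_in _ At) modulus1 mulr1; apply: le_trans St _; rewrite lerDr ltW.
  by rewrite (cutoff_out _ nAt) modulus0 mulr0 addr0 leNgt; apply/negP.
have na1 := nneg_measurableZ (ltW a0) n1; have nMA := nneg_measurableZ (ltW M0) nA.
apply: le_trans (assocD _ na1 nMA) _.
apply: le_trans (leeD (assocZ rho (ltW a0) n1) (assocZ rho (ltW M0) nA)) _.
apply: le_trans (leeD (lexx _) (lee_wpmul2l _ (hdl A mA muA))) _; first by rewrite lee_fin ltW.
rewrite -(fineK r1f) -!EFinM -EFinD lee_fin -/r1.
have -> : M * (e / 2 / M) = e / 2 by field; rewrite gt_eqF.
have : a * r1 <= e / 2.
  rewrite /a mulrAC ler_pdivrMr; last lra.
  by rewrite ler_wpM2l; lra.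
by set z := a * r1; lra.
Qed.

(** Here the supports are the sets where [|y_n|] is large. Absolute continuity makes [y_n]
    outside these sets small in the associate norm, so that [psi] is close to [y] and
    the pairing is concentrated where [|X_n|] is large as well. *)
Lemma select_close_blocks (ep : nat -> R) :
  (forall j, 0 < ep j) -> (forall j, ep j * (32 * (b + 1)) <= 1) ->
  exists (s : nat -> nat) (A B : nat -> set T) p (phi psi : nat -> T -> K),
  [/\ {homo s : m n / (m < n)%N},
      forall i j t, i != j -> B i t -> B j t -> False,
      forall j, simple_block (mu := mu) (X (s j)) (y (s j)) (A j) (B j) (p j) (phi j) (psi j),
      (forall j t, A j t -> j%:R <= modulus (X (s j) t)) /\
      (forall j t, B j t -> j%:R <= modulus (y (s j) t)) &
      forall j, (rhos (eabs (fun t => (y (s j) t - psi j t)%R)) <= (3 * ep j)%:E)%E].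
Proof.
move=> ep0 epb; have [c c0 hc] := integral_le_norm2.
pose E (M : R) n := [set t | M < modulus (y n t)].
pose low (M : R) n := cutoff [set t | (modulus (y n t) <= M)%R] (y n).
pose good (j : nat) (M : R) n :=
  (\int[mu]_t eabs (cutoff [set t | (modulus (X n t) <= M)%R] (F n)) t <= (16^-1)%:E)%E /\
  (rhos (eabs (low M n)) <= (ep j)%:E)%E.
have /choice[dl hdl] : forall q : nat * nat, exists dl : R, 0 < dl /\ forall A, measurable A ->
    (mu A <= dl%:E)%E -> (rhos (eabs (cutoff A (y q.2))) <= (ep q.1)%:E)%E.
  by move=> q; have [dl dl0 h] := assoc_small rhos_ac (Ly q.2) (ep0 q.1); exists dl.
have mE M n : measurable (E M n) by exact: measurable_superlevel.
have [|j e e0|s [M [hs hM hgood htail]]] := @selection _ _ _ mu E good (fun j n => dl (j, n)) mE.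
- by move=> j n; case: (hdl (j, n)).
- have j0 : 0 <= j%:R :> R by [].
  exists (j%:R + 1); first lra.
  set M := _ + 1; have M0 : 0 < M by rewrite /M; lra.
  have [h h0 hh] := assoc_cutoff_sublevel M0 (ep0 j).
  pose h1 := (16 * M * c)^-1; have h10 : 0 < h1 by rewrite invr_gt0 !mulr_gt0.
  pose h2 := e * M / c; have h20 : 0 < h2 by rewrite divr_gt0 ?mulr_gt0.
  move=> N; have [n Nn] := @small (Num.min h (Num.min h1 h2)) N ltac:(by rewrite !lt_min h0 h10).
  have -> : (norm2 mu (eabs (y n)) <= (Num.min h (Num.min h1 h2))%:E)%E =
      [&& (norm2 mu (eabs (y n)) <= h%:E)%E, (norm2 mu (eabs (y n)) <= h1%:E)%E &
          (norm2 mu (eabs (y n)) <= h2%:E)%E].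
    by rewrite !EFin_min !le_min.
  move=> /and3P[hn hn1 hn2].
  exists n; split=> //.
    split; last exact: hh.
    apply: le_trans (integral_cutoff_sublevel n (ltW M0)) _.
    apply: le_trans (lee_wpmul2l _ (hc _ (my n))) _; first by rewrite lee_fin ltW.
    apply: le_trans (lee_wpmul2l _ (lee_wpmul2l _ hn1)) _; try by rewrite lee_fin ltW.
    rewrite -!EFinM lee_fin /h1 le_eqVlt; apply/orP; left; apply/eqP; field.
    by rewrite !gt_eqF.
  have hI := le_trans (hc _ (my n)) (lee_wpmul2l (ltW c0 : (0 <= c%:E)%E) hn2).
  rewrite -EFinM in hI; apply: le_trans (measure_superlevel_le (my n) hI M0) _.
  by rewrite lee_fin /h2 le_eqVlt; apply/orP; left; apply/eqP; field; rewrite !gt_eqF.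
pose Es j := E (M j) (s j); pose B := remove_later Es.
pose A j := B j `&` [set t | M j < modulus (X (s j) t)].
pose G j := \bigcup_i Es (j + i).+1.
pose S j := [set t | modulus (y (s j) t) <= M j].
have mEs j : measurable (Es j) by exact: mE.
have mB j : measurable (B j) by exact: remove_later_measurable.
have mA j : measurable (A j) by apply: measurableI => //; exact: measurable_superlevel.
have mG j : measurable (G j) by exact: bigcup_measurable.
have mS j : measurable (S j) by exact: measurable_sublevel.
have subB j : ~` B j `<=` S j `|` G j.
  move=> t nB; have [Gt|nG] := pselect (G j t); [by right|left].
  by rewrite /S /= leNgt; apply/negP => Et; apply: nB.
have yB j : (rhos (eabs (cutoff (~` B j) (y (s j)))) <= (2 * ep j)%:E)%E.
  apply: (@le_trans _ _ (rhos (fun t => (eabs (cutoff (S j) (y (s j))) t +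
      eabs (cutoff (G j) (y (s j))) t)%E))).
    apply: assoc_le.
    - by apply/nneg_measurable_eabs/cutoff_measurable => //; exact: measurableC.
    - by apply: nneg_measurableD; exact/nneg_measurable_eabs/cutoff_measurable.
    - by apply: nearW => t; exact: cutoff_cover.
  apply: le_trans (assocD _ _ _) _; try exact/nneg_measurable_eabs/cutoff_measurable.
  have [_ h1] := hgood j; have h2 := (hdl (j, s j)).2 (G j) (mG j) (htail j).
  by apply: le_trans (leeD h1 h2) _; rewrite -EFinD lee_fin /=; lra.
have FB j : (\int[mu]_t eabs (cutoff (~` B j) (F (s j))) t <= (16^-1)%:E)%E.
  have mBy : in_L rhos (cutoff (~` B j) (y (s j))).
    split; first by apply: cutoff_measurable => //; exact: measurableC.
    by apply: le_lt_trans (yB j) _; exact: ltry.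
  rewrite (eq_integral (fun t => eabs (cutoff (~` B j) (y (s j))) t * eabs (X (s j)) t)%E); last first.
    move=> t _; rewrite -eabsM /eabs; congr (modulus _)%:E.
    by rewrite /cutoff; case: ifP; rewrite ?mul0r.
  apply: le_trans (pairing_integral_le mBy (Lrho_in_L _)) _; rewrite -rn_Lrho.
  apply: le_trans (lee_wpmul2r _ (yB j)) _; first by rewrite lee_fin rn_ge0.
  rewrite -EFinM lee_fin; apply: le_trans (_ : 2 * ep j * (b + 1) <= _).
    rewrite ler_wpM2l //; first by rewrite mulr_ge0 // ltW.
    by apply: le_trans (xb _) _; lra.
  have -> : 2 * ep j * (b + 1) = 16^-1 * (ep j * (32 * (b + 1))) by field.
  by rewrite ler_piMr.
have hcut j : (\int[mu]_t eabs (cutoff (~` A j) (F (s j))) t <= (8^-1)%:E)%E.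
  pose S' := [set t | modulus (X (s j) t) <= M j].
  have mS' : measurable S' by exact: measurable_sublevel.
  have sub : ~` A j `<=` S' `|` ~` B j.
    move=> t nA; have [Bt|nB] := pselect (B j t); [left|by right].
    by rewrite /S' /= leNgt; apply/negP => Xt; apply: nA.
  apply: le_trans (integral_cutoff_cover (measurableC (mA j)) mS' (measurableC (mB j)) (mF (s j)) sub) _.
  apply: le_trans (leeD (hgood j).1 (FB j)) _.
  by rewrite -EFinD lee_fin; lra.
have /choice[q hq] := fun j => assoc_round_small rhos_ac (Ly (s j)) (ep0 j).
have AB j : A j `<=` B j by move=> t [].
have [p [phi [psi h]]] := @blocks_of_sets s A B q mA mB AB hcut.
exists s, A, B, p, phi, psi; split=> //.
- exact: remove_later_disjoint.
- by move=> j; case: (h j).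
- split=> j t; first by case=> _ /ltW; exact: le_trans.
  by case=> /ltW Et _; exact: le_trans (hM j) Et.
- move=> j; have [qp [[mphi mpsi _ _] [_ psi0 _ _] _ _ psiB]] := h j.
  pose rd t := y (s j) t - round_fun (p j) (y (s j)) t.
  have mrd : sc_measurable rd by apply: sc_measurableB => //; exact: round_fun_measurable.
  have nB : nneg_measurable (eabs (cutoff (~` B j) (y (s j)))).
    by apply/nneg_measurable_eabs/cutoff_measurable => //; exact: measurableC.
  apply: (@le_trans _ _ (rhos (fun t => (eabs (cutoff (~` B j) (y (s j))) t + eabs rd t)%E))).
    apply: assoc_le.
    - exact/nneg_measurable_eabs/sc_measurableB.
    - by apply: nneg_measurableD => //; exact: nneg_measurable_eabs.
    - apply: nearW => t; rewrite /eabs -EFinD lee_fin; have [Bt|nBt] := pselect (B j t).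
        by rewrite psiB // lerDr modulus_ge0.
      by rewrite psi0 // subr0 cutoff_in // lerDl modulus_ge0.
  apply: le_trans (assocD _ nB _) _; first exact: nneg_measurable_eabs.
  by apply: le_trans (leeD (yB j) (hq j _ qp)) _; rewrite -EFinD lee_fin; lra.
Qed.

End absolutely_continuous.

End selecting_blocks.

(** * Sequences of blocks *)

Section conclusions.
Context {d : measure_display} {T : measurableType d} {R : realType}.
Context {k : scalar_kind} {mu : {measure set T -> \bar R}} {rho : function_norm mu}.
Local Notation K := (scalar_field R k).
Local Notation rhos := (assoc_fnorm mu rho).

(** The bound [n%:R - 2] grows with [n], and only points of the support matter. *)
Lemma escapes_of_lower_bound (f : nat -> T -> K) :
  (forall n, {ae mu, forall t, f n t != 0 -> n%:R - 2 <= 2 * modulus (f n t)}) ->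
  escapes_to_infinity mu f.
Proof.
move=> hf; apply/cvgeyPge => r; near=> n.
apply/ess_infP; apply: filterS (hf n) => t; case: eqVneq => [_ _|_ /(_ isT) h]; first exact: leey.
rewrite lee_fin; have : (Num.truncn (2 * r + 2)).+1%:R <= n%:R :> R.
  by rewrite ler_nat; near: n; exact: nbhs_infty_ge.
have := truncnS_gt (2 * r + 2); lra.
Unshelve. all: by end_near.
Qed.

Variables (x : nat -> Lrho k rho) (y : nat -> T -> K) (C : R).
Hypothesis C0 : 0 <= C.
Hypothesis Ly : forall n, in_L rhos (y n).
Hypothesis bxy : biorthogonal (function_functionals (rho := rho) y) x.
Hypothesis sxy : sign_bounded (function_functionals (rho := rho) y) x C.
Hypothesis cotype : rademacher_cotype2 (Lrho k rho).
Variables (A B : nat -> set T) (p : nat -> nat) (phi psi : nat -> T -> K).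
Hypothesis dB : forall i j t, i != j -> B i t -> B j t -> False.
Hypothesis blocks : forall n,
  simple_block (mu := mu) (Lrho_fun (x n)) (y n) (A n) (B n) (p n) (phi n) (psi n).

Local Notation Phi := (fun n => Lof rho (phi n)).
Local Notation fy := (function_functionals (rho := rho) y).
Local Notation fpsi := (function_functionals (rho := rho) psi).

Let mphi n : sc_measurable (phi n). Proof. by have [[]] := blocks n. Qed.
Let mpsi n : sc_measurable (psi n). Proof. by have [[]] := blocks n. Qed.
Let phi0 n t : ~ B n t -> phi n t = 0. Proof. by have [_ [h _ _ _] _ _ _] := blocks n; exact: h. Qed.
Let psi0 n t : ~ B n t -> psi n t = 0. Proof. by have [_ [_ h _ _] _ _ _] := blocks n; exact: h. Qed.
Let phi_le n t : modulus (phi n t) <= 2 * modulus (Lrho_fun (x n) t).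
Proof. by have [_ []] := blocks n. Qed.
Let psi_le n t : modulus (psi n t) <= modulus (y n t).
Proof. by have [_ []] := blocks n. Qed.
Let pair1 n : pairing mu (psi n) (phi n) = 1. Proof. by have [] := blocks n. Qed.

Let Lphi n : in_L rho (phi n). Proof. exact: block_in_L mphi phi_le n. Qed.
Let Lpsi : forall n, in_L rhos (psi n). Proof. by move=> n; exact: (block_in_L_assoc Ly mpsi psi_le). Qed.
Let lpsi : linear_functionals fpsi. Proof. exact: function_functionals_linear. Qed.
Let ly : linear_functionals fy. Proof. exact: function_functionals_linear. Qed.
Let bphi : biorthogonal fpsi Phi.
Proof. exact: (block_biorthogonal dB mphi mpsi phi0 psi0 phi_le pair1). Qed.
Let sphi : sign_bounded fpsi Phi (2 * C * C).
Proof. exact: (block_sign_bounded C0 Ly bxy sxy dB). Qed.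
Let dom1 : finite_dominated x Phi (2 * C).
Proof. exact: (block_dominated Ly bxy sxy dB mphi phi0 phi_le). Qed.
Let dom2 : finite_dominated Phi x C.
Proof. exact: (block_dominates C0 Ly sxy dB mphi mpsi phi0 psi0 phi_le psi_le pair1). Qed.

Let ae_Phi : {ae mu, forall t n, Lrho_fun (Phi n) t = phi n t}.
Proof. by apply/ae_foralln => n; exact: Lof_ae. Qed.

Lemma blocks_good_projecting : good_projecting_functions Phi psi.
Proof.
split.
  by split=> //; apply: sign_bounded_projecting sphi => //; exact: Lrho_banach.
move=> n m /eqP nm; apply: nearW => t.
have [Bn|nBn] := pselect (B n t); last by left; exact: psi0.
by right; apply: psi0 => Bm; exact: dB nm Bn Bm.
Qed.

Lemma blocks_well_complemented : well_complemented Phi.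
Proof.
split.
- move=> n; apply/eqP => P0; have := bphi n n.
  by rewrite P0 functional0 // eqxx => /eqP; rewrite eq_sym oner_eq0.
- move=> n m /eqP nm; apply: filterS ae_Phi => t h; rewrite !h.
  have [Bn|nBn] := pselect (B n t); last by left; exact: phi0.
  by right; apply: phi0 => Bm; exact: dB nm Bn Bm.
- by apply: sign_bounded_unconditional sphi => //; exact: Lrho_banach.
- have [P [_ hP _]] := sign_bounded_projection (@Lrho_banach _ _ _ _ _ _) cotype lpsi bphi sphi.
  by exists P.
- by exists psi; exact: blocks_good_projecting.
Qed.

Lemma blocks_equivalent : equivalent_seq x Phi.
Proof.
by apply: equivalent_seq_of_dominated dom1 dom2; exact: Lrho_banach.
Qed.

Lemma blocks_simple n : simple_function mu (Lrho_fun (Phi n)) /\ simple_function mu (psi n).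
Proof.
have [[m1 m2 f1 f2] _ _ _ _] := blocks n; split.
  by exists (phi n); split=> //; exact: Lof_ae.
by exists (psi n); split=> //; exact: nearW.
Qed.

Lemma blocks_escape : (forall n t, A n t -> n%:R <= modulus (Lrho_fun (x n) t)) ->
  escapes_to_infinity mu (fun n => Lrho_fun (Phi n)).
Proof.
move=> hA; apply: escapes_of_lower_bound => n; apply: filterS ae_Phi => t ->.
have [_ _ _ [h _] _] := blocks n => /h[/hA Xn]; apply: le_trans; lra.
Qed.

Lemma blocks_functionals_escape : (forall n t, B n t -> n%:R <= modulus (y n t)) ->
  escapes_to_infinity mu psi.
Proof.
move=> hB; apply: escapes_of_lower_bound => n; apply: nearW => t.
have [_ _ _ [_ h] _] := blocks n => /h[/hB Yn]; have := modulus_ge0 (psi n t); lra.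
Qed.

(** When the good projecting functionals are summably close to the original ones, the
    operator [u |-> sum (y_n - psi_n)(u) phi_n] has norm less than one. *)
Lemma blocks_congruent (ep : nat -> R) (b : R) : 0 <= b ->
  (forall n, rn (x n) <= b) -> (forall n, ep n * (48 * (b + 1)) <= 2^-1 ^+ n) ->
  (forall n, 0 < ep n) ->
  (forall n, (rhos (eabs (fun t => (y n t - psi n t)%R)) <= (3 * ep n)%:E)%E) ->
  congruent x Phi.
Proof.
move=> b0 xb epb ep0 close.
have M0 : 0 <= 2 * C * C by rewrite !mulr_ge0.
have Q0 : 0 <= C * (2 * C * C) by rewrite mulr_ge0.
pose D := C + 2 * C * C + C * (2 * C * C).
have CD : C <= D by rewrite /D -addrA lerDl addr_ge0.
have MD : 2 * C * C <= D by rewrite /D addrAC lerDr addr_ge0.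
have QD : C * (2 * C * C) <= D by rewrite /D lerDr addr_ge0.
have weaken (f : nat -> Lrho k rho -> K) z c : sign_bounded f z c -> c <= D -> sign_bounded f z D.
  by move=> h cD L e u uL; apply: le_trans (h L e u uL) _; rewrite ler_wpM2r ?rn_ge0.
apply: (@congruent_of_close _ _ _ (@Lrho_banach _ _ _ _ _ _) cotype fy x fpsi Phi D) => //.
- exact: weaken sxy CD.
- exact: weaken sphi MD.
- exact: weaken (sign_bounded_dominated C0 dom2 sphi) QD.
- by apply: weaken (sign_bounded_dominated _ dom1 sxy) MD; rewrite mulr_ge0.
move=> N u.
have dyp i : in_L rhos (fun t => y i t - psi i t).
  split; first by apply: sc_measurableB => //; case: (Ly i).
  by apply: le_lt_trans (close i) _; exact: ltry.
have fE i : fy i u - fpsi i u = pairing mu (fun t => y i t - psi i t) (Lrho_fun u).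
  have i1 := pairing_integrable (Ly i) (Lrho_in_L u).
  have i2 := pairing_integrable (dyp i) (Lrho_in_L u).
  have i3 := pairing_integrable (Lpsi i) (Lrho_in_L u).
  apply/eqP; rewrite subr_eq; apply/eqP.
  rewrite /function_functionals /pairing -sc_integralD //.
  by congr sc_integral; apply/funext => t; rewrite -mulrDl subrK.
have term i : rn ((fy i u - fpsi i u) *: Phi i) <= 4^-1 * 2^-1 ^+ i * rn u.
  rewrite rnZ fE.
  have h1 : modulus (pairing mu (fun t => y i t - psi i t) (Lrho_fun u)) <= 2 * (3 * ep i) * rn u.
    apply: le_trans (pairing_bound u (dyp i)) _; rewrite ler_wpM2r ?rn_ge0 // ler_wpM2l //.
    rewrite -lee_fin fineK; first exact: close.
    by rewrite ge0_fin_numE ?assoc_ge0 //; case: (dyp i).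
  have h2 : rn (Phi i) <= 2 * b.
    rewrite -lee_fin rn_Lof //.
    apply: le_trans (_ : rho (fun t => 2%:E * eabs (Lrho_fun (x i)) t)%E <= _)%E.
      apply: fnorm_le; [exact: nneg_measurable_eabs|exact/nneg_measurableZ/Lrho_nneg|].
      by move=> t; rewrite -EFinM lee_fin.
    by rewrite fnormZ //; [rewrite -rn_Lrho -EFinM lee_fin ler_wpM2l|exact: Lrho_nneg].
  apply: le_trans (ler_pM (modulus_ge0 _) (rn_ge0 _) h1 h2) _.
  rewrite mulrAC ler_wpM2r ?rn_ge0 //.
  have : 2 * (3 * ep i) * (2 * b) <= 4^-1 * (ep i * (48 * (b + 1))).
    by have := ep0 i; set e := ep i => e0; have : 0 <= e * b by [rewrite mulr_ge0 // ltW]; lra.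
  move=> /le_trans; apply; by rewrite ler_wpM2l.
apply: le_trans (rn_sum _ _) _; apply: le_trans (ler_sum _ (fun (i : 'I_N) _ => term i)) _.
rewrite -mulr_suml ler_wpM2r ?rn_ge0 // -mulr_sumr.
have := @geometric_partial_sum R 0 N; rewrite sumEFin lee_fin expr0 mulr1 big_mkord.
by set z := \sum_(i < N) _; lra.
Qed.

End conclusions.

(** * The dichotomy *)

Lemma seminormalized_rn (R : realType) (k : scalar_kind) (V : normedModType (scalar_field R k))
  (x : nat -> V) : seminormalized x ->
  exists a b : R, [/\ 0 < a, 0 <= b & forall n, a <= rn (x n) <= b].
Proof.
move=> [a [b [a0 hab]]].
have b0 : 0 <= b by have /andP[h1 h2] := hab 0%N; exact: le_trans (ltW a0) (le_trans h1 h2).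
have [ra aE] := sc_mk_ge0 (ltW a0); have [rb bE] := sc_mk_ge0 b0.
exists (sc_re a), (sc_re b); split=> //.
  by rewrite lt_neqAle ra andbT; apply/eqP => h; move: a0; rewrite aE -h sc_mk0 ltxx.
by move=> n; have := hab n; rewrite aE bE rnE !sc_mk_le -aE -bE.
Qed.

(** Guarantees that an infimum equal to zero is not attained. *)
Lemma norm2_gt0_of_pairing (R : realType) (k : scalar_kind) (d : measure_display)
    (T : measurableType d) (mu : {measure set T -> \bar R}) (y u : T -> scalar_field R k) :
  sc_measurable y -> sc_measurable u -> pairing mu y u = 1 -> (0 < norm2 mu (eabs y))%E.
Proof.
move=> my mu' p1; have ny := nneg_measurable_eabs my.
rewrite lt_neqAle norm2_eabs_ge0 andbT; apply/eqP => /esym/(fnorm_eq0 (L2_fnorm mu) ny) y0.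
have : pairing mu y u = 0.
  rewrite -(sc_integral0 mu); apply: sc_integral_ae.
  - exact: sc_measurableM.
  - exact: sc_measurable0.
  - by apply: filterS y0 => t [/modulus_eq0 ->]; rewrite mul0r.
by rewrite p1 => /eqP; rewrite oner_eq0.
Qed.

Theorem theorem4p7 (R : realType) (k : scalar_kind) (d : measure_display)
    (T : measurableType d) (mu : {finite_measure set T -> \bar R})
    (rho : function_norm mu)
    (L2_sub_Lrho : forall f : T -> scalar_field R k,
       in_L (norm2 mu) f -> in_L rho f)
    (cotype2_Lrho : rademacher_cotype2 (Lrho k rho))
    (Psi : nat -> Lrho k rho) (Psi_star : nat -> T -> scalar_field R k)
    (Psi_semi : seminormalized Psi)
    (Psi_compl : complemented Psi)
    (Psi_uncond : unconditional_basic Psi)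
    (Psi_star_proj : projecting_functions Psi Psi_star) :
  ((0 < ereal_inf (range (fun n => norm2 mu (eabs (Psi_star n)))))%E ->
     equivalent_seq Psi (@ell2_unit R k))
  /\
  (ereal_inf (range (fun n => norm2 mu (eabs (Psi_star n)))) = 0%E ->
     (exists (s : nat -> nat) (Phi : nat -> Lrho k rho)
             (Phi_star : nat -> T -> scalar_field R k),
        {homo s : m n / (m < n)%N} /\
        equivalent_seq (Psi \o s) Phi /\
        well_complemented Phi /\
        good_projecting_functions Phi Phi_star /\
        escapes_to_infinity mu (fun n => Phi n : T -> scalar_field R k) /\
        (forall n, simple_function mu (Phi n : T -> scalar_field R k)) /\
        (forall n, simple_function mu (Phi_star n)))
     /\
     (absolutely_continuous_fnorm mu (assoc_fnorm mu rho) ->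
      exists (s : nat -> nat) (Phi : nat -> Lrho k rho)
             (Phi_star : nat -> T -> scalar_field R k),
        {homo s : m n / (m < n)%N} /\
        congruent (Psi \o s) Phi /\
        well_complemented Phi /\
        good_projecting_functions Phi Phi_star /\
        escapes_to_infinity mu (fun n => Phi n : T -> scalar_field R k) /\
        escapes_to_infinity mu Phi_star /\
        (forall n, simple_function mu (Phi n : T -> scalar_field R k)) /\
        (forall n, simple_function mu (Phi_star n)))).
Proof.
have [a [b [a0 b0 hab]]] := seminormalized_rn Psi_semi.
have xb n : rn (Psi n) <= b by case/andP: (hab n).
have [Ly proj] := Psi_star_proj.
have lf := function_functionals_linear Ly.
have bounded n : exists c : R, forall u : Lrho k rho,
    modulus (function_functionals Psi_star n u) <= c * rn u.
  by exists (2 * fine (assoc_fnorm mu rho (eabs (Psi_star n)))) => u; exact: pairing_bound.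
have [bxy [C C0 sxy]] := unconditional_sign_bounded (@Lrho_banach _ _ _ _ _ rho) lf bounded
  Psi_uncond proj.
have pairF n : pairing mu (Psi_star n) (Lrho_fun (Psi n)) = 1.
  by have := bxy n n; rewrite eqxx.
split=> [inf0|inf0].
  have [D D0 hD] := L2_embedding L2_sub_Lrho.
  have [dl dl0 hdl] : exists2 dl : R, 0 < dl & forall n, (dl%:E <= norm2 mu (eabs (Psi_star n)))%E.
    move: inf0; case E : (ereal_inf _) => [r| |] // r0.
      by exists r; rewrite -?lte_fin // => n; rewrite -E; apply: ereal_inf_lbound; exists n.
    exists 1 => // n; apply: le_trans (leey _) _; rewrite -E.
    by apply: ereal_inf_lbound; exists n.
  apply: (equivalent_ell2 C0 D0 a0 dl0 cotype2_Lrho Ly bxy sxy hD _ hdl).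
  by move=> n; case/andP: (hab n).
have small := frequently_small (fun n => norm2_gt0_of_pairing (Ly n).1 (Lrho_in_L (Psi n)).1 (pairF n)) inf0.
have sI (s : nat -> nat) : {homo s : m n / (m < n)%N} -> injective s.
  move=> hs m n; case: (ltngtP m n) => // /hs + E; by rewrite E ltnn.
split=> [|rhos_ac].
  (* The blocks are built from the large values of [Psi]. *)
  have [s [A [B [p [phi [psi [hs dB blocks hA]]]]]]] := select_blocks Ly pairF b0 xb small.
  have bs := biorthogonal_reindex (sI s hs) bxy; have ss := sign_bounded_reindex (sI s hs) sxy.
  exists s, (fun n => Lof rho (phi n)), psi; split; first exact: hs.
  split; first exact: (blocks_equivalent C0 (fun n => Ly (s n)) bs ss dB blocks).
  split; first exact: (blocks_well_complemented C0 (fun n => Ly (s n)) bs ss cotype2_Lrho dB blocks).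
  split; first exact: (blocks_good_projecting C0 (fun n => Ly (s n)) bs ss cotype2_Lrho dB blocks).
  split; first exact: (blocks_escape blocks hA).
  by split=> n; case: (blocks_simple blocks n).
(* The functionals are approximated with a summable error, small enough for
   [blocks_congruent]. *)
pose ep n : R := 2^-1 ^+ n / (48 * (b + 1)).
have b1 : 0 < 48 * (b + 1) by lra.
have ep0 n : 0 < ep n by rewrite divr_gt0 // exprn_gt0 // invr_gt0.
have epE n : ep n * (48 * (b + 1)) = 2^-1 ^+ n by rewrite divfK // gt_eqF.
have ep32 n : ep n * (32 * (b + 1)) <= 1.
  apply: le_trans (_ : ep n * (48 * (b + 1)) <= _); first by rewrite ler_wpM2l ?ltW //; lra.
  by rewrite epE exprn_ile1 //; lra.
have [s [A [B [p [phi [psi [hs dB blocks [hA hB] close]]]]]]] :=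
  select_close_blocks Ly pairF xb small rhos_ac ep0 ep32.
have bs := biorthogonal_reindex (sI s hs) bxy; have ss := sign_bounded_reindex (sI s hs) sxy.
exists s, (fun n => Lof rho (phi n)), psi; split; first exact: hs.
split.
  apply: (blocks_congruent C0 (fun n => Ly (s n)) bs ss cotype2_Lrho dB blocks b0 _ _ ep0 close).
    by move=> n; exact: xb.
  by move=> n; rewrite epE.
split; first exact: (blocks_well_complemented C0 (fun n => Ly (s n)) bs ss cotype2_Lrho dB blocks).
split; first exact: (blocks_good_projecting C0 (fun n => Ly (s n)) bs ss cotype2_Lrho dB blocks).
split; first exact: (blocks_escape blocks hA).
split; first exact: (blocks_functionals_escape blocks hB).
by split=> n; case: (blocks_simple blocks n).
Qed.
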